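(* Let $A$ be a commutative noetherian local dg algebra with residue field $k$, let $B$ be the Koszul complex over $A$ on a list $f_1,\dots,f_c\in\mathfrak m_0$, with structure map $\varphi\colon A\to B$, and let $\mathcal S=k[\chi_1,\dots,\chi_c]$. Given an exact triangle $L\to M\to N\to$ in $\mathsf D^{\mathrm b}(B/A)$, there is for each $l\ge0$ the containment $$\mathrm V^l_\varphi(M)\subseteq\bigcup_{i+j=l}\mathrm V^i_\varphi(L)\cap\mathrm V^j_\varphi(N),$$ where $i,j$ range over nonnegative integers; equality holds when $M\to N$ admits a section.
   Context: Setting. $A=\{A_i\}_{i\ge 0}$ is a commutative noetherian local dg algebra: a nonnegatively graded, strictly graded-commutative dg algebra such that $A_0$ is a commutative noetherian local ring with maximal ideal $\mathfrak m_0$ and residue field $k$, and each $\mathrm H_i(A)$ is finitely generated over $\mathrm H_0(A)$. $B=A\langle e_1,\dots,e_c\mid\partial e_i=f_i\rangle$ is the exterior algebra over $A$ on degree $1$ variables $e_i$, with differential extended by the Leibniz rule; $k$ is a dg $A$-module and dg $B$-module via the augmentations. $\mathsf D(A)$, $\mathsf D(B)$ are the derived categories of dg modules. $\mathsf D^{\mathrm b}(B/A)$ is the full subcategory of $\mathsf D(B)$ of dg $B$-modules which are perfect over $A$, i.e. whose restriction lies in the smallest thick subcategory of $\mathsf D(A)$ containing $A$. Cohomology operators. $\mathcal S=k[\chi_1,\dots,\chi_c]$ with each $\chi_i$ in cohomological degree $2$. For $M$ in $\mathsf D^{\mathrm b}(B/A)$ choose a semifree resolution $F\xrightarrow{\simeq}M$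 over $B$; then $\mathrm{RHom}_B(M,k)$ is represented by the dg $\mathcal S$-module $\mathrm{Hom}_A(F,k)\otimes_k\mathcal S$ with differential $\partial^{\mathrm{Hom}(F,k)}\otimes 1+\sum_{i=1}^c\mathrm{Hom}(e_i-,k)\otimes\chi_i$ (where $\mathrm{Hom}(e_i-,k)$ is precomposition with multiplication by $e_i$, with the usual Koszul sign $g\mapsto(-1)^{|g|}g(e_i-)$); it is independent of $F$ up to quasi-isomorphism. Jump loci. $\mathrm{Spec}\,\mathcal S$ is the set of homogeneous prime ideals of $\mathcal S$ with the Zariski topology. For $\mathfrak p\in\mathrm{Spec}\,\mathcal S$, $\kappa(\mathfrak p)=\mathcal S_{\mathfrak p}/\mathfrak p\mathcal S_{\mathfrak p}$ (homogeneous localization), a graded field, over which finitely generated graded modules are free and have a rank. $\mathrm{crk}_{\mathfrak p}(M)=\mathrm{rank}_{\kappa(\mathfrak p)}\mathrm H(\mathrm{RHom}_B(M,k)\otimes^{\mathsf L}_{\mathcal S}\kappa(\mathfrak p))$ and $\mathrm V^i_\varphi(M)=\{\mathfrak p\in\mathrm{Spec}\,\mathcal S:\mathrm{crk}_{\mathfrak p}(M)\geqslant i\}$. *)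

(* Defs.v *)
From HB Require Import structures.
From mathcomp Require Import all_boot all_order all_algebra.
From mathcomp Require Import generic_quotient ring_quotient fraction zify.
From mathcomp Require Import boolp.
From mathcomp Require Import mpoly.

Set Implicit Arguments.
Unset Strict Implicit.
Unset Printing Implicit Defensive.

Import Order.TTheory GRing.Theory Num.Theory.
Local Open Scope quotient_scope.
Local Open Scope ring_scope.

(* Conventions.  All gradings are homological and indexed by int, and all
   differentials have degree -1; cohomological degree d is degree -d.  A graded
   object is the family of its homogeneous components.  A product of elements
   of degrees i and j is placed in degree n for every proof of i + j = n, so
   that no transport between components is ever needed. *)

Definition ksign (i : int) (V : zmodType) (x : V) : V :=
  if odd (absz i) then - x else x.
Arguments ksign i {V} x.

Lemma odd_abszD (i j : int) : odd (absz (i + j)) = odd (absz i) (+) odd (absz j).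
Proof. lia. Qed.

Lemma odd_abszB1 (i : int) : odd (absz (i - 1)) = ~~ odd (absz i).
Proof. lia. Qed.

Section KsignTheory.
Variable V : zmodType.
Implicit Types (i j : int) (x y : V).

Lemma ksignD i x y : ksign i (x + y) = ksign i x + ksign i y.
Proof. by rewrite /ksign; case: ifP; rewrite ?opprD. Qed.

Lemma ksignN i x : ksign i (- x) = - ksign i x.
Proof. by rewrite /ksign; case: ifP. Qed.

Lemma ksignB i x y : ksign i (x - y) = ksign i x - ksign i y.
Proof. by rewrite ksignD ksignN. Qed.

Lemma ksign_0 i : ksign i (0 : V) = 0.
Proof. by rewrite /ksign oppr0 if_same. Qed.

Lemma ksign_add i j x : ksign (i + j) x = ksign i (ksign j x).
Proof.
by rewrite /ksign odd_abszD; case: odd; case: odd => //=; rewrite opprK.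
Qed.

Lemma ksign_pred i x : ksign (i - 1) x = - ksign i x.
Proof. by rewrite /ksign odd_abszB1; case: odd => //=; rewrite opprK. Qed.

Lemma ksignK i x : ksign i (ksign i x) = x.
Proof. by rewrite /ksign; case: odd => //; rewrite opprK. Qed.

Lemma ksignC i j x : ksign i (ksign j x) = ksign j (ksign i x).
Proof. by rewrite -!ksign_add addrC. Qed.

End KsignTheory.

Lemma ksign_pair (U V : zmodType) i (p : U * V) :
  ksign i p = (ksign i p.1, ksign i p.2).
Proof. by rewrite /ksign; case: odd => //; case: p. Qed.

Record dgAlg := DgAlg {
  ga :> int -> zmodType;
  gmul : forall {i j n : int}, i + j = n -> ga i -> ga j -> ga n;
  gone : ga 0;
  gd : forall {n : int}, ga n -> ga (n - 1);
  gmulDl : forall i j n (h : i + j = n) (x y : ga i) (z : ga j),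
    gmul h (x + y) z = gmul h x z + gmul h y z;
  gmulDr : forall i j n (h : i + j = n) (x : ga i) (y z : ga j),
    gmul h x (y + z) = gmul h x y + gmul h x z;
  gmulA : forall i j l ij jl n (h1 : i + j = ij) (h2 : ij + l = n)
      (h3 : j + l = jl) (h4 : i + jl = n) (x : ga i) (y : ga j) (z : ga l),
    gmul h2 (gmul h1 x y) z = gmul h4 x (gmul h3 y z);
  gmul1l : forall n (h : 0 + n = n) (x : ga n), gmul h gone x = x;
  gmul1r : forall n (h : n + 0 = n) (x : ga n), gmul h x gone = x;
  gdD : forall n (x y : ga n), gd (x + y) = gd x + gd y;
  gdd : forall n (x : ga n), gd (gd x) = 0;
  gleibniz : forall i j n (h : i + j = n) (h1 : i - 1 + j = n - 1)
      (h2 : i + (j - 1) = n - 1) (x : ga i) (y : ga j),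
    gd (gmul h x y) = gmul h1 (gd x) y + ksign i (gmul h2 x (gd y))
}.

Definition strictly_graded_commutative (A : dgAlg) : Prop :=
  (forall (i j n : int) (h : i + j = n) (h' : j + i = n) (x : A i) (y : A j),
     gmul h x y = ksign (i * j) (gmul h' y x)) /\
  (forall (i n : int) (h : i + i = n) (x : A i), odd (absz i) -> gmul h x x = 0).

Record dgAlgHom (A B : dgAlg) := DgAlgHom {
  ah :> forall n : int, A n -> B n;
  ahD : forall n (x y : A n), ah (x + y) = ah x + ah y;
  ahM : forall i j n (h : i + j = n) (x : A i) (y : A j),
    ah (gmul h x y) = gmul h (ah x) (ah y);
  ah1 : ah (gone A) = gone B;
  ahd : forall n (x : A n), ah (gd x) = gd (ah x)
}.
Arguments ah {A B} _ {n} _.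

Record dgMod (R : dgAlg) := DgMod {
  gm :> int -> zmodType;
  gact : forall {i j n : int}, i + j = n -> R i -> gm j -> gm n;
  gmd : forall {n : int}, gm n -> gm (n - 1);
  gactDl : forall i j n (h : i + j = n) (a b : R i) (x : gm j),
    gact h (a + b) x = gact h a x + gact h b x;
  gactDr : forall i j n (h : i + j = n) (a : R i) (x y : gm j),
    gact h a (x + y) = gact h a x + gact h a y;
  gactA : forall i j l ij jl n (h1 : i + j = ij) (h2 : ij + l = n)
      (h3 : j + l = jl) (h4 : i + jl = n) (a : R i) (b : R j) (x : gm l),
    gact h2 (gmul h1 a b) x = gact h4 a (gact h3 b x);
  gact1 : forall n (h : 0 + n = n) (x : gm n), gact h (gone R) x = x;
  gmdD : forall n (x y : gm n), gmd (x + y) = gmd x + gmd y;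
  gmdd : forall n (x : gm n), gmd (gmd x) = 0;
  gmleibniz : forall i j n (h : i + j = n) (h1 : i - 1 + j = n - 1)
      (h2 : i + (j - 1) = n - 1) (a : R i) (x : gm j),
    gmd (gact h a x) = gact h1 (gd a) x + ksign i (gact h2 a (gmd x))
}.

Record dgHom (R : dgAlg) (M N : dgMod R) := DgHom {
  mh :> forall n : int, M n -> N n;
  mhD : forall n (x y : M n), mh (x + y) = mh x + mh y;
  mhZ : forall i j n (h : i + j = n) (a : R i) (x : M j),
    mh (gact h a x) = gact h a (mh x);
  mhd : forall n (x : M n), mh (gmd x) = gmd (mh x)
}.
Arguments mh {R M N} _ {n} _.

Section AdditiveTheory.
Variables U V : zmodType.
Variable f : U -> V.
Hypothesis fD : forall x y, f (x + y) = f x + f y.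

Lemma hadd0 : f 0 = 0.
Proof. by apply: (addIr (f 0)); rewrite -fD !add0r. Qed.

Lemma haddN x : f (- x) = - f x.
Proof. by apply/eqP; rewrite -addr_eq0 -fD addNr hadd0. Qed.

Lemma hadd_ksign i x : f (ksign i x) = ksign i (f x).
Proof. by rewrite /ksign; case: ifP => //; rewrite haddN. Qed.

Lemma hadd_sum I (r : seq I) (P : pred I) (F : I -> U) :
  f (\sum_(i <- r | P i) F i) = \sum_(i <- r | P i) f (F i).
Proof. exact: (big_morph f fD hadd0). Qed.

End AdditiveTheory.

Lemma alt_sum (V : zmodType) c (G : 'I_c -> 'I_c -> V) :
  (forall i, G i i = 0) -> (forall i l, G l i = - G i l) ->
  \sum_i \sum_l G i l = 0.
Proof.
elim: c G => [|c IH] G G0 GN; first by rewrite big_ord0.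
rewrite big_ord_recl big_ord_recl G0 add0r.
under [X in _ + X]eq_bigr => i _ do rewrite big_ord_recl GN.
rewrite big_split /= IH // addr0 -big_split /= big1 // => i _.
by rewrite subrr.
Qed.

Section ModuleTheory.
Variables (R : dgAlg) (M : dgMod R).

Lemma gmd0 n : gmd (0 : M n) = 0.
Proof. exact: hadd0 (@gmdD R M n). Qed.

Lemma gmdN n (x : M n) : gmd (- x) = - gmd x.
Proof. exact: haddN (@gmdD R M n) x. Qed.

Lemma gactN i j n (h : i + j = n) (a : R i) (x : M j) :
  gact h a (- x) = - gact h a x.
Proof. exact: haddN (gactDr h a) x. Qed.

Lemma gact_ksign i j n (h : i + j = n) l (a : R i) (x : M j) :
  gact h a (ksign l x) = ksign l (gact h a x).
Proof. exact: hadd_ksign (gactDr h a) l x. Qed.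

Lemma gact_ksignl i j n (h : i + j = n) l (a : R i) (x : M j) :
  gact h (ksign l a) x = ksign l (gact h a x).
Proof. exact: (hadd_ksign (f := fun a => gact h a x)
                 (fun a b => gactDl h a b x)). Qed.

Lemma gmd_ksign n l (x : M n) : gmd (ksign l x) = ksign l (gmd x).
Proof. exact: hadd_ksign (@gmdD R M n) l x. Qed.

End ModuleTheory.

(* An indexed predicate, as gmd y lives in degree n - 1 when y lives in degree
   n. *)
Variant boundary (R : dgAlg) (M : dgMod R) : forall n : int, M n -> Prop :=
  Boundary n (y : M n) : boundary (gmd y).
Arguments boundary {R M n} x.

Definition quasi_iso (R : dgAlg) (M N : dgMod R) (f : dgHom M N) : Prop :=
  (forall (n : int) (x : M n), gmd x = 0 -> boundary (f n x) -> boundary x) /\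
  (forall (n : int) (y : N n), gmd y = 0 ->
     exists2 x : M n, gmd x = 0 & boundary (y - f n x)).

Lemma boundaryP (R : dgAlg) (M : dgMod R) n (x : M n) :
  boundary x <->
  exists m (e : m - 1 = n) (y : M m), x = eq_rect _ (fun i => M i) (gmd y) _ e.
Proof.
split; first by case=> m y; exists m, erefl, y.
by case=> m [e [y ->]]; case: _ / e.
Qed.

Section Constructions.
Variable R : dgAlg.

Definition regular : dgMod R :=
  DgMod (@gmulDl R) (@gmulDr R) (@gmulA R) (@gmul1l R) (@gdD R) (@gdd R)
        (@gleibniz R).

Definition idHom (M : dgMod R) : dgHom M M.
Proof. by exists (fun n x => x). Defined.

Definition compHom (M N P : dgMod R) (g : dgHom N P) (f : dgHom M N) :
  dgHom M P.
Proof.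
exists (fun n x => g n (f n x)) => *; by rewrite ?(mhD, mhZ, mhd).
Defined.

Lemma shift_deg (i j n : int) : i + j = n -> i + (j - 1) = n - 1.
Proof. by move=> <-; rewrite addrA. Qed.

(* (Sigma M)_n = M_(n-1), a . Sigma x = (-1)^|a| Sigma (a x) and
   d (Sigma x) = - Sigma (d x). *)
Definition shift (M : dgMod R) : dgMod R.
Proof.
refine (@DgMod R (fun n => M (n - 1))
  (fun i j n (h : i + j = n) a x => ksign i (gact (shift_deg h) a x))
  (fun n x => - gmd x) _ _ _ _ _ _ _).
- by move=> i j n h a b x; rewrite gactDl ksignD.
- by move=> i j n h a x y; rewrite gactDr ksignD.
- move=> i j l ij jl n h1 h2 h3 h4 a b x; rewrite gact_ksign -ksign_add h1.
  by rewrite (gactA _ _ (shift_deg h3) (shift_deg h4)).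
- by move=> n h x; rewrite gact1.
- by move=> n x y; rewrite gmdD opprD.
- by move=> n x; rewrite gmdN gmdd !oppr0.
- move=> i j n h h1 h2 a x; rewrite gmd_ksign.
  rewrite (gmleibniz _ (shift_deg h1) (shift_deg h2)) ksignD opprD.
  by rewrite ksign_pred gactN !ksignN.
Defined.

Definition shiftHom (M N : dgMod R) (f : dgHom M N) :
  dgHom (shift M) (shift N).
Proof.
exists (fun n x => f (n - 1) x).
- by move=> n x y; rewrite mhD.
- move=> i j n h a x /=; rewrite -mhZ.
  exact: hadd_ksign (@mhD _ _ _ f (n - 1)) _ _.
- by move=> n x /=; rewrite -mhd; exact: haddN (@mhD _ _ _ f (n - 1 - 1)) _.
Defined.

Lemma boundary_shift (M : dgMod R) n (x : M (n - 1)) :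
  @boundary R (shift M) n x <-> @boundary R M (n - 1) x.
Proof.
split.
  case/boundaryP => m [e [y ->]]; case: _ / e => /=.
  by rewrite -gmdN; exact: Boundary.
case/boundaryP => m [e [y ->]].
have emn : m = n by apply: (addIr (- 1)).
subst m; rewrite (eq_irrelevance e erefl) /=.
have [k ek] : exists k, n = k - 1 by exists (n + 1); rewrite addrK.
subst n; rewrite -[gmd y]opprK -gmdN.
exact: (@Boundary R (shift M) k (- y)).
Qed.

Lemma quasi_iso_shift (M N : dgMod R) (f : dgHom M N) :
  quasi_iso f -> quasi_iso (shiftHom f).
Proof.
move=> [inj surj]; split=> n.
  move=> x /= /eqP; rewrite oppr_eq0 => /eqP zx /boundary_shift bx.
  by apply/boundary_shift; exact: inj.
move=> y /= /eqP; rewrite oppr_eq0 => /eqP zy.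
have [x zx bx] := surj _ y zy; exists x => /=; first by rewrite zx oppr0.
by apply/boundary_shift.
Qed.

Section Cone.
Variables (X Y : dgMod R) (f : dgHom X Y).

(* The cone is Y (+) Sigma X, with d (y, Sigma x) = (d y + f x, - Sigma d x). *)
Definition cone : dgMod R.
Proof.
refine (@DgMod R (fun n => (Y n * shift X n)%type : zmodType)
  (fun i j n (h : i + j = n) a u => (gact h a u.1, gact h a u.2))
  (fun n u => (gmd u.1 + f (n - 1) u.2, gmd u.2)) _ _ _ _ _ _ _).
- by move=> i j n h a b [y x]; rewrite !gactDl.
- by move=> i j n h a [y x] [y' x']; rewrite !gactDr.
- move=> i j l ij jl n h1 h2 h3 h4 a b [y x].
  by congr pair; exact: gactA.
- by move=> n h [y x]; rewrite !gact1.
- by move=> n [y x] [y' x']; rewrite !gmdD /= mhD addrACA.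
- move=> n [y x]; congr pair; last exact: gmdd.
  by rewrite /= gmdD gmdd add0r (haddN (@mhD _ _ _ f _)) -mhd subrr.
- move=> i j n h h1 h2 a [y x].
  rewrite ksign_pair; congr pair.
    rewrite /= (gmleibniz _ h1 h2) (hadd_ksign (@mhD _ _ _ f _)) mhZ.
    by rewrite gactDr ksignD addrA (eq_irrelevance (shift_deg h) h2).
  exact: (@gmleibniz R (shift X) i j n h h1 h2).
Defined.

Definition coneIn : dgHom Y cone.
Proof.
refine (@DgHom R Y cone (fun n y => (y, 0 : shift X n)) _ _ _).
- by move=> n y y'; congr pair; rewrite addr0.
- by move=> i j n h a y; congr pair; rewrite (hadd0 (@gactDr R (shift X) i j n h a)).
- move=> n y; congr pair; last by rewrite (@gmd0 R (shift X)).
  by rewrite (hadd0 (@mhD _ _ _ f _)) addr0.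
Defined.

Definition coneOut : dgHom cone (shift X).
Proof. by refine (@DgHom R cone (shift X) (fun n u => u.2) _ _ _). Defined.

End Cone.

End Constructions.

(* D(R) is the localization of the category of dg R-modules at the
   quasi-isomorphisms: morphisms are words in chain maps and formal inverses
   of quasi-isomorphisms, and [deq] is the congruence generated by the
   relations of the localization. *)
Inductive dmor (R : dgAlg) : dgMod R -> dgMod R -> Type :=
| Dmap (X Y : dgMod R) (f : dgHom X Y) : dmor X Y
| Dinv (X Y : dgMod R) (f : dgHom X Y) (qf : quasi_iso f) : dmor Y X
| Dcomp (X Y Z : dgMod R) (g : dmor Y Z) (f : dmor X Y) : dmor X Z.

Definition Did (R : dgAlg) (X : dgMod R) : dmor X X := Dmap (idHom X).

Inductive deq (R : dgAlg) :
  forall X Y : dgMod R, dmor X Y -> dmor X Y -> Prop :=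
| deq_refl X Y (u : dmor X Y) : deq u u
| deq_sym X Y (u v : dmor X Y) : deq u v -> deq v u
| deq_trans X Y (u v w : dmor X Y) : deq u v -> deq v w -> deq u w
| deq_cong X Y Z (v v' : dmor Y Z) (u u' : dmor X Y) :
    deq v v' -> deq u u' -> deq (Dcomp v u) (Dcomp v' u')
| deq_assoc X Y Z T (w : dmor Z T) (v : dmor Y Z) (u : dmor X Y) :
    deq (Dcomp w (Dcomp v u)) (Dcomp (Dcomp w v) u)
| deq_idl X Y (u : dmor X Y) : deq (Dcomp (Did Y) u) u
| deq_idr X Y (u : dmor X Y) : deq (Dcomp u (Did X)) u
| deq_map X Y (f g : dgHom X Y) :
    (forall n (x : X n), f n x = g n x) -> deq (Dmap f) (Dmap g)
| deq_comp X Y Z (g : dgHom Y Z) (f : dgHom X Y) :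
    deq (Dmap (compHom g f)) (Dcomp (Dmap g) (Dmap f))
| deq_invl X Y (f : dgHom X Y) (qf : quasi_iso f) :
    deq (Dcomp (Dinv qf) (Dmap f)) (Did X)
| deq_invr X Y (f : dgHom X Y) (qf : quasi_iso f) :
    deq (Dcomp (Dmap f) (Dinv qf)) (Did Y).

Definition Diso (R : dgAlg) (X Y : dgMod R) (u : dmor X Y) : Prop :=
  exists v : dmor Y X, deq (Dcomp v u) (Did X) /\ deq (Dcomp u v) (Did Y).

Fixpoint Dshift (R : dgAlg) (X Y : dgMod R) (u : dmor X Y) :
    dmor (shift X) (shift Y) :=
  match u in dmor X Y return dmor (shift X) (shift Y) with
  | Dmap _ _ f => Dmap (shiftHom f)
  | Dinv _ _ _ qf => Dinv (quasi_iso_shift qf)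
  | Dcomp _ _ _ g f => Dcomp (Dshift g) (Dshift f)
  end.

(* A triangle is exact when it is isomorphic in D(R) to the triangle
   X -f-> Y -> cone f -> Sigma X of a morphism f of dg modules. *)
Definition exact_triangle (R : dgAlg) (L M N : dgMod R)
    (u : dmor L M) (v : dmor M N) (w : dmor N (shift L)) : Prop :=
  exists (X Y : dgMod R) (f : dgHom X Y)
         (a : dmor X L) (b : dmor Y M) (g : dmor (cone f) N),
    [/\ Diso a, Diso b & Diso g] /\
    [/\ deq (Dcomp u a) (Dcomp b (Dmap f)),
        deq (Dcomp v b) (Dcomp g (Dmap (coneIn f))) &
        deq (Dcomp w g) (Dcomp (Dshift a) (Dmap (coneOut f)))].

(* The full subcategory of D(R) on the objects satisfying P is thick. *)
Record thick (R : dgAlg) (P : dgMod R -> Prop) : Prop := Thick {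
  thick_shift : forall X, P X <-> P (shift X);
  thick_cone : forall X Y Z (u : dmor X Y) (v : dmor Y Z)
      (w : dmor Z (shift X)), exact_triangle u v w -> P X -> P Y -> P Z;
  thick_retract : forall X Y (i : dmor X Y) (r : dmor Y X),
      deq (Dcomp r i) (Did X) -> P Y -> P X
}.

Definition perfect (R : dgAlg) (M : dgMod R) : Prop :=
  forall P : dgMod R -> Prop, thick P -> P (regular R) -> P M.

Definition restrict (R R' : dgAlg) (phi : dgAlgHom R R') (M : dgMod R') :
  dgMod R.
Proof.
refine (@DgMod R M (fun i j n h a x => gact h (phi i a) x)
          (fun n x => gmd x) _ _ _ _ _ _ _).
- by move=> *; rewrite ahD gactDl.
- by move=> *; rewrite gactDr.
- by move=> i j l ij jl n h1 h2 h3 h4 a b x; rewrite ahM; exact: gactA.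
- by move=> *; rewrite ah1 gact1.
- by move=> *; rewrite gmdD.
- by move=> *; rewrite gmdd.
- by move=> i j n h h1 h2 a x; rewrite ahd; exact: gmleibniz.
Defined.

(* T, with the unit iota : G -> T, is the extension of scalars of G along phi,
   i.e. T = R' (x)_R G: extension of scalars is left adjoint to restriction. *)
Definition is_base_change (R R' : dgAlg) (phi : dgAlgHom R R')
    (G : dgMod R) (T : dgMod R') (iota : dgHom G (restrict phi T)) : Prop :=
  forall (U : dgMod R') (g : dgHom G (restrict phi U)),
  exists h : dgHom T U,
    (forall n (x : G n), h n (iota n x) = g n x) /\
    (forall h' : dgHom T U,
       (forall n (x : G n), h' n (iota n x) = g n x) ->
       forall n (y : T n), h' n y = h n y).

Section Semifree.
Variables (R : dgAlg) (M : dgMod R).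
Variables (I : choiceType) (deg : I -> int) (b : forall i, M (deg i)).

Definition lincomb (n : int) (s : seq I) (a : forall i, R (n - deg i)) : M n :=
  \sum_(i <- s) gact (subrK (deg i) n) (a i) (b i).

Definition in_span (P : I -> Prop) (n : int) (x : M n) : Prop :=
  exists (s : seq I) (a : forall i, R (n - deg i)),
    (forall i, i \in s -> P i) /\ x = lincomb s a.

Definition is_basis : Prop :=
  (forall n (x : M n), in_span (fun=> True) x) /\
  (forall n (s : seq I) (a : forall i, R (n - deg i)),
     uniq s -> lincomb s a = 0 -> forall i, i \in s -> a i = 0).

End Semifree.

(* The basis is the disjoint union over l >= 0 of the sets of elements of level
   l, whose differentials lie in the span of those of smaller level. *)
Definition semifree (R : dgAlg) (M : dgMod R) : Prop :=
  exists (I : choiceType) (deg : I -> int) (b : forall i, M (deg i))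
         (lvl : I -> nat),
    is_basis b /\
    forall i, in_span b (fun j => (lvl j < lvl i)%N) (gmd (b i)).

(* The classes of the z i form a basis of H(T) over K, when K has zero
   differential. *)
Definition homology_basis (K : dgAlg) (T : dgMod K) (r : nat) : Prop :=
  exists (deg : 'I_r -> int) (z : forall i, T (deg i)),
    [/\ forall i, gmd (z i) = 0,
        forall n (y : T n), gmd y = 0 ->
          exists a : forall i, K (n - deg i),
            boundary (y - lincomb z (enum 'I_r) a) &
        forall n (a : forall i, K (n - deg i)),
          boundary (lincomb z (enum 'I_r) a) -> forall i, a i = 0].

(* None stands for infinite rank: no finite homogeneous basis. *)
Definition is_homology_rank (K : dgAlg) (T : dgMod K) (rho : option nat) :=
  if rho is Some r then homology_basis T r
  else forall r, ~ homology_basis T r.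

Definition leq_rank (i : nat) (rho : option nat) : bool :=
  if rho is Some r then (i <= r)%N else true.

Section DegreeZero.
Variable A : dgAlg.

Definition mul0 (a b : A 0) : A 0 := gmul (addr0 0) a b.

Definition nonunit (a : A 0) : Prop := ~ exists b, mul0 a b = gone A.

Definition ideal0 (J : A 0 -> Prop) : Prop :=
  [/\ J 0, forall a b, J a -> J b -> J (a + b) & forall a b, J b -> J (mul0 a b)].

Definition finitely_generated0 (J : A 0 -> Prop) : Prop :=
  exists (r : nat) (g : 'I_r -> A 0), (forall i, J (g i)) /\
    forall x, J x -> exists a : 'I_r -> A 0, x = \sum_i mul0 (a i) (g i).

End DegreeZero.

(* A commutative noetherian local dg algebra with residue field k.  In la_fg,
   A_0 maps onto H_0(A), so coefficients in A_0 suffice.  The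
   augmentation A -> k is given by its components; it is a morphism of dg
   algebras, so that k is a dg A-module. *)
Record localDgAlg (k : fieldType) := LocalDgAlg {
  la :> dgAlg;
  la_comm : strictly_graded_commutative la;
  la_nonneg : forall (i : int) (a : la i), i < 0 -> a = 0;
  la_noetherian : forall J : la 0 -> Prop, ideal0 J -> finitely_generated0 J;
  la_local : ideal0 (@nonunit la);
  la_fg : forall i : int, exists (r : nat) (z : 'I_r -> la i),
    (forall s, gd (z s) = 0) /\
    forall x : la i, gd x = 0 -> exists a : 'I_r -> la 0,
      @boundary la (regular la) i (x - \sum_s gmul (add0r i) (a s) (z s));
  aug : forall i : int, la i -> k;
  augD : forall i (a b : la i), aug (a + b) = aug a + aug b;
  augM : forall i j n (h : i + j = n) (a : la i) (b : la j),
    aug (gmul h a b) = aug a * aug b;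
  aug1 : aug (gone la) = 1;
  aug_d : forall i (a : la i), aug (gd a) = 0;
  aug_pos : forall i (a : la i), i != 0 -> aug a = 0;
  aug_surj : forall t : k, exists a : la 0, aug a = t;
  aug_ker : forall a : la 0, aug a = 0 <-> nonunit a
}.
Arguments aug {k l i} _.

Definition max_ideal (k : fieldType) (A : localDgAlg k) (a : A 0) : Prop :=
  nonunit a.

Section Koszul.
Variables (k : fieldType) (A : localDgAlg k) (c : nat).

Fixpoint kprod (B : dgAlg) (e : 'I_c -> B 1) (s : seq 'I_c) : B (size s)%:Z :=
  match s return B (size s)%:Z with
  | [::] => gone B
  | i :: s' => gmul (esym (intS (size s'))) (e i) (kprod e s')
  end.

(* The products of the e_i over the subsets of {1, ..., c} form a basis over A
   of the exterior algebra B = A<e_1, ..., e_c | d e_i = f_i>. *)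
Record koszul (f : 'I_c -> A 0) := Koszul {
  kB :> dgAlg;
  kB_comm : strictly_graded_commutative kB;
  kphi : dgAlgHom A kB;
  ke : 'I_c -> kB 1;
  ke_d : forall i, gd (ke i) = kphi 0 (f i);
  ke_span : forall n (b : kB n),
    exists a : forall s : {set 'I_c}, A (n - (size (enum s))%:Z),
      b = \sum_s gmul (subrK _ n) (kphi _ (a s)) (kprod ke (enum s));
  ke_free : forall n (a : forall s : {set 'I_c}, A (n - (size (enum s))%:Z)),
    \sum_s gmul (subrK _ n) (kphi _ (a s)) (kprod ke (enum s)) = 0 ->
    forall s, a s = 0
}.

End Koszul.

Section Operators.
Variables (k : fieldType) (c : nat).
Local Notation S := {mpoly k[c]}.

(* Homogeneous polynomials of homological degree n, the variables having
   degree -2. *)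
Definition sdeg_pred (n : int) : pred S :=
  fun q => all (fun m : 'X_{1..c} => n == - ((mdeg m).*2)%:Z) (msupp q).
Definition sdeg (n : int) : qualifier 0 S := [qualify q | sdeg_pred n q].

End Operators.
Arguments sdeg {k c} n.

Section OperatorTheory.
Variables (k : fieldType) (c : nat).
Local Notation S := {mpoly k[c]}.

Lemma sdegP n (q : S) :
  reflect (forall m, q@_m != 0 -> n = - ((mdeg m).*2)%:Z) (q \is sdeg n).
Proof.
apply: (iffP allP) => h m.
  by rewrite -mcoeff_msupp => /h/eqP.
by rewrite mcoeff_msupp => /h ->.
Qed.

Lemma sdeg_zmod_closed n : zmod_closed (@sdeg k c n).
Proof.
split; first by apply/sdegP => m; rewrite mcoeff0 eqxx.
move=> p q /sdegP hp /sdegP hq; apply/sdegP => m.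
rewrite mcoeffB; case: (eqVneq p@_m 0) => [-> | /hp //].
by rewrite sub0r oppr_eq0 => /hq.
Qed.
HB.instance Definition _ n :=
  GRing.isZmodClosed.Build S (@sdeg_pred k c n) (sdeg_zmod_closed n).

Lemma sdeg1 : (1 : S) \is sdeg 0.
Proof. by apply/sdegP=> m; rewrite mcoeff1; case: (eqVneq m 0%MM) => [->|]; rewrite ?mdeg0 ?eqxx. Qed.

Lemma sdegX i : ('X_i : S) \is sdeg (- 2).
Proof.
by apply/sdegP => m; rewrite mcoeffX; case: (eqVneq U_(i)%MM m) => [<-|]; rewrite ?mdeg1 ?eqxx.
Qed.

Lemma sdegM i j n (p q : S) : i + j = n ->
  p \is sdeg i -> q \is sdeg j -> p * q \is sdeg n.
Proof.
move=> <- /allP hp /allP hq; apply/allP => m /msuppM_le/allpairsP [[u v]] /=.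
by case=> /hp/eqP -> /hq/eqP -> ->; rewrite mdegD doubleD PoszD opprD.
Qed.

Lemma sdegZ n t (q : S) : q \is sdeg n -> t *: q \is sdeg n.
Proof.
move=> hq; rewrite -mul_mpolyC; apply: sdegM (add0r n) _ hq.
apply/sdegP => m; rewrite mcoeffC.
by case: (eqVneq m 0%MM) => [->|]; rewrite ?mdeg0 // mulr0 eqxx.
Qed.

Record spoly (n : int) := SPoly { spval :> {mpoly k[c]}; _ : spval \is sdeg n }.
HB.instance Definition _ n := [isSub for @spval n].
HB.instance Definition _ n := [Choice of spoly n by <:].
HB.instance Definition _ n := [SubChoice_isSubZmodule of spoly n by <:].

Lemma spvalP n (q : spoly n) : spval q \is sdeg n.
Proof. by case: q. Qed.

Definition spmul i j n (h : i + j = n) (p : spoly i) (q : spoly j) : spoly n :=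
  SPoly (sdegM h (spvalP p) (spvalP q)).

(* S = k[chi_1, ..., chi_c] as a dg algebra with zero differential. *)
Definition cohop : dgAlg.
Proof.
refine (@DgAlg (fun n => spoly n : zmodType) spmul (SPoly sdeg1)
  (fun n _ => 0) _ _ _ _ _ _ _ _).
- by move=> *; apply: val_inj; rewrite /= mulrDl.
- by move=> *; apply: val_inj; rewrite /= mulrDr.
- by move=> *; apply: val_inj; rewrite /= mulrA.
- by move=> *; apply: val_inj; rewrite /= mul1r.
- by move=> *; apply: val_inj; rewrite /= mulr1.
- by move=> *; rewrite addr0.
- by [].
- move=> i j n h h1 h2 x y; rewrite /ksign; case: odd; apply: val_inj => /=.
    by rewrite mul0r mulr0 subr0.
  by rewrite mul0r mulr0 addr0.
Defined.

End OperatorTheory.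

Section RHom.
Variables (k : fieldType) (A : localDgAlg k) (c : nat) (f : 'I_c -> A 0).
Hypothesis fm : forall i, max_ideal (f i).
Variables (B : koszul f) (F : dgMod B).
Local Notation S := {mpoly k[c]}.

(* The degree n part of Hom_A(F, k) (x)_k S.  The element g (x) s, with g in
   Hom_A(F, k) = (+)_j Hom_A(F, k)_(-j) and s in S, is encoded as the family of
   maps F_j -> S, y |-> g(y) s.  The pieces of S being finite dimensional over
   k, the families obtained are those which are A-linear (A acting on S through
   k), homogeneous, and zero on all but finitely many F_j. *)
Definition homS_pred (n : int) (x : forall j, F j -> S) : Prop :=
  [/\ forall j (y z : F j), x j (y + z) = x j y + x j z,
      forall i j l (h : i + j = l) (a : A i) (y : F j),
        x l (gact h (kphi B i a) y) = aug a *: x j y,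
      forall j (y : F j), x j y \is sdeg (n + j) &
      exists N : nat, forall j (y : F j), (N < absz j)%N -> x j y = 0].

Record homS (n : int) := HomS {
  hsval :> forall j, F j -> S;
  hsP : homS_pred n hsval
}.

HB.instance Definition _ n := gen_eqMixin (homS n).
HB.instance Definition _ n := gen_choiceMixin (homS n).

Lemma homS_eq n (x y : homS n) : (forall j z, x j z = y j z) -> x = y.
Proof.
case: x y => [x hx] [y hy] /= xy.
have exy : x = y by apply: functional_extensionality_dep => j; apply: funext => z.
by subst y; congr HomS.
Qed.

Lemma homS_zero_subproof n : homS_pred n (fun _ _ => 0).
Proof.
split=> *; rewrite ?addr0 ?scaler0 ?rpred0 //.
by exists 0%N.
Qed.

Lemma homS_opp_subproof n (x : homS n) : homS_pred n (fun j y => - x j y).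
Proof.
case: x => x [xD xZ xd [N xN]]; split=> /=.
- by move=> *; rewrite xD opprD.
- by move=> *; rewrite xZ scalerN.
- by move=> *; rewrite rpredN.
- by exists N => *; rewrite xN ?oppr0.
Qed.

Lemma homS_add_subproof n (x y : homS n) :
  homS_pred n (fun j z => x j z + y j z).
Proof.
case: x y => x [xD xZ xd [N xN]] [y [yD yZ yd [N' yN]]]; split=> /=.
- by move=> *; rewrite xD yD addrACA.
- by move=> *; rewrite xZ yZ scalerDr.
- by move=> *; rewrite rpredD.
- exists (maxn N N') => j z; rewrite gtn_max => /andP[h h'].
  by rewrite xN ?yN ?addr0.
Qed.

Definition homS_zero n := HomS (homS_zero_subproof n).
Definition homS_opp n (x : homS n) := HomS (homS_opp_subproof x).
Definition homS_add n (x y : homS n) := HomS (homS_add_subproof x y).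

Lemma homS_addA n : associative (@homS_add n).
Proof. by move=> x y z; apply: homS_eq => j t; rewrite /= addrA. Qed.
Lemma homS_addC n : commutative (@homS_add n).
Proof. by move=> x y; apply: homS_eq => j t; rewrite /= addrC. Qed.
Lemma homS_add0 n : left_id (homS_zero n) (@homS_add n).
Proof. by move=> x; apply: homS_eq => j t; rewrite /= add0r. Qed.
Lemma homS_addN n : left_inverse (homS_zero n) (@homS_opp n) (@homS_add n).
Proof. by move=> x; apply: homS_eq => j t; rewrite /= addNr. Qed.

HB.instance Definition _ n := GRing.isZmodule.Build (homS n)
  (@homS_addA n) (@homS_addC n) (@homS_add0 n) (@homS_addN n).

Lemma homS_act_subproof i j n (h : i + j = n) (p : cohop k c i) (x : homS j) :
  homS_pred n (fun l y => spval p * x l y).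
Proof.
case: x => x [xD xZ xd [N xN]]; split=> /=.
- by move=> *; rewrite xD mulrDr.
- by move=> *; rewrite xZ scalerAr.
- by move=> l y; apply: sdegM (spvalP p) (xd l y); rewrite addrA h.
- by exists N => *; rewrite xN ?mulr0.
Qed.

Definition homS_act i j n (h : i + j = n) (p : cohop k c i) (x : homS j) :
  homS n := HomS (homS_act_subproof h p x).

(* On g (x) s, with g of degree n, the differential
     d^Hom(g) (x) s + \sum_i (-1)^|g| g(e_i -) (x) chi_i s,
   where d^Hom(g) = - (-1)^|g| g d; the elements of S having even degree, |g|
   has the parity of the total degree n. *)
Definition homS_diff_fun (n : int) (x : homS n) (j : int) (y : F j) : S :=
  ksign n (\sum_(i < c) 'X_i * x (1 + j) (gact (erefl (1 + j)) (ke B i) y)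
           - x (j - 1) (gmd y)).

Lemma ksign_aug i (a : A i) (q : S) : ksign i (aug a *: q) = aug a *: q.
Proof.
have [i0|i0] := eqVneq i 0.
  by rewrite /ksign (_ : odd _ = false) // i0.
by rewrite (aug_pos _ i0) scale0r ksign_0.
Qed.

Lemma ke_swap i j l (h : i + j = l) (h' : i + (1 + j) = 1 + l) s (a : A i)
    (y : F j) :
  gact (erefl (1 + l)) (ke B s) (gact h (kphi B i a) y) =
  ksign i (gact h' (kphi B i a) (gact (erefl (1 + j)) (ke B s) y)).
Proof.
have h1 : 1 + i + j = 1 + l by rewrite -addrA h.
rewrite -(gactA erefl h1) ((kB_comm B).1 _ _ _ _ (addrC i 1)) mul1r.
by rewrite gact_ksignl (gactA _ _ erefl h').
Qed.

Lemma homS_transport (x : forall j, F j -> S) i j l l' (h : i + j = l)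
    (h' : i + j = l') (a : B i) (y : F j) : x l (gact h a y) = x l' (gact h' a y).
Proof. by case: _ / h; case: _ / h'. Qed.

Lemma homS_diff_subproof n (x : homS n) : homS_pred (n - 1) (homS_diff_fun x).
Proof.
case: x => x [xD xZ xd [N xN]]; split; rewrite /homS_diff_fun /=.
- move=> j y z; rewrite -ksignD; congr (ksign n _).
  rewrite gmdD xD opprD [RHS]addrACA -big_split /=; congr (_ + _).
  by apply: eq_bigr => i _; rewrite gactDr xD mulrDr.
- move=> i j l h a y.
  have h1 : i + (1 + j) = 1 + l by rewrite addrCA h.
  have h2 : i - 1 + j = l - 1 by rewrite addrAC h.
  have h3 : i + (j - 1) = l - 1 by rewrite addrA h.
  rewrite (gmleibniz _ h2 h3) -ahd xD xZ aug_d scale0r add0r.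
  rewrite (hadd_ksign (xD _)) xZ ksign_aug.
  under eq_bigr => s _ do
    rewrite (ke_swap h h1) (hadd_ksign (xD _)) xZ ksign_aug -scalerAr.
  rewrite -scaler_sumr -scalerBr /ksign; by case: odd; rewrite ?scalerN.
- move=> j y.
  have sd : \sum_(i < c) 'X_i * x (1 + j) (gact (erefl (1 + j)) (ke B i) y)
      - x (j - 1) (gmd y) \is sdeg (n - 1 + j).
    rewrite rpredB ?rpred_sum // => [i _|].
      have hn : - 2 + (n + (1 + j)) = n - 1 + j by lia.
      by apply: (sdegM hn) => //; exact: sdegX.
    by rewrite -addrA (addrC (- 1)).
  by rewrite /ksign; case: odd; rewrite ?rpredN.
- exists N.+1 => j y Nj; rewrite big1 => [|i _].
    by rewrite xN ?subr0 ?ksign_0 //; lia.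
  by rewrite xN ?mulr0 //; lia.
Qed.

Definition homS_diff n (x : homS n) : homS (n - 1) :=
  HomS (homS_diff_subproof x).

Lemma homS_diffD n (x y : homS n) :
  homS_diff (x + y) = homS_diff x + homS_diff y.
Proof.
apply: homS_eq => j z; rewrite /= /homS_diff_fun /= -ksignD; congr (ksign n _).
rewrite opprD [RHS]addrACA -big_split /=; congr (_ + _).
by apply: eq_bigr => i _; rewrite mulrDr.
Qed.

Lemma homS_diffK n (x : homS n) : homS_diff (homS_diff x) = 0.
Proof.
apply: homS_eq => j y; rewrite /= /homS_diff_fun /= /homS_diff_fun.
case: x => x [xD xZ xd [N xN]] /=.
have x0 l : x l 0 = 0 := hadd0 (xD l).
rewrite ksign_pred gmdd x0 subr0.
set D := _ - _; suff -> : D = 0 by rewrite ksign_0 oppr0.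
have de i : x (1 + j - 1) (gmd (gact (erefl (1 + j)) (ke B i) y)) =
    - x (1 + (j - 1)) (gact (erefl (1 + (j - 1))) (ke B i) (gmd y)).
  have h1 : 1 - 1 + j = 1 + j - 1 by rewrite addrAC.
  have h2 : 1 + (j - 1) = 1 + j - 1 by rewrite addrA.
  rewrite (gmleibniz _ h1 h2) xD (hadd_ksign (xD _)) ke_d.
  have -> : x (1 + j - 1) (gact h1 (kphi B 0 (f i)) y) = 0.
    have := xZ 0 j _ h1 (f i) y => ->.
    by rewrite (aug_ker (f i)).2 ?scale0r //; exact: fm.
  by rewrite add0r (homS_transport x h2 (erefl _)).
have -> : D = ksign n (\sum_(i < c) \sum_(l < c) 'X_i * ('X_l *
    x (1 + (1 + j)) (gact (erefl (1 + (1 + j))) (ke B l)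
       (gact (erefl (1 + j)) (ke B i) y)))).
  rewrite /D; under eq_bigr => i _ do
    rewrite (hadd_ksign (mulrDr 'X_i)) de opprK mulrDr mulr_sumr.
  rewrite -(hadd_sum (@ksignD _ n)) -ksignB -sumrB; congr (ksign n _).
  by apply: eq_bigr => i _; rewrite addrK.
have h2 : 1 + 1 + j = 1 + (1 + j) by rewrite addrA.
rewrite alt_sum ?ksign_0 // => [i|i l].
  rewrite -(gactA erefl h2) (kB_comm B).2 //.
  by rewrite (hadd0 (f := fun a => gact h2 a y)) ?x0 ?mulr0 // => a b;
    rewrite gactDl.
rewrite -!(gactA erefl h2) ((kB_comm B).1 _ _ _ erefl erefl (ke B i)) mul1r.
by rewrite gact_ksignl (hadd_ksign (xD _)) /= !mulrN mulrCA.
Qed.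

Definition RHom : dgMod (cohop k c).
Proof.
refine (@DgMod (cohop k c) (fun n => homS n : zmodType) homS_act homS_diff
  _ _ _ _ _ _ _).
- by move=> *; apply: homS_eq => l y; rewrite /= mulrDl.
- by move=> *; apply: homS_eq => l y; rewrite /= mulrDr.
- by move=> *; apply: homS_eq => l y; rewrite /= mulrA.
- by move=> *; apply: homS_eq => l y; rewrite /= mul1r.
- exact: homS_diffD.
- exact: homS_diffK.
- move=> i j n h h1 h2 p x; apply: homS_eq => l y.
  transitivity (ksign i (spval p * homS_diff_fun x y)); last first.
    by rewrite /= mul0r add0r /ksign; case: odd.
  rewrite /= /homS_diff_fun /= (hadd_ksign (mulrDr (spval p))) -ksign_add h.
  congr (ksign n _); rewrite mulrBr mulr_sumr; congr (_ - _).
  by apply: eq_bigr => s _; rewrite mulrCA.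
Defined.

End RHom.

Section PrimeQuotient.
Variables (R : comNzRingType) (I : prime_idealr R).

Definition prime_quot : Type := {ideal_quot I}.
HB.instance Definition _ := GRing.ComNzRing.on prime_quot.

Definition pq_pi (x : R) : prime_quot := \pi_{ideal_quot I} x.

Definition pq_unit : pred prime_quot := fun x => `[< exists y, y * x = 1 >].
Definition pq_inv (x : prime_quot) : prime_quot :=
  if pselect (exists y, y * x = 1) is left h then projT1 (cid h) else x.

Lemma pq_mulVr : {in pq_unit, left_inverse 1 pq_inv *%R}.
Proof.
move=> x /asboolP ux; rewrite /pq_inv; case: pselect => // h.
by case: (cid h).
Qed.

Lemma pq_unitP x y : y * x = 1 -> pq_unit x.
Proof. by move=> yx; apply/asboolP; exists y. Qed.

Lemma pq_inv_out : {in [predC pq_unit], pq_inv =1 id}.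
Proof.
move=> x /negP nx; rewrite /pq_inv; case: pselect => // h.
by case: nx; apply/asboolP.
Qed.

HB.instance Definition _ := GRing.ComNzRing_hasMulInverse.Build prime_quot
  pq_mulVr pq_unitP pq_inv_out.

Lemma pq_domain : GRing.integral_domain_axiom prime_quot.
Proof. exact: Quotient.rquot_IdomainAxiom. Qed.

HB.instance Definition _ :=
  GRing.ComUnitRing_isIntegral.Build prime_quot pq_domain.

Lemma pq_pi_zmod : zmod_morphism pq_pi.
Proof. exact: (@rmorphB _ _ \pi_{ideal_quot I}). Qed.
Lemma pq_pi_monoid : monoid_morphism pq_pi.
Proof.
split; first exact: (rmorph1 \pi_{ideal_quot I}).
exact: (@rmorphM _ _ \pi_{ideal_quot I}).
Qed.
HB.instance Definition _ :=
  GRing.isZmodMorphism.Build R prime_quot pq_pi pq_pi_zmod.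
HB.instance Definition _ :=
  GRing.isMonoidMorphism.Build R prime_quot pq_pi pq_pi_monoid.

Lemma pq_pi_eq0 x : (pq_pi x == 0) = (x \in (I : pred R)).
Proof.
by rewrite -[x in RHS]subr0 Quotient.idealrBE -[0 in LHS](rmorph0 pq_pi).
Qed.

End PrimeQuotient.

Lemma subf_div (K : fieldType) (a b s t : K) : s != 0 -> t != 0 ->
  a / s - b / t = (a * t - b * s) / (s * t).
Proof. by move=> s0 t0; rewrite -mulNr addf_div // mulNr. Qed.

Section ResidueField.
Variables (k : fieldType) (c : nat).
Local Notation S := {mpoly k[c]}.

(* A point of Spec S. *)
Record hprime := HPrime {
  hp_ideal :> prime_idealr S;
  hp_homog : forall q : S, q \in (hp_ideal : pred S) ->
    forall d : nat, pihomog mdeg d q \in (hp_ideal : pred S)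
}.

Definition frac_pi (p : hprime) (q : S) : {fraction (prime_quot (hp_ideal p))} :=
  tofrac (pq_pi (hp_ideal p) q).

Lemma frac_pi_zmod p : zmod_morphism (frac_pi p).
Proof. by move=> x y; rewrite /frac_pi !rmorphB. Qed.
Lemma frac_pi_monoid p : monoid_morphism (frac_pi p).
Proof. by split=> [|x y]; rewrite /frac_pi ?rmorph1 ?rmorphM. Qed.
HB.instance Definition _ p := GRing.isZmodMorphism.Build S
  {fraction (prime_quot (hp_ideal p))} (frac_pi p) (frac_pi_zmod p).
HB.instance Definition _ p := GRing.isMonoidMorphism.Build S
  {fraction (prime_quot (hp_ideal p))} (frac_pi p) (frac_pi_monoid p).

Lemma frac_pi_eq0 p q : (frac_pi p q == 0) = (q \in (hp_ideal p : pred S)).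
Proof. by rewrite /frac_pi tofrac_eq0 pq_pi_eq0. Qed.

(* The homogeneous fractions are taken inside any field E which contains S / p,
   so that the generic case can be used without unfolding Frac (S / p). *)
Section HomogeneousFractions.
Variables (p : hprime) (E : fieldType) (pi : {rmorphism S -> E}).
Hypothesis pi_eq0 : forall q, (pi q == 0) = (q \in (hp_ideal p : pred S)).

(* S_p / p S_p is the ring of fractions of S / p with homogeneous denominators;
   kap n is the set of such fractions of degree n. *)
Definition kap_pred (n : int) : pred E := fun x =>
  `[< exists (i : int) (a s : S),
        [/\ a \is sdeg (i + n), s \is sdeg i, s \notin (hp_ideal p : pred S)
          & x = pi a / pi s] >].
Definition kap (n : int) : qualifier 0 E := [qualify x | kap_pred n x].

Lemma kapP n (x : E) : reflect (exists (i : int) (a s : S),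
  [/\ a \is sdeg (i + n), s \is sdeg i, s \notin (hp_ideal p : pred S)
    & x = pi a / pi s]) (x \is kap n).
Proof. exact: asboolP. Qed.

Lemma hp_notin1 : 1 \notin (hp_ideal p : pred S).
Proof. by rewrite idealr1. Qed.

Lemma hp_notinM (u v : S) : u \notin (hp_ideal p : pred S) ->
  v \notin (hp_ideal p : pred S) -> u * v \notin (hp_ideal p : pred S).
Proof. by move=> hu hv; rewrite prime_idealrM negb_or hu hv. Qed.

Lemma kap_zmod_closed n : zmod_closed (kap n).
Proof.
split.
  apply/kapP; exists 0, 0, 1; rewrite rpred0 sdeg1 hp_notin1.
  by split=> //; rewrite rmorph0 mul0r.
move=> x y /kapP[i [a [s [ha hs ps ->]]]] /kapP[j [b [t [hb ht pt ->]]]].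
apply/kapP; exists (i + j), (a * t - b * s), (s * t); split.
- apply: rpredB; [apply: sdegM ha ht | apply: sdegM hb hs]; lia.
- exact: sdegM hs ht.
- exact: hp_notinM.
- move: ps pt; rewrite -!pi_eq0 => ps pt.
  by rewrite subf_div // rmorphB !rmorphM.
Qed.
HB.instance Definition _ n :=
  GRing.isZmodClosed.Build E (kap_pred n) (kap_zmod_closed n).

Lemma kap_pi n (q : S) : q \is sdeg n -> pi q \is kap n.
Proof.
move=> hq; apply/kapP; exists 0, q, 1; rewrite add0r sdeg1 hp_notin1.
by split=> //; rewrite rmorph1 divr1.
Qed.

Lemma kap1 : 1 \is kap 0.
Proof. by rewrite -(rmorph1 pi) kap_pi ?sdeg1. Qed.

Lemma kapM i j n (x y : E) : i + j = n ->
  x \is kap i -> y \is kap j -> x * y \is kap n.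
Proof.
move=> <- /kapP[d [a [s [ha hs ps ->]]]] /kapP[e [b [t [hb ht pt ->]]]].
apply/kapP; exists (d + e), (a * b), (s * t); split.
- by apply: sdegM ha hb; rewrite addrACA.
- exact: sdegM hs ht.
- exact: hp_notinM.
- by rewrite !rmorphM mulf_div.
Qed.

Record kappa_el (n : int) := KappaEl { kapval :> E; _ : kapval \is kap n }.
HB.instance Definition _ n := [isSub for @kapval n].
HB.instance Definition _ n := [Choice of kappa_el n by <:].
HB.instance Definition _ n := [SubChoice_isSubZmodule of kappa_el n by <:].

Lemma kapvalP n (x : kappa_el n) : kapval x \is kap n.
Proof. by case: x. Qed.

Definition kap_mul i j n (h : i + j = n) (x : kappa_el i) (y : kappa_el j) :
  kappa_el n := KappaEl (kapM h (kapvalP x) (kapvalP y)).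

Definition kappa_in : dgAlg.
Proof.
refine (@DgAlg (fun n => kappa_el n : zmodType) kap_mul (KappaEl kap1)
  (fun n _ => 0) _ _ _ _ _ _ _ _).
- by move=> *; apply: val_inj; rewrite /= mulrDl.
- by move=> *; apply: val_inj; rewrite /= mulrDr.
- by move=> *; apply: val_inj; rewrite /= mulrA.
- by move=> *; apply: val_inj; rewrite /= mul1r.
- by move=> *; apply: val_inj; rewrite /= mulr1.
- by move=> *; rewrite addr0.
- by [].
- move=> i j n h h1 h2 x y; rewrite /ksign; case: odd; apply: val_inj => /=.
    by rewrite mul0r mulr0 subr0.
  by rewrite mul0r mulr0 addr0.
Defined.

Definition to_kappa_in : dgAlgHom (cohop k c) kappa_in.
Proof.
refine (@DgAlgHom (cohop k c) kappa_in
  (fun n q => KappaEl (kap_pi (spvalP q))) _ _ _ _).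
- by move=> *; apply: val_inj; rewrite /= rmorphD.
- by move=> *; apply: val_inj; rewrite /= rmorphM.
- by apply: val_inj; rewrite /= rmorph1.
- by move=> *; apply: val_inj; rewrite /= rmorph0.
Defined.

End HomogeneousFractions.

(* The graded field kappa(p), as a dg algebra with zero differential, and the
   canonical map S -> kappa(p). *)
Definition kappa (p : hprime) : dgAlg := kappa_in (frac_pi_eq0 p).
Definition to_kappa (p : hprime) : dgAlgHom (cohop k c) (kappa p) :=
  to_kappa_in (frac_pi_eq0 p).

End ResidueField.

Section JumpLoci.
Variables (k : fieldType) (A : localDgAlg k) (c : nat) (f : 'I_c -> A 0).
Hypothesis fm : forall i, max_ideal (f i).
Variable B : koszul f.

(* M is an object of D^b(B/A). *)
Definition perfect_over (M : dgMod B) : Prop :=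
  perfect (restrict (kphi B) M).

(* rho is the rank over kappa(p) of H(RHom_B(M, k) (x)^L_S kappa(p)), computed
   from a semifree resolution F of M over B, a semifree resolution G over S of
   the dg S-module RHom_B(M, k) attached to F, and T = G (x)_S kappa(p).  The
   rank does not depend on these choices, hence the existential. *)
Definition crk (p : hprime k c) (M : dgMod B) (rho : option nat) : Prop :=
  exists (F : dgMod B) (q : dgHom F M)
         (G : dgMod (cohop k c)) (r : dgHom G (RHom fm F))
         (T : dgMod (kappa p)) (iota : dgHom G (restrict (to_kappa p) T)),
    [/\ semifree F, quasi_iso q, semifree G, quasi_iso r &
        is_base_change iota] /\ is_homology_rank T rho.

Definition jump_locus (i : nat) (M : dgMod B) (p : hprime k c) : Prop :=
  exists2 rho : option nat, crk p M rho & leq_rank i rho.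

End JumpLoci.

(* Main.v *)
(* RHom_B(-, k) (x)^L kappa(p) sends a triangle X -> Y -> cone g of dg B-modules
   to a triangle T_C -> T_Y -> cone t of dg kappa(p)-modules: if h : F_X -> F_Y
   lifts g to semifree resolutions, restriction along F_Y -> cone h is a map
   RHom(cone h, k) -> RHom(F_Y, k) whose cone is quasi-isomorphic to
   RHom(F_X, k), and one takes semifree resolutions over S and base change.
   Exactness of H(T_C) -> H(T_Y) -> H(cone t) over the graded field kappa(p)
   bounds the rank of Y by the sum of the ranks of cone g and X.  A section of
   Y -> cone g makes T_C -> T_Y split up to homotopy, so that H(T_C) -> H(T_Y) is
   injective, H(T_Y) -> H(cone t) is surjective, and the ranks add up.  Ranks are
   handled as the possible sizes of independent families of homology classes,
   which also covers infinite rank. *)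

(* The rank is defined by an existential over resolutions and base changes, so both inclusions rest
   on comparing arbitrary choices ([fiber_model_iso]). The obstacle is that a morphism of D(R) is a
   word with formal inverses, and equality is the generated congruence [deq]: nothing can be read
   off such a word directly. For F semifree, however, every word can be interpreted as a relation
   between homotopy classes of maps out of F, and congruent words have the same interpretation. This
   is the bridge from D(R) to chain maps, both for the isomorphisms of the triangle and for the
   section. Degrees are the other constraint. As n - 1 + 1 is not convertible to n, a map of degree
   1 is encoded as a map of degree 0 out of a suspension, and many identities are stated in degrees
   of the form n - 1. Homology is never formed as a quotient: the linear algebra takes place among
   cycles, modulo the graded submodule of boundaries. *)
Require Import Defs.
From HB Require Import structures.
From mathcomp Require Import all_boot all_order all_algebra.
From mathcomp Require Import ring_quotient zify.
From mathcomp Require Import boolp.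
From mathcomp Require Import mpoly.

Set Implicit Arguments.
Unset Strict Implicit.
Unset Printing Implicit Defensive.

Import Order.TTheory GRing.Theory Num.Theory.
Local Open Scope ring_scope.

(** * Equations in abelian groups *)

(* [ring] does not apply in an abelian group; [zmod] compares the coefficients
   of the atoms. *)
Inductive zexp := ZVar of nat | ZZero | ZAdd of zexp & zexp | ZOpp of zexp.

Section ZmodSolver.
Variable V : zmodType.

Fixpoint zeval (env : seq V) (e : zexp) : V :=
  match e with
  | ZVar n => nth 0 env n
  | ZZero => 0
  | ZAdd a b => zeval env a + zeval env b
  | ZOpp a => - zeval env a
  end.

Fixpoint zcoef (e : zexp) (i : nat) : int :=
  match e with
  | ZVar n => (n == i)%:Z
  | ZZero => 0
  | ZAdd a b => zcoef a i + zcoef b i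
  | ZOpp a => - zcoef a i
  end.

Fixpoint zbound (e : zexp) (n : nat) : bool :=
  match e with
  | ZVar m => (m < n)%N
  | ZZero => true
  | ZAdd a b => zbound a n && zbound b n
  | ZOpp a => zbound a n
  end.

Lemma zevalE (env : seq V) e : zbound e (size env) ->
  zeval env e = \sum_(i <- iota 0 (size env)) nth 0 env i *~ zcoef e i.
Proof.
elim: e => [m|_|a IHa b IHb|a IHa] /=.
- move=> mn; rewrite (bigD1_seq m) ?mem_iota ?iota_uniq //= eqxx.
  by rewrite big1 ?addr0 // => i /negbTE; rewrite eq_sym => ->.
- by rewrite big1.
- move=> /andP[/IHa -> /IHb ->]; rewrite -big_split; apply: eq_bigr => i _.
  by rewrite /= mulrzDr.
- by move=> /IHa ->; rewrite -sumrN; apply: eq_bigr => i _; rewrite mulrNz.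
Qed.

Lemma zmod_eq (env : seq V) e e' :
  [&& zbound e (size env), zbound e' (size env) &
      all (fun i => zcoef e i == zcoef e' i) (iota 0 (size env))] ->
  zeval env e = zeval env e'.
Proof.
case/and3P => b b' /allP h; rewrite !zevalE //.
by apply: eq_big_seq => i /h /eqP ->.
Qed.

End ZmodSolver.

Ltac zindex_syn x env :=
  lazymatch env with
  | x :: _ => constr:(O)
  | _ :: ?env' => let n := zindex_syn x env' in constr:(S n)
  end.
(** Convertible atoms are identified too: the same element may be typed in [shift M] at n or in M at
    n - 1. *)
Ltac zindex_conv x env :=
  match env with
  | ?y :: _ => let _ := constr:(erefl x : x = y) in constr:(O)
  | _ :: ?env' => let n := zindex_conv x env' in constr:(S n)
  end.
Ltac zindex x env :=
  match env with
  | _ => zindex_syn x env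
  | _ => zindex_conv x env
  end.
Ltac zinsert x env :=
  match env with
  | _ => let n := zindex x env in constr:(env)
  | _ => constr:(x :: env)
  end.
Ltac zatoms env t :=
  lazymatch t with
  | (?a + ?b)%R => let env := zatoms env a in zatoms env b
  | (- ?a)%R => zatoms env a
  | 0%R => env
  | _ => zinsert t env
  end.
Ltac zquote env t :=
  lazymatch t with
  | (?a + ?b)%R => let a := zquote env a in let b := zquote env b in constr:(ZAdd a b)
  | (- ?a)%R => let a := zquote env a in constr:(ZOpp a)
  | 0%R => constr:(ZZero)
  | _ => let n := zindex t env in constr:(ZVar n)
  end.
Ltac zmod :=
  lazymatch goal with
  | |- @eq ?T ?a ?b =>
    let env := zatoms (@nil T) a in
    let env := zatoms env b in
    let ea := zquote env a in
    let eb := zquote env b in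
    exact (@zmod_eq _ env ea eb isT)
  end.


(** * Graded modules with a basis *)

(** Recursive choice along a level in nat. The second hypothesis makes the condition at i local,
    depending only on values of smaller level, so the n-th approximation is final below level n and
    the diagonal of the approximations solves all conditions. *)
Lemma wf_choice (I : Type) (lvl : I -> nat) (V : I -> Type)
    (P : forall i, (forall j, V j) -> V i -> Prop) (c0 : forall i, V i) :
  (forall i c, (forall j, (lvl j < lvl i)%N -> P j c (c j)) ->
     exists x, P i c x) ->
  (forall i c c' x, (forall j, (lvl j < lvl i)%N -> c j = c' j) ->
     P i c x -> P i c' x) ->
  exists c, forall i, P i c (c i).
Proof.
move=> ex loc.
have [c cP] : exists c : nat -> forall i, V i, forall n,
    (forall i, (lvl i < n)%N -> P i (c n) (c n i)) /\
    (forall i, (lvl i < n)%N -> c n.+1 i = c n i).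
  (* The hypothesis on [c] sits inside the existential, so that the step is total and can be
     iterated by a plain recursion. *)
  have step n (c : forall i, V i) : exists c' : forall i, V i,
      (forall i, (lvl i < n)%N -> P i c (c i)) ->
      (forall i, (lvl i < n.+1)%N -> P i c' (c' i)) /\
      (forall i, (lvl i < n)%N -> c' i = c i).
    have [cn|] := pselect (forall i, (lvl i < n)%N -> P i c (c i)); last first.
      by exists c.
    have step1 i : exists x : V i,
        ((lvl i < n)%N -> x = c i) /\ ((lvl i < n.+1)%N -> P i c x).
      have [lin|nli] := ltnP (lvl i) n.
        by exists (c i); split=> // _; exact: cn.
      have [lin'|nli'] := ltnP (lvl i) n.+1; last by exists (c i).
      have [|x xP] := ex i c; last by exists x.
      by move=> j ji; apply: cn; lia.
    exists (fun i => projT1 (cid (step1 i))) => _.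
    have c'E i : (lvl i < n)%N -> projT1 (cid (step1 i)) = c i.
      by case: (cid (step1 i)) => x [].
    split=> // i lin.
    apply: (loc _ c) => [j ji|]; first by rewrite c'E //; lia.
    by case: (cid (step1 i)) => x [] /= _; apply.
  pose c := fix c n := if n is m.+1 then projT1 (cid (step m (c m))) else c0.
  have cP n : forall i, (lvl i < n)%N -> P i (c n) (c n i).
    elim: n => [//|n IH] /=.
    by case: (cid (step n (c n))) => c' /= /(_ IH) [].
  exists c => n; split=> [|/=]; first exact: cP.
  by case: (cid (step n (c n))) => c' /= /(_ (cP n)) [].
have cE i n : (lvl i < n)%N -> c n i = c (lvl i).+1 i.
  elim: n => // n IH; rewrite ltnS leq_eqVlt => /orP[/eqP -> //|lin].
  by rewrite (cP n).2 // IH.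
exists (fun i => c (lvl i).+1 i) => i.
apply: (loc _ (c (lvl i).+1)) => [j ji|]; first by apply: cE; lia.
exact: (cP _).1.
Qed.

(** No condition on the differentials: perturbations of a differential and homotopies are of this
    kind, with a suspension as target or source whose action absorbs the Koszul sign. *)
Definition glin (R : dgAlg) (M N : dgMod R) (phi : forall n, M n -> N n) :=
  (forall n (x y : M n), phi n (x + y) = phi n x + phi n y) /\
  (forall i j n (h : i + j = n) (a : R i) (x : M j),
     phi n (gact h a x) = gact h a (phi j x)).

Lemma glin_dgHom (R : dgAlg) (M N : dgMod R) (f : dgHom M N) : glin f.
Proof. by split; [exact: mhD | exact: mhZ]. Qed.

Section Glin.
Variables (R : dgAlg) (M N : dgMod R) (phi : forall n, M n -> N n).
Arguments phi : clear implicits.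
Hypothesis L : glin phi.

Lemma glin0 n : phi n 0 = 0. Proof. exact: hadd0 (L.1 n). Qed.
Lemma glinN n x : phi n (- x) = - phi n x. Proof. exact: haddN (L.1 n) x. Qed.
Lemma glinB n x y : phi n (x - y) = phi n x - phi n y.
Proof. by rewrite L.1 glinN. Qed.
Lemma glin_ksign n i x : phi n (ksign i x) = ksign i (phi n x).
Proof. exact: hadd_ksign (L.1 n) i x. Qed.

End Glin.

Section ActTheory.
Variables (R : dgAlg) (M : dgMod R).

Lemma gact0r i j n (h : i + j = n) (a : R i) : gact h a (0 : M j) = 0.
Proof. exact: hadd0 (gactDr h a). Qed.

Lemma gact0l i j n (h : i + j = n) (x : M j) : gact h (0 : R i) x = 0.
Proof. exact: (hadd0 (f := fun a => gact h a x) (fun a b => gactDl h a b x)). Qed.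

Lemma gactNl i j n (h : i + j = n) (a : R i) (x : M j) :
  gact h (- a) x = - gact h a x.
Proof. exact: (haddN (f := fun a => gact h a x) (fun a b => gactDl h a b x)). Qed.

Lemma gmdB n (x y : M n) : gmd (x - y) = gmd x - gmd y.
Proof. by rewrite gmdD gmdN. Qed.

Lemma gact_cast i i' j j' n (ei : i = i') (ej : j' = j) (h : i + j = n)
    (h' : i' + j' = n) (a : R i) (x : M j') :
  gact h a (eq_rect _ (fun d => M d) x _ ej) =
  gact h' (eq_rect _ (fun d => R d) a _ ei) x.
Proof. by subst i' j => /=; congr gact; exact: eq_irrelevance. Qed.

(** A boundary can be unpacked as [gmd y] only in a degree of the form m - 1, so proofs about
    boundaries begin by writing their degree in this form. *)
Lemma degB1 (n : int) : exists m : int, n = m - 1.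
Proof. by exists (n + 1); rewrite addrK. Qed.

Lemma boundaryE m (x : M (m - 1)) : boundary x <-> exists y : M m, x = gmd y.
Proof.
split=> [/boundaryP[m' [e [y ->]]]|[y ->]]; last exact: Boundary.
have em : m' = m by apply: (addIr (- 1)).
by subst m'; rewrite (eq_irrelevance e erefl); exists y.
Qed.

Lemma boundary0 n : boundary (0 : M n).
Proof. by have [m ?] := degB1 n; subst n; apply/boundaryE; exists 0; rewrite gmd0. Qed.

Lemma boundaryD n (x y : M n) : boundary x -> boundary y -> boundary (x + y).
Proof.
have [m ?] := degB1 n; subst n.
by move=> /boundaryE[u ->] /boundaryE[v ->]; rewrite -gmdD; exact: Boundary.
Qed.

Lemma boundaryN n (x : M n) : boundary x -> boundary (- x).
Proof.
have [m ?] := degB1 n; subst n.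
by move=> /boundaryE[u ->]; rewrite -gmdN; exact: Boundary.
Qed.

Lemma boundaryB n (x y : M n) : boundary x -> boundary y -> boundary (x - y).
Proof. by move=> bx /boundaryN; exact: boundaryD. Qed.

End ActTheory.

Lemma boundary_map (R : dgAlg) (M N : dgMod R) (f : dgHom M N) n (x : M n) :
  boundary x -> boundary (f n x).
Proof. by case=> m y; rewrite mhd; exact: Boundary. Qed.

Section Basis.
Variables (R : dgAlg) (M : dgMod R) (I : choiceType) (deg : I -> int).
Variables (b : forall i, M (deg i)).

(** The coefficient of an index is multiplied by its number of occurrences. The new coefficients
    depend only on [s] and [a], so one choice serves both a family and its images. *)
Lemma lincomb_undup n (s : seq I) (a : forall i, R (n - deg i)) :
  exists2 a' : forall i, R (n - deg i), (forall i, i \notin s -> a' i = 0) &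
    forall (N : dgMod R) (c : forall i, N (deg i)),
      lincomb c s a = lincomb c (undup s) a'.
Proof.
exists (fun i => a i *+ count_mem i s) => [i /count_memPn -> //|N c].
rewrite /lincomb -big_undup_iterop_count; apply: eq_bigr => i _.
rewrite -[iterop _ _ _ _]/(_ *+ _); elim: (count_mem i s) => [|m IH].
  by rewrite !mulr0n gact0l.
by rewrite !mulrS IH gactDl.
Qed.

Lemma lincomb_widen (N : dgMod R) (c : forall i, N (deg i)) n (s t : seq I)
    (a : forall i, R (n - deg i)) :
  uniq s -> uniq t -> {subset s <= t} -> (forall i, i \notin s -> a i = 0) ->
  lincomb c s a = lincomb c t a.
Proof.
move=> us ut st a0; rewrite /lincomb.
rewrite [RHS](bigID (mem s)) /= [X in _ + X]big1 ?addr0; last first.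
  by move=> i /a0 ->; rewrite gact0l.
rewrite -[RHS]big_filter; apply: perm_big; apply: uniq_perm => //.
  exact: filter_uniq.
by move=> i; rewrite mem_filter /=; case: (boolP (i \in s)) => //= /st ->.
Qed.

Lemma lincombD (N : dgMod R) (c : forall i, N (deg i)) n (s : seq I)
    (a a' : forall i, R (n - deg i)) :
  lincomb c s (fun i => a i + a' i) = lincomb c s a + lincomb c s a'.
Proof. by rewrite -big_split; apply: eq_bigr => i _; rewrite gactDl. Qed.

Lemma lincombB (N : dgMod R) (c : forall i, N (deg i)) n (s : seq I)
    (a a' : forall i, R (n - deg i)) :
  lincomb c s (fun i => a i - a' i) = lincomb c s a - lincomb c s a'.
Proof. by rewrite -sumrB; apply: eq_bigr => i _; rewrite gactDl gactNl. Qed.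

Lemma lincomb_glin (N N' : dgMod R) (phi : forall n, N n -> N' n)
   (L : glin phi) (c : forall i, N (deg i)) n (s : seq I)
   (a : forall i, R (n - deg i)) :
  phi n (lincomb c s a) = lincomb (fun i => phi _ (c i)) s a.
Proof.
rewrite /lincomb (hadd_sum (L.1 n)); apply: eq_bigr => i _; exact: L.2.
Qed.

Lemma act_deg p m n d : p + m = n -> p + (m - d) = n - d :> int.
Proof. by move<-; rewrite addrA. Qed.

Lemma gact_lincomb (N : dgMod R) (c : forall i, N (deg i)) p m n (h : p + m = n)
    (r : R p) (s : seq I) (a : forall i, R (m - deg i)) :
  gact h r (lincomb c s a) =
  lincomb c s (fun i => gmul (act_deg (deg i) h) r (a i)).
Proof.
rewrite /lincomb (hadd_sum (gactDr h r)); apply: eq_bigr => i _.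
by rewrite (gactA _ _ (subrK _ _) h).
Qed.

Hypothesis Hb : is_basis b.

Lemma basis_ind (P : forall n, M n -> Prop) :
  (forall n, P n 0) -> (forall n x y, P n x -> P n y -> P n (x + y)) ->
  (forall i p n (h : p + deg i = n) (r : R p), P n (gact h r (b i))) ->
  forall n x, P n x.
Proof.
move=> P0 PD Pb n x; have [s [a [_ ->]]] := Hb.1 n x.
by apply: big_ind => [|? ?|i _]; [exact: P0 | exact: PD | exact: Pb].
Qed.

Lemma glin_basis_eq (N : dgMod R) (phi psi : forall n, M n -> N n) :
  glin phi -> glin psi -> (forall i, phi _ (b i) = psi _ (b i)) ->
  forall n x, phi n x = psi n x.
Proof.
move=> L L' e; apply: basis_ind => [n|n x y ex ey|i p n h r].
- by rewrite !glin0.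
- by rewrite L.1 L'.1 ex ey.
- by rewrite L.2 L'.2 e.
Qed.

(** The list is not unique, as it may contain indices with coefficient zero, but the coefficient
    function is; this makes the linear extension in [basis_ext] well defined. *)
Definition finrep n (x : M n) (sa : seq I * (forall i, R (n - deg i))) :=
  [/\ uniq sa.1, forall i, i \notin sa.1 -> sa.2 i = 0 & x = lincomb b sa.1 sa.2].

Lemma finrep_ex n (x : M n) : exists sa, finrep x sa.
Proof.
have [s [a [_ ->]]] := Hb.1 n x.
have [a' a0 e] := lincomb_undup s a.
exists (undup s, a'); split=> //=; first exact: undup_uniq.
by move=> i; rewrite mem_undup; exact: a0.
Qed.

Lemma finrep_uniq n (x : M n) sa sa' : finrep x sa -> finrep x sa' ->
  forall i, sa.2 i = sa'.2 i.
Proof.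
move=> [us a0 ->] [us' a0' e] i.
pose t := undup (sa.1 ++ sa'.1).
have st : {subset sa.1 <= t} by move=> j js; rewrite mem_undup mem_cat js.
have st' : {subset sa'.1 <= t}.
  by move=> j js; rewrite mem_undup mem_cat js orbT.
have ut : uniq t by exact: undup_uniq.
have [it|nit] := boolP (i \in t).
  apply/eqP; rewrite -subr_eq0; apply/eqP.
  apply: (Hb.2 n t (fun i => sa.2 i - sa'.2 i) ut) => //.
  rewrite lincombB -(lincomb_widen b us ut st a0).
  by rewrite -(lincomb_widen b us' ut st' a0') e subrr.
by rewrite a0 ?a0' //; apply: contra nit; [exact: st'|exact: st].
Qed.

Lemma finrep_lincomb (N : dgMod R) (c : forall i, N (deg i)) n (x : M n) sa sa' :
  finrep x sa -> finrep x sa' -> lincomb c sa.1 sa.2 = lincomb c sa'.1 sa'.2.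
Proof.
move=> h h'; have e := finrep_uniq h h'.
move: h h' => [us a0 _] [us' a0' _].
pose t := undup (sa.1 ++ sa'.1).
have st : {subset sa.1 <= t} by move=> j js; rewrite mem_undup mem_cat js.
have st' : {subset sa'.1 <= t}.
  by move=> j js; rewrite mem_undup mem_cat js orbT.
have ut : uniq t by exact: undup_uniq.
rewrite (lincomb_widen c us ut st a0) (lincomb_widen c us' ut st' a0').
by apply: eq_bigr => i _; rewrite e.
Qed.

Lemma basis_ext (N : dgMod R) (c : forall i, N (deg i)) :
  exists2 phi : forall n, M n -> N n,
    glin phi & forall i, phi _ (b i) = c i.
Proof.
pose rep n (x : M n) := projT1 (cid (finrep_ex x)).
have repP n (x : M n) : finrep x (rep n x).
  by rewrite /rep; case: cid.
pose phi n (x : M n) := lincomb c (rep n x).1 (rep n x).2.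
have phiE n s (a : forall i, R (n - deg i)) :
    phi n (lincomb b s a) = lincomb c s a.
  have [a' a0 e] := lincomb_undup s a; rewrite !e.
  apply: (@finrep_lincomb N c n _ _ (undup s, a') (repP _ _)); split=> //=.
    exact: undup_uniq.
  by move=> i; rewrite mem_undup; exact: a0.
have phiZ : forall i j n (h : i + j = n) (a : R i) (x : M j),
    phi n (gact h a x) = gact h a (phi j x).
  move=> p m n h r x; have [s [a [_ ->]]] := Hb.1 m x.
  by rewrite gact_lincomb !phiE -gact_lincomb.
exists phi; first split=> // n x y.
  have [us a0 ex] := repP n x; have [us' a0' ey] := repP n y.
  pose t := undup ((rep n x).1 ++ (rep n y).1).
  have st : {subset (rep n x).1 <= t}.
    by move=> j js; rewrite mem_undup mem_cat js.
  have st' : {subset (rep n y).1 <= t}.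
    by move=> j js; rewrite mem_undup mem_cat js orbT.
  have ut : uniq t by exact: undup_uniq.
  rewrite [in LHS]ex [in LHS]ey (lincomb_widen b us ut st a0).
  rewrite (lincomb_widen b us' ut st' a0') -lincombD phiE lincombD.
  by rewrite -(lincomb_widen c us ut st a0) -(lincomb_widen c us' ut st' a0').
move=> i.
have h0 : 0 + deg i = deg i by rewrite add0r.
have e1 : 0 = deg i - deg i :> int by rewrite subrr.
(* The coefficient 1 at i must sit in degree deg i - deg i, which is 0 only up to a transport. *)
pose one_ j : R (deg i - deg j) :=
  if pselect (0 = deg i - deg j) is left e then
    eq_rect _ (fun d => R d) (gone R) _ e else 0.
have oneE (N' : dgMod R) (c' : forall i, N' (deg i)) : lincomb c' [:: i] one_ = c' i.
  rewrite /lincomb big_seq1 /one_; case: pselect => // e.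
  by rewrite -(@gact_cast _ _ _ _ _ _ _ e erefl h0) gact1.
by rewrite -[in LHS](oneE M b) phiE oneE.
Qed.

End Basis.

(** * Free and twisted modules *)

Section Span.
Variables (R : dgAlg) (M : dgMod R) (I : choiceType) (deg : I -> int).
Variables (b : forall i, M (deg i)).

Lemma in_span0 (P : I -> Prop) n : in_span b P (0 : M n).
Proof. by exists [::], (fun=> 0); split=> //; rewrite /lincomb big_nil. Qed.

Lemma in_spanD (P : I -> Prop) n (x y : M n) :
  in_span b P x -> in_span b P y -> in_span b P (x + y).
Proof.
move=> [s [a [sP ->]]] [s' [a' [sP' ->]]].
have [a1 a0 ->] := lincomb_undup s a.
have [a1' a0' ->] := lincomb_undup s' a'.
pose t := undup (s ++ s').
exists t, (fun i => a1 i + a1' i); split=> [i|].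
  by rewrite mem_undup mem_cat => /orP[/sP|/sP'].
rewrite lincombD; congr (_ + _); apply: lincomb_widen; rewrite ?undup_uniq //.
- by move=> i; rewrite !mem_undup mem_cat => ->.
- by move=> i; rewrite mem_undup; exact: a0.
- by move=> i; rewrite !mem_undup mem_cat orbC => ->.
- by move=> i; rewrite mem_undup; exact: a0'.
Qed.

Lemma in_span_gact (P : I -> Prop) i p n (h : p + deg i = n) (r : R p) :
  P i -> in_span b P (gact h r (b i)).
Proof.
move=> Pi; have e : p = n - deg i by rewrite -h addrK.
pose a j : R (n - deg j) := if pselect (i = j) is left ij then
  eq_rect _ (fun d => R d) r _ (etrans e (congr1 (fun j => n - deg j) ij)) else 0.
exists [:: i], a; split=> [j|]; first by rewrite inE => /eqP ->.
rewrite /lincomb big_seq1 /a; case: pselect => // ii.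
exact: (@gact_cast _ _ _ _ _ _ _ _ erefl).
Qed.

Lemma in_span_glin_eq (P : I -> Prop) (N : dgMod R) (phi psi : forall n, M n -> N n) :
  glin phi -> glin psi -> (forall i, P i -> phi _ (b i) = psi _ (b i)) ->
  forall n x, in_span b P x -> phi n x = psi n x.
Proof.
move=> L L' e n x [s [a [sP ->]]]; rewrite !lincomb_glin //.
by apply: eq_big_seq => i /sP /e ->.
Qed.

Lemma in_span_weaken (P Q : I -> Prop) n (x : M n) :
  (forall i, P i -> Q i) -> in_span b P x -> in_span b Q x.
Proof. by move=> PQ [s [a [sP ->]]]; exists s, a; split=> // i /sP /PQ. Qed.

End Span.

Section FreeModule.
Variables (R : dgAlg) (I : choiceType) (deg : I -> int).

Record finsupp (n : int) := FinSupp {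
  fsval :> forall i, R (n - deg i);
  fsP : exists s : seq I, forall i, i \notin s -> fsval i = 0
}.

HB.instance Definition _ n := gen_eqMixin (finsupp n).
HB.instance Definition _ n := gen_choiceMixin (finsupp n).

Lemma fs_eq n (x y : finsupp n) : (forall i, x i = y i) -> x = y.
Proof.
case: x y => x hx [y hy] /= xy.
have exy : x = y by apply: functional_extensionality_dep.
by subst y; congr FinSupp.
Qed.

Lemma fs_zero_subproof n :
  exists s : seq I, forall i, i \notin s -> (0 : R (n - deg i)) = 0.
Proof. by exists [::]. Qed.

Lemma fs_opp_subproof n (x : finsupp n) :
  exists s : seq I, forall i, i \notin s -> - x i = 0.
Proof. by have [s sP] := fsP x; exists s => i /sP ->; rewrite oppr0. Qed.

Lemma fs_add_subproof n (x y : finsupp n) :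
  exists s : seq I, forall i, i \notin s -> x i + y i = 0.
Proof.
have [s sP] := fsP x; have [t tP] := fsP y; exists (s ++ t) => i.
by rewrite mem_cat negb_or => /andP[/sP -> /tP ->]; rewrite addr0.
Qed.

Definition fs_zero n := FinSupp (fs_zero_subproof n).
Definition fs_opp n (x : finsupp n) := FinSupp (fs_opp_subproof x).
Definition fs_add n (x y : finsupp n) := FinSupp (fs_add_subproof x y).

Lemma fs_addA n : associative (@fs_add n).
Proof. by move=> x y z; apply: fs_eq => i; exact: addrA. Qed.
Lemma fs_addC n : commutative (@fs_add n).
Proof. by move=> x y; apply: fs_eq => i; exact: addrC. Qed.
Lemma fs_add0 n : left_id (fs_zero n) (@fs_add n).
Proof. by move=> x; apply: fs_eq => i; exact: add0r. Qed.
Lemma fs_addN n : left_inverse (fs_zero n) (@fs_opp n) (@fs_add n).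
Proof. by move=> x; apply: fs_eq => i; exact: addNr. Qed.

HB.instance Definition _ n := GRing.isZmodule.Build (finsupp n)
  (@fs_addA n) (@fs_addC n) (@fs_add0 n) (@fs_addN n).

Lemma gmul0r i j n (h : i + j = n) (a : R i) : gmul h a (0 : R j) = 0.
Proof. exact: (@gact0r R (regular R)). Qed.

Lemma gd0 n : gd (0 : R n) = 0.
Proof. exact: (@gmd0 R (regular R)). Qed.

Lemma fs_act_subproof p m n (h : p + m = n) (r : R p) (x : finsupp m) :
  exists s : seq I, forall i, i \notin s -> gmul (act_deg (deg i) h) r (x i) = 0.
Proof. by have [s sP] := fsP x; exists s => i /sP ->; rewrite gmul0r. Qed.

Definition fs_act p m n (h : p + m = n) (r : R p) (x : finsupp m) : finsupp n :=
  FinSupp (fs_act_subproof h r x).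

Definition rcast m n (e : m = n) (x : R m) : R n := eq_rect _ (fun d => R d) x _ e.

Lemma rcastD m n (e : m = n) (x y : R m) : rcast e (x + y) = rcast e x + rcast e y.
Proof. by case: _ / e. Qed.

Lemma rcast0 m n (e : m = n) : rcast e 0 = 0.
Proof. by case: _ / e. Qed.

Lemma rcast_dd m n l (e : m - 1 = n) (e' : n - 1 = l) (x : R m) :
  rcast e' (gd (rcast e (gd x))) = 0.
Proof. by subst n; case: _ / e' => /=; rewrite gdd. Qed.

Lemma rcast_leibniz p q m m' q' (h : p + q = m) (e : m - 1 = m') (e' : q - 1 = q')
    (h1 : p - 1 + q = m') (h2 : p + q' = m') (x : R p) (y : R q) :
  rcast e (gd (gmul h x y)) =
  gmul h1 (gd x) y + ksign p (gmul h2 x (rcast e' (gd y))).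
Proof. by subst m' q' => /=; rewrite (gleibniz _ h1 h2). Qed.

Lemma diff_deg (n d : int) : n - d - 1 = n - 1 - d.
Proof. by rewrite addrAC. Qed.

Lemma fs_diff_subproof n (x : finsupp n) :
  exists s : seq I, forall i, i \notin s -> rcast (diff_deg n (deg i)) (gd (x i)) = 0.
Proof.
have [s sP] := fsP x; exists s => i /sP ->.
by rewrite gd0 rcast0.
Qed.

Definition fs_diff n (x : finsupp n) : finsupp (n - 1) := FinSupp (fs_diff_subproof x).

Lemma fs_ksign n (x : finsupp n) p i : ksign p x i = ksign p (x i).
Proof. by rewrite /ksign; case: ifP. Qed.

(** The differential acts on coefficients alone, so the basis elements are cycles. Resolutions and
    base changes are built as perturbations of this module. *)
Definition free0 : dgMod R.
Proof.
refine (@DgMod R (fun n => finsupp n : zmodType) fs_act fs_diff _ _ _ _ _ _ _).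
- by move=> *; apply: fs_eq => l; rewrite /= gmulDl.
- by move=> *; apply: fs_eq => l; rewrite /= gmulDr.
- by move=> *; apply: fs_eq => t; exact: gmulA.
- by move=> *; apply: fs_eq => t; exact: gmul1l.
- by move=> *; apply: fs_eq => t; rewrite /= gdD rcastD.
- by move=> *; apply: fs_eq => t; rewrite /= rcast_dd.
- move=> i j n h h1 h2 a x; apply: fs_eq => t /=; rewrite fs_ksign /=.
  exact: rcast_leibniz.
Defined.

Definition fs_delta_fun i j : R (deg i - deg j) :=
  if pselect (i = j) is left e then
    rcast (esym (etrans (congr1 (fun k => deg i - deg k) (esym e)) (subrr (deg i)))) (gone R)
  else 0.

Lemma fs_delta_subproof i :
  exists s : seq I, forall j, j \notin s -> fs_delta_fun i j = 0.
Proof.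
exists [:: i] => j; rewrite inE /fs_delta_fun => /eqP ji.
by case: pselect => // e; case: ji.
Qed.

Definition fs_delta i : free0 (deg i) := FinSupp (fs_delta_subproof i).

Lemma rcast_gmul1 p d n (e : 0 = d) (h : p + d = n) (e' : p = n) (r : R p) :
  gmul h r (rcast e (gone R)) = rcast e' r.
Proof. by subst d; case: _ / e' h => h; rewrite /= gmul1r. Qed.

Lemma gact_deltaE n i (r : R (n - deg i)) j :
  (gact (subrK (deg i) n) r (fs_delta i) : finsupp n) j =
  if pselect (i = j) is left e then
    rcast (congr1 (fun k => n - deg k) e) r else 0.
Proof.
rewrite /= /fs_delta_fun; case: pselect => [e|_]; last by rewrite gmul0r.
exact: rcast_gmul1.
Qed.

Lemma lincomb_deltaE n (s : seq I) (a : forall i, R (n - deg i)) j : uniq s ->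
  (lincomb fs_delta s a : finsupp n) j = if j \in s then a j else 0.
Proof.
elim: s => [|i s IH] /=; first by rewrite /lincomb big_nil.
move=> /andP[nis us].
transitivity ((gact (subrK (deg i) n) (a i) (fs_delta i) : finsupp n) j +
    (lincomb fs_delta s a : finsupp n) j).
  by rewrite {1}/lincomb big_cons.
rewrite gact_deltaE IH // inE; case: pselect => [e|ne].
  by subst j; rewrite eqxx (negbTE nis) addr0.
by rewrite add0r; case: eqP => // e; case: ne.
Qed.

Lemma free0_basis : is_basis fs_delta.
Proof.
split=> [n x|n s a us s0 i si].
  have [s sP] := fsP x.
  exists (undup s), x; split=> //; apply: fs_eq => j.
  rewrite lincomb_deltaE ?undup_uniq // mem_undup.
  by case: (boolP (j \in s)) => // /sP.
have := lincomb_deltaE a i us; rewrite s0 si => <- //.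
Qed.

Lemma rcast_d1 d (e : 0 = d) d' (e' : d - 1 = d') : rcast e' (gd (rcast e (gone R))) = 0.
Proof.
subst d d' => /=.
(* The Leibniz rule for 1 = 1 . 1 reads d(1) = d(1) + d(1), whence d(1) = 0. *)
have := gleibniz (addr0 0) (addr0 (0 - 1)) (add0r (0 - 1)) (gone R) (gone R).
rewrite !gmul1r gmul1l -[ksign 0 _]/(gd (gone R)) -[LHS]addr0.
by move/addrI => <-.
Qed.

Lemma gmd_delta i : gmd (fs_delta i) = 0.
Proof.
apply: fs_eq => j /=; rewrite /fs_delta_fun; case: pselect => [e|_].
  exact: rcast_d1.
by rewrite gd0 rcast0.
Qed.

End FreeModule.

Section Twist.
Variables (R : dgAlg) (M : dgMod R) (D : forall n, M n -> M (n - 1)).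
Arguments D : clear implicits.
Hypothesis L : @glin R M (shift M) D.
Hypothesis D2 : forall n (x : M n), gmd (gmd x + D n x) + D _ (gmd x + D n x) = 0.

(** Perturbation of a differential: linearity of D towards [shift M] is the sign rule under which d
    + D still satisfies the Leibniz rule. *)
Definition twist : dgMod R.
Proof.
refine (@DgMod R M (@gact R M) (fun n x => gmd x + D n x) _ _ _ _ _ D2 _).
- exact: gactDl.
- exact: gactDr.
- exact: gactA.
- exact: gact1.
- by move=> n x y; rewrite gmdD L.1 addrACA.
- move=> i j n h h1 h2 a x; rewrite (gmleibniz h h1 h2) L.2 /=.
  rewrite gactDr ksignD addrA; congr (_ + ksign i (gact _ _ _)).
  exact: eq_irrelevance.
Defined.

End Twist.

(** * Semifree resolutions *)

Section BasisChain.
Variables (R : dgAlg) (M N : dgMod R) (I : choiceType) (deg : I -> int).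
Variables (b : forall i, M (deg i)) (Hb : is_basis b).

(** The failure of phi to commute with the differentials is linear, because the terms with d(r) in
    the two Leibniz rules cancel. *)
Lemma basis_chain (phi : forall n, M n -> N n) : glin phi ->
  (forall i, phi _ (gmd (b i)) = gmd (phi _ (b i))) ->
  forall n x, phi _ (gmd x) = gmd (phi n x).
Proof.
move=> L e; apply: (basis_ind Hb) => [n|n x y ex ey|i p n h r].
- by rewrite gmd0 !glin0 // gmd0.
- by rewrite gmdD !L.1 gmdD ex ey.
- have h1 : p - 1 + deg i = n - 1 by rewrite -h addrAC.
  have h2 : p + (deg i - 1) = n - 1 by rewrite -h addrA.
  rewrite (gmleibniz h h1 h2) L.1 glin_ksign // !L.2 e.
  by rewrite -(gmleibniz h h1 h2).
Qed.

End BasisChain.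

Section FreeDg.
Variables (R : dgAlg) (I : choiceType) (deg : I -> int).
Variables (D : forall n, free0 R deg n -> free0 R deg (n - 1)).
Arguments D : clear implicits.
Hypothesis L : @glin R (free0 R deg) (shift (free0 R deg)) D.

(** The square of d + D is linear, the cross terms of the Leibniz rule cancelling by sign. On a
    basis element d vanishes, which leaves the two terms of the hypothesis. *)
Lemma free_twist_sq :
  (forall i, gmd (D _ (fs_delta R deg i)) + D _ (D _ (fs_delta R deg i)) = 0) ->
  forall n (x : free0 R deg n), gmd (gmd x + D n x) + D _ (gmd x + D n x) = 0.
Proof.
move=> H; pose d n (x : free0 R deg n) := gmd x + D n x.
have dD n x y : d n (x + y) = d n x + d n y by rewrite /d gmdD L.1 addrACA.
have dZ i j n (h : i + j = n) (h1 : i - 1 + j = n - 1) (h2 : i + (j - 1) = n - 1)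
    (a : R i) x : d n (gact h a x) = gact h1 (gd a) x + ksign i (gact h2 a (d j x)).
  rewrite /d (gmleibniz h h1 h2) L.2 gactDr ksignD addrA.
  by congr (_ + ksign i (gact _ _ _)); exact: eq_irrelevance.
suff dd : forall n x, d _ (d n x) = 0 by [].
apply: (basis_ind (free0_basis R deg)) => [n|n x y dx dy|i p n h r].
- by rewrite !(hadd0 (dD _)).
- by move: dx dy => /= dx dy; rewrite (dD _ x y) dD dx dy addr0.
- have h1 : p - 1 + deg i = n - 1 by rewrite -h addrAC.
  have h2 : p + (deg i - 1) = n - 1 by rewrite -h addrA.
  have h3 : p - 1 - 1 + deg i = n - 1 - 1 by rewrite -h1 addrAC.
  have h4 : p - 1 + (deg i - 1) = n - 1 - 1 by rewrite -h1 addrA.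
  have h5 : p + (deg i - 1 - 1) = n - 1 - 1 by rewrite -h2 !addrA.
  rewrite (dZ _ _ _ h h1 h2) dD (dZ _ _ _ h1 h3 h4).
  rewrite (hadd_ksign (dD _)) (dZ _ _ _ h2 h4 h5) gdd gact0l add0r ksign_pred.
  rewrite ksignD addKr ksignK.
  suff -> : d _ (d _ (fs_delta R deg i)) = 0 by rewrite gact0r.
  by rewrite /d gmd_delta add0r H.
Qed.

End FreeDg.

(* A tree is a finite formal description of a generator: [Leaf y] has zero
   boundary and is sent to y, and grafting adds a multiple of the generator of
   another tree to the boundary.  Thus every element of the module freely
   generated by the trees is the formal boundary of some tree. *)
Inductive tree (R : dgAlg) (M : dgMod R) : int -> Type :=
| Leaf m (y : M m) : tree M m
| Graft i n m (h : i + n = m - 1) (a : R i) (t : tree M n) (t' : tree M m) :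
    tree M m.
Arguments Leaf {R M m} y.
Arguments Graft {R M i n m} h a t t'.

Section Resolution.
Variables (R : dgAlg) (M : dgMod R).

Definition gen : Type := {m : int & tree M m}.
HB.instance Definition _ := gen_eqMixin gen.
HB.instance Definition _ := gen_choiceMixin gen.

Definition gdeg (t : gen) : int := projT1 t.
Let F0 := free0 R gdeg.
Let e (t : gen) : F0 (gdeg t) := fs_delta R gdeg t.

Fixpoint height m (t : tree M m) : nat :=
  match t with
  | Leaf _ _ => 0
  | Graft _ _ _ _ _ t t' => maxn (height t).+1 (height t')
  end.

Fixpoint fboundary m (t : tree M m) : F0 (m - 1) :=
  match t in tree _ m return F0 (m - 1) with
  | Leaf _ _ => 0
  | Graft _ n _ h a t t' => fboundary t' + gact h a (e (existT _ n t))
  end.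

Fixpoint fimage m (t : tree M m) : M m :=
  match t in tree _ m return M m with
  | Leaf _ y => y
  | Graft _ _ _ _ _ _ t' => fimage t'
  end.

Definition glvl (t : gen) : nat := height (projT2 t).

Lemma fboundary_span m (t : tree M m) :
  in_span e (fun j => (glvl j < height t)%N) (fboundary t).
Proof.
elim: t => [m' y|i n m' h a t _ t' IH] /=; first exact: in_span0.
apply: in_spanD.
  by apply: in_span_weaken IH => j; rewrite /glvl => /leq_trans -> //; exact: leq_maxr.
by apply: (@in_span_gact _ F0 _ _ e _ (existT _ n t)); rewrite /glvl /= leq_maxl.
Qed.

(** Grafting adds to the formal boundary and leaves the image alone, so the two can be prescribed
    independently. *)
Lemma fboundary_surj m (y : M m) (x : F0 (m - 1)) :
  exists t : tree M m, fboundary t = x /\ fimage t = y.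
Proof.
have [s [a [_ ->]]] := (free0_basis R gdeg).1 _ x.
exists (foldr (fun i => Graft (subrK (gdeg i) (m - 1)) (a i) (projT2 i)) (Leaf y) s).
rewrite /lincomb; elim: s => [|[n t] s [IH1 IH2]] /=; first by rewrite big_nil.
by rewrite big_cons /= IH1 IH2; split=> //; exact: addrC.
Qed.

(** All generators are adjoined at once. A tree carries its intended boundary and image, and its
    height is its level; the values actually used are selected by recursion on the height, as their
    legitimacy depends only on smaller trees. *)
Lemma semifree_resolution : exists (F : dgMod R) (q : dgHom F M), semifree F /\ quasi_iso q.
Proof.
pose Hb := free0_basis R gdeg.
pose V (t : gen) : Type := (F0 (gdeg t - 1) * M (gdeg t))%type.
pose D0 (c : forall t, V t) := cid2 (basis_ext Hb (N := shift F0) (fun t => (c t).1)).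
pose D c : forall n, F0 n -> F0 (n - 1) := s2val (D0 c).
have DL c : glin (M := F0) (N := shift F0) (D c) := s2valP (D0 c).
have De c t : D c _ (e t) = (c t).1 := s2valP' (D0 c) t.
pose eps0 (c : forall t, V t) := cid2 (basis_ext Hb (N := M) (fun t => (c t).2)).
pose eps c : forall n, F0 n -> M n := s2val (eps0 c).
have epsL c : glin (M := F0) (N := M) (eps c) := s2valP (eps0 c).
have epse c t : eps c _ (e t) = (c t).2 := s2valP' (eps0 c) t.
pose ok c (t : gen) := let z := fboundary (projT2 t) in
  gmd z + D c _ z = 0 /\ eps c _ z = gmd (fimage (projT2 t)).
(* A tree whose formal boundary does not fit is given zero boundary and zero
   image; the cycle so created is killed by a larger tree. *)
have [c cP] : exists c : forall t, V t, forall t,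
    c t = if pselect (ok c t) is left _ then
            (fboundary (projT2 t), fimage (projT2 t)) else (0, 0).
  apply: (@wf_choice gen glvl V (fun t c x => x = if pselect (ok c t) is left _ then
            (fboundary (projT2 t), fimage (projT2 t)) else (0, 0)) (fun=> (0, 0))).
    by move=> t c _; eexists.
  move=> t c c' x cc' ->; have -> // : ok c t = ok c' t.
  have sp := fboundary_span (projT2 t).
  rewrite /ok (in_span_glin_eq (DL c) (DL c') _ sp).
    by rewrite (in_span_glin_eq (epsL c) (epsL c') _ sp) // => j lj; rewrite !epse cc'.
  by move=> j lj; rewrite !De cc'.
have D2 : forall n (x : F0 n), gmd (gmd x + D c n x) + D c _ (gmd x + D c n x) = 0.
  apply: free_twist_sq => // t; rewrite De cP.
  case: pselect => [[]|_] //; rewrite -[(0, 0).1]/(0 : F0 _).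
  by rewrite gmd0 (hadd0 ((DL c).1 _)) addr0.
pose F := twist (DL c) D2.
have eE t : (gmd (e t : F (gdeg t)) : F (gdeg t - 1)) = (c t).1.
  by rewrite -[LHS]/(gmd (e t) + D c _ (e t)) De gmd_delta add0r.
have HbF : @is_basis R F gen gdeg e by exact: Hb.
have epsLF : @glin R F M (eps c) by exact: epsL.
have epsd : forall n (x : F n), eps c (n - 1) (gmd x) = gmd (eps c n x).
  apply: (basis_chain HbF epsLF) => t; rewrite eE epse cP.
  by case: pselect => [[_]|_] //=; rewrite (hadd0 ((epsL c).1 _)) gmd0.
exists F, (DgHom epsLF.1 epsLF.2 epsd); split.
  exists gen, gdeg, e, glvl; split=> // t; rewrite eE cP.
  case: pselect => [_|_]; last exact: in_span0.
  exact: (fboundary_span (projT2 t)).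
(* One generator serves both halves of the quasi-isomorphism: y a primitive of the image of a cycle
   x gives injectivity, and x = 0 with y a cycle gives surjectivity. *)
have killP m (x : F (m - 1)) (y : M m) : gmd x = 0 -> eps c _ x = gmd y ->
    exists x' : F m, gmd x' = x /\ eps c _ x' = y.
  move=> dx ex; have [t [tx ty]] := fboundary_surj y x.
  move: (eE (existT _ m t)) (epse c (existT _ m t)); rewrite cP /ok /= tx ty.
  case: pselect => [_ /= E1 E2|[]]; first by exists (e (existT _ m t)).
  by split=> //; exact: dx.
split=> n x dx.
  have [m ?] := degB1 n; subst n => /boundaryE[y ey].
  by have [x' [<- _]] := killP m x y dx ey; exact: Boundary.
have e0 : eps c _ (0 : F (n - 1)) = gmd x by rewrite (glin0 epsLF) dx.
have [x' [dx' ex']] := @killP n 0 x (gmd0 F _) e0.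
by exists x' => //=; rewrite ex' subrr; exact: boundary0.
Qed.

End Resolution.

(** * Suspensions and cones of semifree modules *)

Lemma in_span_lincomb (R : dgAlg) (M : dgMod R) (I J : choiceType) (deg : I -> int)
    (b : forall i, M (deg i)) (P : I -> Prop) (degJ : J -> int)
    (c : forall j, M (degJ j)) n (s : seq J) (a : forall j, R (n - degJ j)) :
  (forall j, j \in s -> in_span b P (gact (subrK (degJ j) n) (a j) (c j))) ->
  in_span b P (lincomb c s a).
Proof.
rewrite /lincomb => H; rewrite big_seq.
by apply: big_ind => [|x y|j /H //]; [exact: in_span0 | exact: in_spanD].
Qed.

Lemma gact_castr (R : dgAlg) (M : dgMod R) i j j' n (ej : j' = j) (h : i + j = n)
    (h' : i + j' = n) (a : R i) (x : M j') :
  gact h a (eq_rect _ (fun d => M d) x _ ej) = gact h' a x.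
Proof. exact: (gact_cast (erefl i)). Qed.

Section ShiftBasis.
Variables (R : dgAlg) (M : dgMod R) (I : choiceType) (deg : I -> int).
Variables (b : forall i, M (deg i)).

Definition shift_basis i : shift M (deg i + 1) :=
  eq_rect _ (fun d => M d) (b i) _ (esym (addrK 1 (deg i))).

Lemma gact_shift_basis i p n (h : p + deg i = n - 1) (h' : p + (deg i + 1) = n) (r : R p) :
  gact h r (b i) = @gact R (shift M) _ _ _ h' (ksign p r) (shift_basis i).
Proof. by rewrite /= gact_ksignl ksignK gact_castr. Qed.

Lemma in_span_shift (P : I -> Prop) n (x : M (n - 1)) :
  in_span b P x -> @in_span R (shift M) I (fun i => deg i + 1) shift_basis P n x.
Proof.
move=> [s [a [sP ->]]]; rewrite /lincomb big_seq.
apply: (big_ind (@in_span R (shift M) I (fun i => deg i + 1) shift_basis P n)).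
- exact: in_span0.
- exact: in_spanD.
- move=> i /sP Pi; have h : n - 1 - deg i + (deg i + 1) = n by lia.
  by rewrite (gact_shift_basis _ h); exact: in_span_gact.
Qed.

Lemma is_basis_shift :
  is_basis b -> @is_basis R (shift M) I (fun i => deg i + 1) shift_basis.
Proof.
move=> Hb; split=> [n x|n s a us s0 i si].
  exact/in_span_shift/Hb.1.
have e j : n - (deg j + 1) = n - 1 - deg j by rewrite opprD addrA addrAC.
pose a' j : R (n - 1 - deg j) := rcast (e j) (ksign (n - (deg j + 1)) (a j)).
have Ha := Hb.2 (n - 1) s a' us.
have /Ha/(_ i si) : lincomb b s a' = 0.
  rewrite -[RHS]s0; apply: eq_bigr => j _ /=.
  rewrite -gact_ksignl.
  exact: esym (gact_cast (e j) _ _ (subrK (deg j) (n - 1)) _ _).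
rewrite /a'; move: (a i); case: _ / (e i) => x /= x0.
by rewrite -[x](ksignK (n - (deg i + 1))) x0 ksign_0.
Qed.

Lemma gmd_shift_basis i :
  @gmd R (shift M) _ (shift_basis i) =
  - eq_rect _ (fun d => M d) (gmd (b i)) _ (congr1 (fun d => d - 1) (esym (addrK 1 (deg i)))).
Proof. by rewrite /= /shift_basis; case: _ / (esym (addrK 1 (deg i))). Qed.

End ShiftBasis.

Lemma in_spanN (R : dgAlg) (M : dgMod R) (I : choiceType) (deg : I -> int)
    (b : forall i, M (deg i)) (P : I -> Prop) n (x : M n) :
  in_span b P x -> in_span b P (- x).
Proof.
move=> [s [a [sP ->]]]; exists s, (fun i => - a i); split=> //.
by rewrite /lincomb -sumrN; apply: eq_bigr => i _; rewrite gactNl.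
Qed.

Lemma in_span_cast (R : dgAlg) (M : dgMod R) (I : choiceType) (deg : I -> int)
    (b : forall i, M (deg i)) (P : I -> Prop) n m (e : n = m) (x : M n) :
  in_span b P x -> in_span b P (eq_rect _ (fun d => M d) x _ e).
Proof. by case: _ / e. Qed.

Lemma semifree_shift (R : dgAlg) (M : dgMod R) : semifree M -> semifree (shift M).
Proof.
move=> [I [deg [b [lvl [Hb Hd]]]]].
exists I, (fun i => deg i + 1), (shift_basis b), lvl; split.
  exact: is_basis_shift.
move=> i; apply: in_span_shift; rewrite gmd_shift_basis.
by apply: in_spanN; apply: in_span_cast.
Qed.

Section ConeBasis.
Variables (R : dgAlg) (X Y : dgMod R) (f : dgHom X Y).
Variables (I J : choiceType) (degX : I -> int) (degY : J -> int).
Variables (bX : forall i, shift X (degX i)) (bY : forall j, Y (degY j)).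

Definition cone_deg (u : J + I) : int :=
  match u with inl j => degY j | inr i => degX i end.

Definition cone_basis (u : J + I) : cone f (cone_deg u) :=
  match u return cone f (cone_deg u) with
  | inl j => (bY j, 0)
  | inr i => (0, bX i)
  end.

Lemma in_span_coneIn (P : J -> Prop) (Q : J + I -> Prop) n (y : Y n) :
  (forall j, P j -> Q (inl j)) -> in_span bY P y ->
  in_span cone_basis Q ((y, 0) : cone f n).
Proof.
move=> PQ [s [a [sP ->]]].
rewrite -[X in in_span _ _ X]/(coneIn f n (lincomb bY s a)).
rewrite (lincomb_glin (glin_dgHom (coneIn f))).
apply: in_span_lincomb => j /sP /PQ Qj.
exact: (@in_span_gact _ _ _ _ cone_basis Q (inl j)).
Qed.

Lemma glin_cone_inr : @glin R (shift X) (cone f) (fun n x => (0, x)).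
Proof.
by split=> *; congr pair; rewrite /= ?addr0 ?gact0r.
Qed.

Lemma in_span_coneInr (P : I -> Prop) (Q : J + I -> Prop) n (x : shift X n) :
  (forall i, P i -> Q (inr i)) -> in_span bX P x ->
  in_span cone_basis Q ((0, x) : cone f n).
Proof.
move=> PQ [s [a [sP ->]]].
rewrite (lincomb_glin glin_cone_inr bX s a).
apply: in_span_lincomb => j /sP /PQ Qj.
exact: (@in_span_gact _ _ _ _ cone_basis Q (inr j)).
Qed.

Lemma sum_inl (V : zmodType) (s : seq (J + I)) (G : J + I -> V) :
  (forall i, G (inr i) = 0) ->
  \sum_(u <- s) G u = \sum_(j <- pmap (fun u => if u is inl j then Some j else None) s) G (inl j).
Proof.
move=> G0; elim: s => [|[j|i] s IH] /=; rewrite ?big_nil // !big_cons IH //.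
by rewrite G0 add0r.
Qed.

Lemma sum_inr (V : zmodType) (s : seq (J + I)) (G : J + I -> V) :
  (forall j, G (inl j) = 0) ->
  \sum_(u <- s) G u = \sum_(i <- pmap (fun u => if u is inr i then Some i else None) s) G (inr i).
Proof.
move=> G0; elim: s => [|[j|i] s IH] /=; rewrite ?big_nil // !big_cons IH //.
by rewrite G0 add0r.
Qed.

Lemma is_basis_cone : is_basis bX -> is_basis bY -> is_basis cone_basis.
Proof.
move=> HX HY; split=> [n [y x]|n s a us s0].
  have -> : (y, x) = (y, 0) + (0, x) :> cone f n.
    by congr pair; rewrite ?addr0 ?add0r.
  apply: in_spanD.
    exact: in_span_coneIn (HY.1 _ y).
  exact: in_span_coneInr (HX.1 _ x).
have fst_sum : (lincomb cone_basis s a).1 =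
    \sum_(u <- s) gact (subrK (cone_deg u) n) (a u) (cone_basis u).1.
  by apply: (big_morph (fun u : (Y n * shift X n)%type => u.1)).
have snd_sum : (lincomb cone_basis s a).2 =
    \sum_(u <- s) gact (subrK (cone_deg u) n) (a u) (cone_basis u).2.
  by apply: (big_morph (fun u : (Y n * shift X n)%type => u.2)).
move=> [j|i] us'.
  apply: (HY.2 n (pmap (fun u => if u is inl j then Some j else None) s)
           (fun j => a (inl j))).
  - apply: (@pmap_uniq _ _ _ inl) us; by case.
  - rewrite /lincomb -(@sum_inl _ s (fun u => gact (subrK (cone_deg u) n) (a u) (cone_basis u).1)).
      by rewrite -fst_sum s0.
    by move=> i; rewrite gact0r.
  - by rewrite mem_pmap; apply/mapP; exists (inl j).
apply: (HX.2 n (pmap (fun u => if u is inr j then Some j else None) s)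
           (fun j => a (inr j))).
- apply: (@pmap_uniq _ _ _ inr) us; by case.
- rewrite /lincomb -(@sum_inr _ s (fun u => gact (subrK (cone_deg u) n) (a u) (cone_basis u).2)).
    by rewrite -snd_sum s0.
  by move=> j; rewrite gact0r.
- by rewrite mem_pmap; apply/mapP; exists (inr i).
Qed.

End ConeBasis.

(** The differential of a generator of the suspended part meets generators of Y, through f, and
    generators of X. Both are finite in number, so a level in nat above all of them can be chosen by
    recursion along the level in X. *)
Lemma semifree_cone (R : dgAlg) (X Y : dgMod R) (f : dgHom X Y) :
  semifree X -> semifree Y -> semifree (cone f).
Proof.
move=> /semifree_shift [I [degX [bX [lvlX [HX dX]]]]] [J [degY [bY [lvlY [HY dY]]]]].
have fP i : exists s : seq J, in_span bY (fun j => j \in s) (f _ (bX i)).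
  have [s [a [_ e]]] := HY.1 _ (f _ (bX i)).
  by exists s, s, a.
have dP i : exists t : seq I, in_span bX (fun j => j \in t) (gmd (bX i)) /\
    (forall j, j \in t -> (lvlX j < lvlX i)%N).
  have [t [a [tP e]]] := dX i.
  by exists t; split=> //; exists t, a.
pose s i := projT1 (cid (fP i)); pose t i := projT1 (cid (dP i)).
have sP i : in_span bY (fun j => j \in s i) (f _ (bX i)) by rewrite /s; case: cid.
have tP i : in_span bX (fun j => j \in t i) (gmd (bX i)) by rewrite /t; case: cid => ? [].
have tl i j : j \in t i -> (lvlX j < lvlX i)%N.
  by rewrite /t; case: cid => u [/= _]; apply.
have [lvl lvlP] : exists lvl : I -> nat, forall i,
    (forall j, j \in s i -> (lvlY j < lvl i)%N) /\
    (forall j, j \in t i -> (lvl j < lvl i)%N).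
  apply: (@wf_choice I lvlX (fun=> nat) (fun i c x => (forall j, j \in s i -> (lvlY j < x)%N) /\
    (forall j, j \in t i -> (c j < x)%N)) (fun=> 0%N)).
    move=> i c _; exists (\max_(j <- s i) lvlY j + \max_(j <- t i) c j).+1.
    split=> j jin; rewrite ltnS.
      by apply: leq_trans (leq_addr _ _); exact: leq_bigmax_seq.
    by apply: leq_trans (leq_addl _ _); exact: leq_bigmax_seq.
  move=> i c c' x cc' [h1 h2]; split=> // j jt.
  by rewrite -cc' ?h2 //; exact: tl.
pose L (u : J + I) := match u with inl j => lvlY j | inr i => lvl i end.
exists (J + I)%type, (cone_deg degX degY), (cone_basis f bX bY), L.
split; first exact: is_basis_cone.
case=> [j|i].
  rewrite (_ : gmd _ = ((gmd (bY j), 0) : cone f _)).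
    exact: in_span_coneIn (dY j).
  by congr pair; rewrite /= ?(glin0 (glin_dgHom f)) ?addr0 // gmd0 oppr0.
rewrite (_ : gmd _ = (((f _ (bX i) : Y (degX i - 1)), 0) : cone f _) + (0, gmd (bX i))).
  apply: in_spanD.
    by apply: in_span_coneIn (sP i) => j; exact: (lvlP i).1.
  by apply: in_span_coneInr (tP i) => j; exact: (lvlP i).2.
by congr pair; rewrite /= ?gmd0 ?addr0 ?add0r.
Qed.

(** * Homotopies and lifting *)

(* A homotopy has degree 1; as a degree 0 map out of the suspension it is
   strictly linear, the Koszul sign being part of the action on [shift M]. *)
Definition homotopic (R : dgAlg) (M N : dgMod R) (f g : dgHom M N) : Prop :=
  exists2 K : forall n, shift M n -> N n, glin K &
    forall n (x : M (n - 1)),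
      f (n - 1) x - g (n - 1) x = gmd (K n x) + K (n - 1) (gmd x).

Section HomotopyTheory.
Variable R : dgAlg.
Implicit Types M N P : dgMod R.

Lemma homotopic_eq M N (f g : dgHom M N) :
  (forall n x, f n x = g n x) -> homotopic f g.
Proof.
move=> e; exists (fun n _ => 0); first by split=> *; rewrite ?addr0 ?gact0r.
by move=> n x; rewrite e subrr gmd0 addr0.
Qed.

Lemma homotopic_sym M N (f g : dgHom M N) : homotopic f g -> homotopic g f.
Proof.
move=> [K L e]; exists (fun n x => - K n x).
  by split=> *; rewrite ?L.1 ?opprD // L.2 gactN.
by move=> n x; rewrite -opprB e gmdN opprD.
Qed.

Lemma homotopic_trans M N (f g h : dgHom M N) :
  homotopic f g -> homotopic g h -> homotopic f h.
Proof.
move=> [K L e] [K' L' e']; exists (fun n x => K n x + K' n x).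
  by split=> *; rewrite ?L.1 ?L'.1 1?addrACA // L.2 L'.2 gactDr.
move=> n x; rewrite gmdD addrACA -e -e' addrA subrK //.
Qed.

Lemma homotopic_compl M N P (h : dgHom N P) (f g : dgHom M N) :
  homotopic f g -> homotopic (compHom h f) (compHom h g).
Proof.
move=> [K L e]; exists (fun n x => h n (K n x)).
  by split=> *; rewrite ?L.1 ?mhD // L.2 mhZ.
by move=> n x /=; rewrite -(glinB (glin_dgHom h)) e mhD mhd.
Qed.

Lemma homotopic_compr M N P (f g : dgHom N P) (h : dgHom M N) :
  homotopic f g -> homotopic (compHom f h) (compHom g h).
Proof.
move=> [K L e]; exists (fun n x => K n (h (n - 1) x)).
  split=> [n x y|i j n hn a x]; first by rewrite mhD L.1.
  by rewrite -L.2 /= (glin_ksign (glin_dgHom h)) mhZ.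
by move=> n x /=; rewrite e mhd.
Qed.

Lemma homotopic_boundary M N (f g : dgHom M N) n (x : M n) :
  homotopic f g -> gmd x = 0 -> boundary (f n x - g n x).
Proof.
have [m ?] := degB1 n; subst n => -[K L e] dx.
by rewrite e dx (glin0 L) addr0; exact: Boundary.
Qed.

End HomotopyTheory.

Section Null.
Variable R : dgAlg.

Lemma in_span_ind (M : dgMod R) (I : choiceType) (deg : I -> int)
    (b : forall i, M (deg i)) (Q : I -> Prop) (P : forall n, M n -> Prop) :
  (forall n, P n 0) -> (forall n x y, P n x -> P n y -> P n (x + y)) ->
  (forall i p n (h : p + deg i = n) (r : R p), Q i -> P n (gact h r (b i))) ->
  forall n x, in_span b Q x -> P n x.
Proof.
move=> P0 PD Pb n x [s [a [sQ ->]]]; rewrite /lincomb big_seq.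
by apply: big_ind => [|? ?|i /sQ ?]; [exact: P0 | exact: PD | exact: Pb].
Qed.

Definition acyclic (C : dgMod R) := forall n (x : C n), gmd x = 0 -> boundary x.

(* Well-founded induction on the level of the basis elements b: the image of b
   must be a primitive of the cycle phi b + K (d b). *)
Lemma semifree_acyclic (P C : dgMod R) (phi : dgHom P (shift C)) :
  semifree P -> acyclic C ->
  exists2 K : forall n, P n -> C n, glin K &
    forall n x, phi n x = gmd (K n x) - K (n - 1) (gmd x).
Proof.
move=> [I [deg [b [lvl [Hb Hd]]]]] aC.
pose V i : Type := C (deg i).
pose E (c : forall i, V i) := cid2 (basis_ext Hb (N := C) c).
pose ext c : forall n, P n -> C n := s2val (E c).
have L c : glin (ext c) := s2valP (E c).
have extE c i : ext c _ (b i) = c i := s2valP' (E c) i.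
have span_ok c (Q : I -> Prop) :
    (forall i, Q i -> gmd (ext c _ (b i)) = phi _ (b i) + ext c _ (gmd (b i))) ->
    forall n x, in_span b Q x -> gmd (ext c n x) = phi n x + ext c _ (gmd x).
  move=> H; apply: in_span_ind => [n|n x y ex ey|i p n h r Qi].
  - by rewrite gmd0 !(glin0 (L c)) (glin0 (glin_dgHom phi)) gmd0 addr0.
  - by rewrite gmdD !(L c).1 gmdD ex ey mhD addrACA.
  - have h1 : p - 1 + deg i = n - 1 by rewrite -h addrAC.
    have h2 : p + (deg i - 1) = n - 1 by rewrite -h addrA.
    rewrite mhZ (gmleibniz h h1 h2) (L c).1 (glin_ksign (L c)) !(L c).2.
    rewrite (gmleibniz h h1 h2) H // gactDr ksignD addrCA; congr (_ + _).
    by congr (ksign p (gact _ _ _)); exact: eq_irrelevance.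
have [c cP] : exists c : forall i, V i, forall i,
    gmd (c i) = phi _ (b i) + ext c _ (gmd (b i)).
  apply: (@wf_choice I lvl V (fun i c x => gmd x = phi _ (b i) + ext c _ (gmd (b i)))
    (fun=> 0)).
    move=> i c H.
    suff /aC/boundaryE[x ->] : gmd (phi _ (b i) + ext c _ (gmd (b i)) : C (deg i - 1)) = 0.
      by exists x.
    rewrite gmdD (span_ok c (fun j => (lvl j < lvl i)%N)) //; last first.
      by move=> j /H ej; rewrite extE ej.
    rewrite gmdd (glin0 (L c)) addr0 mhd.
    exact: subrr.
  move=> i c c' x cc' ->; congr (_ + _).
  apply: (in_span_glin_eq (L c) (L c') _ (Hd i)) => j lj.
  by rewrite !extE cc'.
exists (ext c) => // n x; apply/eqP; rewrite eq_sym subr_eq; apply/eqP.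
by apply: (span_ok c (fun=> True)) (Hb.1 n x) => i _; rewrite extE.
Qed.

(** [semifree_acyclic] is applied to the suspension of F, whose differential is - d; this turns the
    difference there into the sum required of a homotopy. *)
Lemma semifree_null (F C : dgMod R) (phi : dgHom F C) :
  semifree F -> acyclic C ->
  exists2 K : forall n, shift F n -> C n, glin K &
    forall n (x : F (n - 1)), phi (n - 1) x = gmd (K n x) + K (n - 1) (gmd x).
Proof.
move=> sF aC.
have [K L e] := semifree_acyclic (shiftHom phi) (semifree_shift sF) aC.
exists K => // n x; rewrite -[LHS]/(shiftHom phi n x) e.
by rewrite -[@gmd R (shift F) n x]/(- gmd x) (glinN L) opprK.
Qed.

Lemma cone_acyclic (Y Z : dgMod R) (s : dgHom Y Z) : quasi_iso s -> acyclic (cone s).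
Proof.
move=> [inj surj].
suff H n (z : Z n) (y : Y (n - 1)) : gmd z + s (n - 1) y = 0 -> gmd y = 0 ->
    boundary ((z, y) : cone s n).
  move=> n [z y] e; have /= dz := congr1 fst e; have /= dy := congr1 snd e.
  apply: H dz _; apply/eqP; rewrite -oppr_eq0; apply/eqP; exact: dy.
have [m ?] := degB1 n; subst n => dz dy.
have sy : s _ y = - gmd z.
  by apply/eqP; rewrite -addr_eq0 [X in X == _]addrC; apply/eqP.
have /boundaryE[y' ey] : boundary y.
  by apply: inj => //; rewrite sy; apply: boundaryN; exact: Boundary.
have cyc : gmd (z + s (m - 1) y') = 0 by rewrite gmdD -mhd -ey dz.
have [y'' dy''] := surj (m - 1) _ cyc.
move=> /boundaryE[z' ez].
apply/boundaryE; exists (z', (y'' - y' : Y (m - 1))); congr pair => /=.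
  by rewrite -ez (glinB (glin_dgHom s)) addrA subrK addrK.
by rewrite gmdB dy'' sub0r opprK.
Qed.

(** The two suspensions put the same sign on both sides, so it cancels. This reads the suspended
    component of a null-homotopy as a map of the modules themselves. *)
Lemma unshift_glin (M N : dgMod R) (phi : forall n, M (n - 1) -> N (n - 1)) :
  @glin R (shift M) (shift N) phi ->
  exists2 f : forall n, M n -> N n, glin f & forall n x, f (n - 1) x = phi n x.
Proof.
move=> L.
pose f n (x : M n) : N n := eq_rect _ (fun d => N d)
  (phi (n + 1) (eq_rect _ (fun d => M d) x _ (esym (addrK 1 n)))) _ (addrK 1 n).
have fE n x : f (n - 1) x = phi n x.
  rewrite /f; move: (addrK 1 (n - 1)) => e.
  have en : n - 1 + 1 = n by rewrite subrK.
  by move: e; rewrite en => e; rewrite (eq_irrelevance e erefl).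
exists f => //; split=> [n x y|i j n h a x].
  by have [m ?] := degB1 n; subst n; rewrite !fE L.1.
move: h x; have [m ?] := degB1 n; subst n; have [l ?] := degB1 j; subst j => h x.
have h' : i + l = m by lia.
have := L.2 _ _ _ h' a x; rewrite /= !fE (eq_irrelevance (shift_deg h') h) => e.
have {e} := congr1 (ksign i) e; rewrite ksignK => <-.
by rewrite (glin_ksign (M := shift M) (N := shift N) L) ksignK.
Qed.

(** The composite F -> Z -> cone s is null-homotopic, the cone being acyclic. The Y-component of a
    null-homotopy is the lift h, and its Z-component is the homotopy between g and s h. *)
Lemma semifree_lift (F Y Z : dgMod R) (s : dgHom Y Z) (g : dgHom F Z) :
  semifree F -> quasi_iso s -> exists h : dgHom F Y, homotopic g (compHom s h).
Proof.
move=> sF /cone_acyclic aC.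
have [K L e] := semifree_null (compHom (coneIn s) g) sF aC.
have L2 : @glin R (shift F) (shift Y) (fun n x => (K n x).2).
  by split=> *; rewrite ?L.1 // L.2.
have L1 : @glin R (shift F) Z (fun n x => (K n x).1).
  by split=> *; rewrite ?L.1 // L.2.
have [h Lh hE] := unshift_glin L2.
have e1 n (x : F (n - 1)) : g (n - 1) x =
    gmd (K n x).1 + s (n - 1) (K n x).2 + (K (n - 1) (gmd x)).1.
  by have /(congr1 (fun u => u.1)) := e n x.
have e2 n (x : F (n - 1)) : @gmd R Y (n - 1) (K n x).2 = (K (n - 1) (gmd x)).2 :> Y (n - 1 - 1).
  have /(congr1 (fun u => u.2)) := e n x; rewrite /= => /esym/eqP.
  by rewrite addr_eq0 eqr_opp => /eqP.
have ch : forall n x, h (n - 1) (gmd x) = gmd (h n x).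
  move=> n x; have [m ?] := degB1 n; subst n.
  by rewrite !hE e2.
exists (DgHom Lh.1 Lh.2 ch), (fun n x => (K n x).1) => // n x /=.
by rewrite hE e1 addrAC addrK.
Qed.

(** A homotopy from s h to s h' and the difference h' - h are the components of a chain map from the
    suspension of F to the acyclic cone of s. The Y-component of its null-homotopy is the homotopy
    sought. *)
Lemma semifree_lift_uniq (F Y Z : dgMod R) (s : dgHom Y Z) (h h' : dgHom F Y) :
  semifree F -> quasi_iso s -> homotopic (compHom s h) (compHom s h') ->
  homotopic h h'.
Proof.
move=> sF /cone_acyclic aC [K L e].
pose phi n (x : shift F n) : cone s n := (K n x, h' (n - 1) x - h (n - 1) x).
have phiL : glin phi.
  split=> [n x y|i j n hn a x]; rewrite /phi.
    by congr pair; rewrite ?L.1 // !mhD /= opprD addrACA.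
  congr pair; first by rewrite L.2.
  rewrite /= !(glin_ksign (glin_dgHom _)) !mhZ -ksignB; congr ksign.
  by rewrite gactDr gactN.
have phid : forall n x, phi (n - 1) (gmd x) = gmd (phi n x).
  move=> n x; rewrite /phi; congr pair => /=; last first.
    by rewrite !(glinN (glin_dgHom _)) !mhd gmdB opprB opprK; exact: addrC.
  rewrite (glinN L) (glinB (glin_dgHom s)); apply/eqP.
  rewrite eq_sym -addr_eq0 addrAC; have /= <- := e n x.
  by rewrite addrA subrK subrr.
have [K' L' e'] := semifree_null (DgHom phiL.1 phiL.2 phid) (semifree_shift sF) aC.
have L2 : @glin R (shift (shift F)) (shift Y) (fun n x => (K' n x).2).
  by split=> *; rewrite ?L'.1 // L'.2.
have [H LH HE] := unshift_glin L2.
exists (fun n x => H n x) => // n x; have [m ?] := degB1 n; subst n.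
have /(congr1 snd) /= := e' m x.
rewrite -(HE m x) => /(congr1 -%R); rewrite opprB => ->.
rewrite opprD opprK; congr (_ + _).
rewrite -(HE (m - 1)) -(glinN LH); congr (H _ _).
by rewrite /= opprK.
Qed.

End Null.

(** * Uniqueness of semifree resolutions *)

Section Action.
Variables (R : dgAlg) (F : dgMod R).

(* The action of D(R) on the homotopy classes of maps out of F, which by
   semifreeness invert the quasi-isomorphisms. *)
Fixpoint act (X Y : dgMod R) (u : dmor X Y) : dgHom F X -> dgHom F Y -> Prop :=
  match u in dmor X Y return dgHom F X -> dgHom F Y -> Prop with
  | Dmap _ _ f => fun g h => homotopic h (compHom f g)
  | Dinv _ _ f _ => fun g h => homotopic g (compHom f h)
  | Dcomp _ _ _ v u => fun g h => exists2 m, act u g m & act v m h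
  end.

Hypothesis sF : semifree F.

Lemma act_total X Y (u : dmor X Y) g : exists h, act u g h.
Proof.
elim: u g => [{}X {}Y f g|{}X {}Y f qf g|{}X {}Y Z v IHv u IHu g] /=.
- by exists (compHom f g); exact: homotopic_eq.
- exact: semifree_lift.
- by have [m um] := IHu g; have [h vh] := IHv m; exists h, m.
Qed.

Lemma act_homotopic X Y (u : dmor X Y) g g' h h' :
  homotopic g g' -> homotopic h h' -> act u g h -> act u g' h'.
Proof.
elim: u g g' h h' => [{}X {}Y f|{}X {}Y f qf|{}X {}Y Z v IHv u IHu] g g' h h' /= gg hh.
- move=> e; apply: homotopic_trans (homotopic_sym hh) _.
  by apply: homotopic_trans e _; exact: homotopic_compl.
- move=> e; apply: homotopic_trans (homotopic_sym gg) _.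
  by apply: homotopic_trans e _; exact: homotopic_compl.
- move=> [m um vm]; have mm : homotopic m m by exact: homotopic_eq.
  by exists m; [exact: IHu um | exact: IHv vm].
Qed.

(** Among the generating relations, the two cancellation laws of a formal inverse amount to
    uniqueness and existence of lifts along a quasi-isomorphism. Equalities in D(R) thus become
    homotopies. *)
Lemma act_deq X Y (u v : dmor X Y) : deq u v -> forall g h, act u g h <-> act v g h.
Proof.
have R0 Z (g : dgHom F Z) : homotopic g g by exact: homotopic_eq.
elim=> {X Y u v}.
- by [].
- by move=> X Y u v _ IH g h; rewrite IH.
- by move=> X Y u v w _ IH _ IH' g h; rewrite IH IH'.
- move=> X Y Z v v' u u' _ IHv _ IHu g h /=.
  by split=> -[m um vm]; exists m; [apply/IHu|apply/IHv|apply/IHu|apply/IHv].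
- move=> X Y Z T w v u g h /=; split.
    by move=> [m [m' um vm] wm]; exists m' => //; exists m.
  by move=> [m um [m' vm wm]]; exists m' => //; exists m.
- move=> X Y u g h /=; split=> [[m um hm]|uh]; last by exists h => //; exact: homotopic_eq.
  apply: (act_homotopic (R0 _ g) _ um); apply: homotopic_sym.
  by apply: homotopic_trans hm _; exact: homotopic_eq.
- move=> X Y u g h /=; split=> [[m hm um]|uh]; last by exists g => //; exact: homotopic_eq.
  apply: (act_homotopic _ (R0 _ h) um).
  by apply: homotopic_trans hm _; exact: homotopic_eq.
- move=> X Y f f' ff g h /=; split=> e; apply: homotopic_trans e _; apply: homotopic_eq => n x /=.
    exact: ff.
  exact: esym (ff _ _).
- move=> X Y Z f' f g h /=; split=> [e|[m hm e]].
    exists (compHom f g); first exact: homotopic_eq.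
    by apply: homotopic_trans e _; exact: homotopic_eq.
  apply: homotopic_trans e _.
  by apply: homotopic_trans (homotopic_compl f' hm) _; exact: homotopic_eq.
- move=> X Y f qf g h /=; split=> [[m hm e]|e].
    apply: (semifree_lift_uniq sF qf).
    apply: homotopic_trans (homotopic_sym e) _.
    apply: homotopic_trans hm _; apply: homotopic_compl; exact: homotopic_eq.
  exists (compHom f g); first exact: homotopic_eq.
  apply: homotopic_compl; apply: homotopic_sym.
  by apply: homotopic_trans e _; exact: homotopic_eq.
- move=> X Y f qf g h /=; split=> [[m hm e]|e].
    apply: homotopic_trans e _; apply: homotopic_trans (homotopic_sym hm) _.
    exact: homotopic_eq.
  have [m gm] := semifree_lift g sF qf; exists m => //.
  apply: homotopic_trans e _; apply: homotopic_trans gm; exact: homotopic_eq.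
Qed.

End Action.

Lemma act_comp (R : dgAlg) (F F' : dgMod R) (phi : dgHom F' F) X Y (u : dmor X Y)
    (g : dgHom F X) h :
  act u g h -> act u (compHom g phi) (compHom h phi).
Proof.
elim: u g h => [{}X {}Y f|{}X {}Y f qf|{}X {}Y Z v IHv u IHu] g h /=.
- move=> e; apply: homotopic_trans (homotopic_compr phi e) _; exact: homotopic_eq.
- move=> e; apply: homotopic_trans (homotopic_compr phi e) _; exact: homotopic_eq.
- by move=> [m um vm]; exists (compHom m phi); [exact: IHu | exact: IHv].
Qed.

Section Resolutions.
Variable R : dgAlg.

Lemma act_lift (F F' X X' : dgMod R) (q : dgHom F X) (q' : dgHom F' X')
    (u : dmor X X') : semifree F -> quasi_iso q' ->
  exists phi : dgHom F F', act u q (compHom q' phi).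
Proof.
move=> sF qi'; have [m um] := act_total sF u q.
have [phi e] := semifree_lift m sF qi'.
by exists phi; apply: (act_homotopic _ e um); exact: homotopic_eq.
Qed.

Lemma act_id_lift (F X : dgMod R) (q : dgHom F X) (theta : dgHom F F) (w : dmor X X) :
  semifree F -> quasi_iso q -> deq w (Did X) -> act w q (compHom q theta) ->
  homotopic theta (idHom F).
Proof.
move=> sF qi dw /(act_deq sF dw) /= e.
apply: (semifree_lift_uniq sF qi); apply: homotopic_trans e _.
exact: homotopic_eq.
Qed.

Definition homotopy_equiv (F F' : dgMod R) (phi : dgHom F F') (psi : dgHom F' F) :=
  homotopic (compHom psi phi) (idHom F) /\ homotopic (compHom phi psi) (idHom F').

Lemma act_comp_comp (F F' X X' : dgMod R) (q : dgHom F X) (q' : dgHom F' X')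
    (u : dmor X X') (v : dmor X' X) phi psi :
  act u q (compHom q' phi) -> act v q' (compHom q psi) ->
  act (Dcomp v u) q (compHom q (compHom psi phi)).
Proof.
move=> up vp; exists (compHom q' phi) => //.
by apply: (act_homotopic _ _ (act_comp phi vp)); exact: homotopic_eq.
Qed.

Lemma resolution_uniq (F F' X X' : dgMod R) (q : dgHom F X) (q' : dgHom F' X')
    (u : dmor X X') :
  semifree F -> semifree F' -> quasi_iso q -> quasi_iso q' -> Diso u ->
  exists phi psi, @homotopy_equiv F F' phi psi.
Proof.
move=> sF sF' qi qi' [v [vu uv]].
have [phi up] := act_lift q u sF qi'; have [psi vp] := act_lift q' v sF' qi.
exists phi, psi; split.
  exact: act_id_lift sF qi vu (act_comp_comp up vp).
exact: act_id_lift sF' qi' uv (act_comp_comp vp up).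
Qed.

(** The section exists only in D(R); its action on the resolution of C gives a chain map, and the
    equality in D(R) makes it a section up to homotopy. *)
Lemma lift_section (FY FC Y C : dgMod R) (qY : dgHom FY Y) (qC : dgHom FC C)
    (e : dgHom Y C) (e' : dgHom FY FC) (t : dmor C Y) :
  semifree FC -> quasi_iso qY -> quasi_iso qC ->
  homotopic (compHom qC e') (compHom e qY) ->
  deq (Dcomp (Dmap e) t) (Did C) ->
  exists s : dgHom FC FY, homotopic (compHom e' s) (idHom FC).
Proof.
move=> sC qiY qiC ee et; have [s ts] := act_lift qC t sC qiY.
exists s; apply: (act_id_lift sC qiC et); exists (compHom qY s) => //=.
exact: homotopic_compr s ee.
Qed.

End Resolutions.

(** * Quasi-isomorphisms between cones *)

Section QuasiIso.
Variable R : dgAlg.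

Lemma quasi_iso_comp (X Y Z : dgMod R) (g : dgHom Y Z) (f : dgHom X Y) :
  quasi_iso f -> quasi_iso g -> quasi_iso (compHom g f).
Proof.
move=> [fi fs] [gi gs]; split=> n x dx.
  move=> /= /gi bf; apply: fi => //; apply: bf.
  by rewrite -mhd dx (glin0 (glin_dgHom f)).
have [y dy bz] := gs n x dx; have [w dw by_] := fs n y dy.
exists w => //=; rewrite -[x](subrK (g n y)) -addrA.
apply: boundaryD => //; rewrite -(glinB (glin_dgHom g)); exact: boundary_map.
Qed.

Lemma homotopy_equiv_quasi_iso (X Y : dgMod R) (f : dgHom X Y) (g : dgHom Y X) :
  homotopy_equiv f g -> quasi_iso f.
Proof.
move=> [gf fg]; split=> n x dx.
  move=> /(boundary_map g) bx.
  rewrite -[x](subrK (g n (f n x))); apply: boundaryD => //.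
  by have := homotopic_boundary (homotopic_sym gf) dx.
exists (g n x); first by rewrite -mhd dx (glin0 (glin_dgHom g)).
by have := homotopic_boundary (homotopic_sym fg) dx.
Qed.

Lemma cone_cycle (X Y : dgMod R) (f : dgHom X Y) n (y : Y n) (x : X (n - 1)) :
  gmd ((y, x) : cone f n) = 0 -> gmd y + f _ x = 0 /\ gmd x = 0.
Proof.
move=> e; split; first exact: (congr1 fst e).
by apply/eqP; rewrite -oppr_eq0; apply/eqP; exact: (congr1 snd e).
Qed.

(** With H the homotopy filling the square, the map is (y, x) -> (b y + H x, a x). The statement on
    quasi-isomorphisms is the five lemma, carried out on elements. *)
Lemma cone_map (X Y X' Y' : dgMod R) (f : dgHom X Y) (f' : dgHom X' Y')
    (a : dgHom X X') (b : dgHom Y Y') :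
  homotopic (compHom b f) (compHom f' a) ->
  exists c : dgHom (cone f) (cone f'),
    (forall n y, c n (y, 0) = (b n y, 0)) /\ (quasi_iso a -> quasi_iso b -> quasi_iso c).
Proof.
move=> [H L e].
have H' n (x : X (n - 1)) : b _ (f _ x) = f' _ (a _ x) + (gmd (H n x) + H _ (gmd x)).
  by rewrite -e /=; zmod.
pose c n (u : cone f n) : cone f' n := (b n u.1 + H n u.2, a (n - 1) u.2).
have cL : glin c.
  split=> [n [y x] [y' x']|i j n h r [y x]]; congr pair => /=.
  - by rewrite mhD L.1 addrACA.
  - by rewrite mhD.
  - by rewrite mhZ gactDr L.2.
  - by rewrite (glin_ksign (glin_dgHom a)) mhZ.
have cd : forall n x, c (n - 1) (gmd x) = gmd (c n x).
  move=> n [y x]; congr pair => /=; last first.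
    by rewrite (glinN (glin_dgHom a)) mhd.
  rewrite mhD mhd (glinN L) gmdD H'.
  zmod.
exists (DgHom cL.1 cL.2 cd); split=> [n y|[ai as_] [bi bs]].
  by rewrite /= /c /= (glin0 L) addr0 (glin0 (glin_dgHom a)).
split.
  suff inj n (y : Y n) (x : X (n - 1)) : gmd ((y, x) : cone f n) = 0 ->
      boundary ((b n y + H n x, a (n - 1) x) : cone f' n) -> boundary ((y, x) : cone f n).
    by move=> n [y x]; exact: inj.
  have [m ?] := degB1 n; subst n.
  move=> /cone_cycle[dy dx] /boundaryE[[y' x'] exy].
  have e1 : b _ y + H _ x = gmd y' + f' _ x' := congr1 fst exy.
  have e2 : a _ x = - @gmd R X' (m - 1) x' := congr1 snd exy.
  have /boundaryE[x1 ex1] : boundary x.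
    by apply: ai => //; rewrite e2; apply: boundaryN; exact: Boundary.
  (* The image of x1 need not be - x'. The discrepancy is a cycle, equal to the image of a cycle x2
     up to d x3; subtracting the boundary of (0, x2 - x1) then removes the suspended component of
     (y, x). *)
  have cx : gmd (a (m - 1) x1 + x' : X' (m - 1)) = 0.
    by rewrite gmdD -mhd -ex1 e2 addNr.
  have [x2 dx2 /boundaryE[x3 ex3]] := as_ _ _ cx.
  pose x4 := x2 - x1.
  have dx4 : gmd x4 = - x by rewrite gmdB dx2 -ex1 sub0r.
  have ax4 : a _ x4 = x' - gmd x3.
    rewrite -ex3 (glinB (glin_dgHom a)).
    zmod.
  have cy : gmd (y - f _ x4) = 0.
    by rewrite gmdB -mhd dx4 (glinN (glin_dgHom f)) opprK dy.
  have by4 : boundary (b _ (y - f _ x4)).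
    rewrite (glinB (glin_dgHom b)) H' dx4 (glinN L) ax4 (glinB (glin_dgHom f')).
    have -> : b _ y = gmd y' + f' _ x' - H _ x by rewrite -e1 addrK.
    rewrite mhd (_ : _ - _ = gmd y' + gmd (f' _ x3) - gmd (H m x4)); last by zmod.
    apply: boundaryB; first apply: boundaryD; exact: Boundary.
  have /boundaryE[y4 ey4] := bi _ _ cy by4.
  apply/boundaryE; exists ((y4, x4) : cone f m); congr pair => /=.
    by rewrite -ey4 subrK.
  by rewrite dx4 opprK.
suff surj n (y' : Y' n) (x' : X' (n - 1)) : gmd ((y', x') : cone f' n) = 0 ->
    exists (y : Y n) (x : X (n - 1)), gmd ((y, x) : cone f n) = 0 /\
      boundary ((y' - (b n y + H n x), x' - a (n - 1) x) : cone f' n).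
  move=> n [y' x'] /surj[y [x [dxy bd]]]; exists ((y, x) : cone f n) => //.
have [m ?] := degB1 n; subst n => /cone_cycle[dy' dx'].
have [x1 dx1 /boundaryE[x2 ex2]] := as_ _ _ dx'.
have df2 : gmd (f' _ x2) = f' _ x' - f' _ (a _ x1).
  by rewrite -mhd -ex2 (glinB (glin_dgHom f')).
have bfx : boundary (b _ (f _ x1)).
  have -> : b _ (f _ x1) = gmd (H (m - 1) x1) - gmd y' - gmd (f' _ x2).
    rewrite H' dx1 (glin0 L) addr0 df2 -[RHS]addr0 -dy'; zmod.
  by apply: boundaryB; [apply: boundaryB|]; exact: Boundary.
have cfx : gmd (f _ x1) = 0 by rewrite -mhd dx1 (glin0 (glin_dgHom f)).
(* As f x1 = d y1, the cycle (- y1, x1) takes care of the suspended component; what remains is a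
   cycle of Y', reached by y2. *)
have /boundaryE[y1 ey1] := bi _ _ cfx bfx.
have cy : gmd (y' + f' _ x2 - H (m - 1) x1 + b _ y1) = 0.
  rewrite gmdD gmdB gmdD df2 -[gmd (b _ _)]mhd -ey1 H' dx1 (glin0 L) addr0 -[RHS]dy'.
  zmod.
have [y2 dy2 bz] := bs _ _ cy.
exists (y2 - y1), x1; split.
  by congr pair => /=; rewrite ?dx1 ?oppr0 // gmdB dy2 sub0r -ey1 addNr.
have {bz} bz : boundary (y' - (b (m - 1) (y2 - y1) + H (m - 1) x1) + f' _ x2).
  rewrite (glinB (glin_dgHom b)) (_ : _ + _ = y' + f' (m - 1) x2 - H (m - 1) x1 + b (m - 1) y1 - b (m - 1) y2) //.
  zmod.
rewrite (_ : (_, _) = ((y' - (b _ (y2 - y1) + H _ x1) + f' _ x2, 0) : cone f' (m - 1)) +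
  gmd ((0, - x2) : cone f' m)); last first.
  congr pair => /=; last by rewrite gmdN opprK add0r.
  by rewrite gmd0 add0r (glinN (glin_dgHom f')) addrK.
apply: boundaryD; last exact: Boundary.
exact: (boundary_map (coneIn f')).
Qed.

End QuasiIso.

(** * Functoriality of RHom *)

Section RHomFunctor.
Variables (k : fieldType) (A : localDgAlg k) (c : nat) (f : 'I_c -> A 0).
Hypothesis fm : forall i, max_ideal (f i).
Variable B : koszul f.
Local Notation S := {mpoly k[c]}.

Section Map.
Variables (F F' : dgMod B) (phi : dgHom F F').

Lemma rmap_subproof n (x : homS F' n) : homS_pred n (fun j (y : F j) => hsval x (phi j y)).
Proof.
case: x => x [xD xZ xd [N xN]]; split=> /=.
- by move=> j y z; rewrite mhD xD.
- by move=> i j l h a y; rewrite mhZ xZ.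
- by move=> j y; exact: xd.
- by exists N => j y Nj; exact: xN.
Qed.

Definition rmap : dgHom (RHom fm F') (RHom fm F).
Proof.
refine (@DgHom (cohop k c) (RHom fm F') (RHom fm F)
  (fun n x => HomS (rmap_subproof x)) _ _ _).
- by move=> n x y; apply: homS_eq.
- by move=> i j n h p x; apply: homS_eq.
- move=> n x; apply: homS_eq => j y; rewrite /= /homS_diff_fun /=.
  by congr (ksign n (_ - _)); [apply: eq_bigr => i _; rewrite mhZ | rewrite mhd].
Defined.

End Map.

Section RaiseDegree.
Variables (F F' : dgMod B) (K : forall n, shift F n -> F' n).
Arguments K : clear implicits.
Hypothesis L : @glin B (shift F) F' K.

Definition raise (x : forall j, F' j -> S) j (y : F j) : S :=
  x (j + 1) (K (j + 1) (eq_rect _ (fun d => F d) y _ (esym (addrK 1 j)))).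

Lemma raiseE (x : forall j, F' j -> S) j (y : F (j - 1)) :
  raise x y = x j (K j y).
Proof.
rewrite /raise; move: (addrK 1 (j - 1)) => e.
have en : j - 1 + 1 = j by rewrite subrK.
by move: e; rewrite en => e; rewrite (eq_irrelevance e erefl).
Qed.

Lemma raise_subproof n (x : homS F' (n - 1)) :
  homS_pred n (fun j (y : F j) => - ksign n (raise (hsval x) y)).
Proof.
case: x => x [xD xZ xd [N xN]]; split=> /=.
- move=> j y z; have [m ?] := degB1 j; subst j.
  by rewrite !raiseE L.1 xD ksignD opprD.
- move=> i j l h a y.
  move: h y; have [m ?] := degB1 j; have [m' ?] := degB1 l; subst j l => h y.
  have h' : i + m = m' by lia.
  rewrite !raiseE.
  have := L.2 _ _ _ h' (kphi B i a) y; rewrite /= (eq_irrelevance (shift_deg h') h) => e.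
  have {}e : K m' (gact h (kphi B i a) y) = ksign i (gact h' (kphi B i a) (K m y)).
    by rewrite -e (glin_ksign L) ksignK.
  rewrite e (hadd_ksign (xD _)) xZ ksign_aug.
  by rewrite scalerN (hadd_ksign (scalerDr (aug a))).
- move=> j y; have [m ?] := degB1 j; subst j; rewrite raiseE.
  have : x m (K m y) \is sdeg (n + (m - 1)) by rewrite addrCA addrC; exact: xd.
  by rewrite /ksign; case: odd; rewrite ?rpredN.
- exists N.+1 => j y Nj; have [m ?] := degB1 j; subst j; rewrite raiseE.
  by rewrite xN ?ksign_0 ?oppr0 //; lia.
Qed.

(** Precomposition with K. The sign - (-1)^n makes it linear on the suspension and leaves no sign in
    the homotopy identity. *)
Definition rhomotopy n (x : shift (RHom fm F') n) : RHom fm F n :=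
  HomS (raise_subproof x).

Lemma rhomotopy_glin : @glin (cohop k c) (shift (RHom fm F')) (RHom fm F) rhomotopy.
Proof.
split=> [n x x'|i j n h p x]; apply: homS_eq => l y; have [m ?] := degB1 l; subst l.
  by rewrite /= !raiseE /= ksignD opprD.
have e (z : homS F' (n - 1)) : hsval (ksign i z) (K m y) = ksign i (hsval z (K m y)).
  by rewrite /ksign; case: odd.
rewrite /= !raiseE e /= mulrN (hadd_ksign (mulrDr (spval p))) -ksign_add.
by congr (- _); rewrite /ksign -h; congr (if _ then _ else _); lia.
Qed.

(** K has degree 1 and so anticommutes with the action of e_i; this makes the terms with chi_i
    cancel in [rhomotopyP]. *)
Lemma raise_ke (n : int) (x : homS F' n) i j (y : F (j - 1)) :
  raise (hsval x) (gact (erefl (1 + (j - 1))) (ke B i) y) =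
  - hsval x (gact (erefl (1 + j)) (ke B i) (K j y)).
Proof.
have h : 1 + (j - 1) = 1 + j - 1 by rewrite addrA.
rewrite (homS_transport (raise (hsval x)) _ h) raiseE.
have := L.2 1 j _ (erefl (1 + j)) (ke B i) y.
rewrite /= (eq_irrelevance (shift_deg _) h) => <-.
by rewrite (hadd_ksign (L.1 _)) (hadd_ksign (let: And4 xD _ _ _ := hsP x in xD _)) opprK.
Qed.

End RaiseDegree.

Lemma rhomotopyP (F F' : dgMod B) (g h : dgHom F F') (K : forall n, shift F n -> F' n)
    (L : @glin B (shift F) F' K) :
  (forall n (x : F (n - 1)), g (n - 1) x - h (n - 1) x = gmd (K n x) + K (n - 1) (gmd x)) ->
  forall n (x : RHom fm F' (n - 1)),
    rmap g (n - 1) x - rmap h (n - 1) x =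
    gmd (rhomotopy L (x : shift (RHom fm F') n)) + rhomotopy L (gmd x : shift (RHom fm F') (n - 1)).
Proof.
move=> e n x; apply: homS_eq => j y; have [m ?] := degB1 j; subst j.
have xD l := let: And4 h _ _ _ := hsP x in h l.
transitivity (hsval x (gmd (K m y)) + hsval x (K _ (gmd y))).
  by rewrite -xD -e xD (haddN (xD _)).
rewrite /= /homS_diff_fun /= /homS_diff_fun !raiseE !ksign_pred.
under eq_bigr => i _ do rewrite raise_ke // ksignN opprK.
rewrite /ksign; case: odd; last first.
  by rewrite opprK; zmod.
under eq_bigr => i _ do rewrite mulrN.
rewrite sumrN !opprK; zmod.
Qed.

Lemma rmap_homotopic (F F' : dgMod B) (g h : dgHom F F') :
  homotopic g h -> homotopic (rmap g) (rmap h).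
Proof.
move=> [K L e]; exists (rhomotopy L); first exact: rhomotopy_glin.
exact: rhomotopyP.
Qed.

End RHomFunctor.

Definition zeroHom (R : dgAlg) (M N : dgMod R) : dgHom M N.
Proof.
by refine (@DgHom R M N (fun _ _ => 0) _ _ _) => *; rewrite ?addr0 ?gact0r ?gmd0.
Defined.

Section RHomCone.
Variables (k : fieldType) (A : localDgAlg k) (c : nat) (f : 'I_c -> A 0).
Hypothesis fm : forall i, max_ideal (f i).
Variable B : koszul f.
Local Notation S := {mpoly k[c]}.
Variables (X Y : dgMod B) (g : dgHom X Y).

(* coneIn o g is null-homotopic, through x |-> (0, Sigma x). *)
Definition coneS n (x : shift X n) : cone g n := (0, x).

Lemma coneS_glin : @glin B (shift X) (cone g) coneS.
Proof. exact: glin_cone_inr. Qed.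

Lemma coneSP n (x : X (n - 1)) :
  (g (n - 1) x, 0) = gmd (coneS x) + coneS (gmd x) :> cone g (n - 1).
Proof. by congr pair => /=; rewrite ?gmd0 ?add0r ?addr0 ?addNr. Qed.

Local Notation rho := (rmap fm (coneIn g)).
Local Notation H := (@rhomotopy _ _ _ _ fm _ _ _ _ coneS_glin _).

Lemma rcone_homotopyP n (x : RHom fm (cone g) (n - 1)) :
  rmap fm g _ (rho _ x) =
  gmd (H (x : shift (RHom fm (cone g)) n)) + H (gmd x : shift (RHom fm (cone g)) (n - 1)).
Proof.
pose z := zeroHom X (cone g).
have e (i : int) (y : X (i - 1)) : compHom (coneIn g) g (i - 1) y - z (i - 1) y =
    gmd (coneS y) + coneS (gmd y) by rewrite subr0; exact: coneSP.
rewrite -(rhomotopyP coneS_glin e x); apply: homS_eq => j y /=.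
by rewrite (hadd0 (let: And4 xD _ _ _ := hsP x in xD _)) subr0.
Qed.

(** The comparison map induced by the null-homotopy H of the composite RHom(cone g, k) -> RHom(Y, k)
    -> RHom(X, k). *)
Definition rcone_map n (u : cone rho n) : RHom fm X n := rmap fm g n u.1 + H u.2.

Lemma rcone_dgHom : exists kappa : dgHom (cone rho) (RHom fm X),
  forall n u, kappa n u = rcone_map u.
Proof.
have L := rhomotopy_glin fm coneS_glin.
have D n (u v : cone rho n) : rcone_map (u + v) = rcone_map u + rcone_map v.
  rewrite -[LHS]/(rmap fm g n (u.1 + v.1) + H (u.2 + v.2 : shift (RHom fm (cone g)) n)).
  by rewrite mhD L.1 addrACA.
have Z i j n (h : i + j = n) (p : cohop k c i) (u : cone rho j) :
    rcone_map (gact h p u) = gact h p (rcone_map u).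
  rewrite -[LHS]/(rmap fm g n (gact h p u.1) +
    H (gact h p (u.2 : shift (RHom fm (cone g)) j))).
  by rewrite mhZ L.2 gactDr.
have d n (u : cone rho n) : rcone_map (gmd u) = gmd (rcone_map u).
  rewrite -[LHS]/(rmap fm g _ (gmd u.1 + rho _ u.2) +
    H (- gmd (u.2 : RHom fm (cone g) (n - 1)) : shift (RHom fm (cone g)) (n - 1))).
  rewrite mhD mhd gmdD (glinN L) rcone_homotopyP.
  zmod.
by exists (DgHom D Z d).
Qed.

Lemma rext_subproof n (x : homS X n) :
  homS_pred (n - 1) (fun j (u : cone g j) => - ksign n (hsval x (u.2 : X (j - 1)))).
Proof.
case: x => x [xD xZ xd [N xN]]; split=> /=.
- by move=> j [y z] [y' z']; rewrite xD ksignD opprD.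
- move=> i j l h a [y z] /=.
  by rewrite (hadd_ksign (xD _)) xZ ksign_aug scalerN (hadd_ksign (scalerDr (aug a))).
- move=> j [y z].
  have : x _ (z : X (j - 1)) \is sdeg (n - 1 + j) by rewrite -addrA (addrC (-1)); exact: xd.
  by rewrite /ksign; case: odd; rewrite ?rpredN.
- by exists N.+1 => j [y z] Nj; rewrite xN ?ksign_0 ?oppr0 //=; lia.
Qed.

Definition rext n (x : RHom fm X n) : RHom fm (cone g) (n - 1) := HomS (rext_subproof x).

Lemma gmd_rext n (x : RHom fm X n) : gmd (rext x) = - rext (gmd x).
Proof.
have xD l := let: And4 h _ _ _ := hsP x in h l.
apply: homS_eq => j [y z].
have ex i : hsval x (ksign 1 (gact (shift_deg (erefl (1 + j))) (ke B i) (z : X (j - 1)))) =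
    - hsval x (gact (erefl (1 + (j - 1))) (ke B i) (z : X (j - 1))).
  by rewrite (hadd_ksign (xD _)); congr (- _); exact: homS_transport.
rewrite /= /homS_diff_fun /= /homS_diff_fun !ksign_pred (haddN (xD _)).
under eq_bigr => i _ do rewrite ex.
by rewrite /ksign; case: odd; under eq_bigr => i _ do rewrite !mulrN;
  rewrite !sumrN; zmod.
Qed.

Lemma rext0 n : rext (0 : RHom fm X n) = 0.
Proof. by apply: homS_eq => j u; rewrite /= ksign_0 oppr0. Qed.

Lemma rprj_subproof n (y : homS Y n) : homS_pred n (fun j (u : cone g j) => hsval y u.1).
Proof.
case: y => y [yD yZ yd [N yN]]; split=> [j u v|i j l h a u|j u|].
- exact: yD.
- exact: yZ.
- exact: yd.
- by exists N => j u; exact: yN.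
Qed.

Definition rprj n (y : RHom fm Y n) : RHom fm (cone g) n := HomS (rprj_subproof y).

(** As a graded module, RHom(cone g, k) is the sum of RHom(Y, k) and a shifted RHom(X, k), with
    [rprj] and [rext] as the two extensions by zero. They give explicit primitives and preimages. *)
Lemma rcone_quasi_iso (kappa : dgHom (cone rho) (RHom fm X)) :
  (forall n u, kappa n u = rcone_map u) -> quasi_iso kappa.
Proof.
move=> kE.
have kE' n (y : RHom fm Y n) (w : RHom fm (cone g) (n - 1)) j (x : X (j - 1)) :
    hsval (kappa n (y, w)) x = hsval y (g (j - 1) x) - ksign n (hsval w ((0, x) : cone g j)).
  by rewrite kE /= raiseE.
split=> n.
  suff inj (y : RHom fm Y n) (w : RHom fm (cone g) (n - 1)) :
      gmd ((y, w) : cone rho n) = 0 -> boundary (kappa n (y, w)) ->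
      boundary ((y, w) : cone rho n) by case=> y w; exact: inj.
  move=> /cone_cycle[dy dw].
  have {}dy j (y0 : Y j) : hsval (gmd y) y0 = - hsval w ((y0, 0) : cone g j).
    have /(congr1 (fun z : homS Y _ => hsval z y0)) /= := dy.
    by move/eqP; rewrite addr_eq0 => /eqP.
  move: y w dy dw; have [m ?] := degB1 n; subst n => y w dy dw /boundaryE[xi exi].
  apply/boundaryE.
  (* The second component must restrict to y on Y and have differential - w: [rprj y] achieves the
     first, and [rext xi] corrects the part on the suspension of X. *)
  exists ((0, rprj y + rext xi) : cone rho m).
  have D0 (F : dgMod B) l (x : homS F l) : forall j (u v : F j), hsval x (u + v) = hsval x u + hsval x v.
    by case: (hsP x).
  congr pair.
    rewrite gmd0 add0r; apply: homS_eq => j y0 /=.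
    by rewrite (hadd0 (@D0 X _ xi _)) ksign_0 oppr0 addr0.
  rewrite -[RHS]/(- gmd (rprj y + rext xi)) gmdD gmd_rext -exi.
  apply: homS_eq => j [y0 x0]; rewrite -[RHS]/(- (hsval (gmd (rprj y)) ((y0, x0) : cone g j) -
    - ksign (m - 1) (hsval (kappa (m - 1) (y, w)) (x0 : X (j - 1))))).
  rewrite kE'.
  have -> : hsval (gmd (rprj y)) ((y0, x0) : cone g j) =
      hsval (gmd y) y0 - ksign (m - 1) (hsval y (g (j - 1) x0)).
    by rewrite /= /homS_diff_fun /= D0 -ksignB opprD addrA.
  rewrite dy (_ : (y0, x0) = ((y0, 0) : cone g j) + (0, x0)); last first.
    by congr pair; rewrite ?addr0 ?add0r.
  by rewrite D0 ksignB ksignK; zmod.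
move=> xi dxi; exists ((0, rext xi) : cone rho n).
  congr pair.
    rewrite gmd0 add0r; apply: homS_eq => j y0 /=.
    by rewrite (hadd0 (let: And4 xD _ _ _ := hsP xi in xD _)) ksign_0 oppr0.
  by rewrite -[LHS]/(- gmd (rext xi)) gmd_rext dxi rext0 !oppr0.
rewrite (_ : kappa n _ = xi) ?subrr; first exact: boundary0.
apply: homS_eq => j x; have [m ?] := degB1 j; subst j.
by rewrite kE' /= ksignN ksignK opprK add0r.
Qed.

End RHomCone.

(** * Base change *)

Lemma is_basis_ext (R : dgAlg) (M : dgMod R) (I : choiceType) (deg : I -> int)
    (b b' : forall i, M (deg i)) : (forall i, b i = b' i) -> is_basis b -> is_basis b'.
Proof. by move=> e; have -> : b' = b by apply: functional_extensionality_dep => i. Qed.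

Lemma map_cast (P Q : int -> Type) (g : forall n, P n -> Q n) n m (e : n = m) x :
  g m (eq_rect _ P x _ e) = eq_rect _ Q (g n x) _ e.
Proof. by case: _ / e. Qed.

Section BaseChange.
Variables (R R' : dgAlg) (phi : dgAlgHom R R').

(** Base change with bases in hand: the universal property speaks of chain maps only, whereas
    homotopies require the extension of arbitrary linear maps along iota. *)
Definition free_base_change (G : dgMod R) (T : dgMod R') (iota : dgHom G (restrict phi T)) :=
  exists (I : choiceType) (deg : I -> int) (b : forall i, G (deg i)),
    is_basis b /\ @is_basis R' T I deg (fun i => iota _ (b i)).

Section Extension.
Variables (G : dgMod R) (T : dgMod R') (iota : forall n, G n -> restrict phi T n).
Arguments iota : clear implicits.
Hypothesis Li : glin iota.
Variables (I : choiceType) (deg : I -> int) (b : forall i, G (deg i)).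
Hypothesis Hb : is_basis b.
Hypothesis HT : @is_basis R' T I deg (fun i => iota _ (b i)).

Lemma base_ext (U : dgMod R') (g : forall n, G n -> restrict phi U n) : glin g ->
  exists2 d : forall n, T n -> U n, glin d & forall n x, d n (iota n x) = g n x.
Proof.
move=> Lg; have [d Ld db] := basis_ext HT (N := U) (fun i => g _ (b i)).
exists d => // n x.
have Ldi : @glin R G (restrict phi U) (fun n x => d n (iota n x)).
  split=> [m y z|i j m h a y]; first by rewrite Li.1 Ld.1.
  by rewrite Li.2 /= Ld.2.
exact: (glin_basis_eq Hb Ldi Lg db).
Qed.

End Extension.

Lemma free_base_changeP (G : dgMod R) (T : dgMod R') (iota : dgHom G (restrict phi T)) :
  free_base_change iota -> is_base_change iota.
Proof.
move=> [I [deg [b [Hb HT]]]] U g.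
have [d Ld dE] := base_ext (glin_dgHom iota) Hb HT (glin_dgHom g).
have ch : forall n x, d (n - 1) (gmd x) = gmd (d n x).
  apply: (basis_chain HT Ld) => i.
  have := mhd iota (b i) => /= <-; rewrite !dE.
  exact: (mhd g).
exists (DgHom Ld.1 Ld.2 ch); split=> [n x|h hE n y]; first exact: dE.
apply: (glin_basis_eq HT (glin_dgHom h) Ld) => i.
by rewrite hE dE.
Qed.

(** T has the same basis over R', and its differential is forced by iota being a chain map. Its
    square then vanishes on the basis because that of G does. *)
Lemma base_change_ex (G : dgMod R) : semifree G ->
  exists (T : dgMod R') (iota : dgHom G (restrict phi T)), free_base_change iota.
Proof.
move=> [I [deg [b [lvl [Hb _]]]]].
pose T0 := free0 R' deg; pose e i : T0 (deg i) := fs_delta R' deg i.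
have He : is_basis e := free0_basis R' deg.
have [iota Li ib] := basis_ext Hb (N := restrict phi T0) e.
have [D LD De] := basis_ext He (N := shift T0) (fun i => iota _ (gmd (b i))).
have key n (x : G n) : gmd (iota n x : T0 n) + D n (iota n x) = iota _ (gmd x).
  move: n x; apply: (basis_ind Hb) => [n|n x y ex ey|i p n h r].
  - by rewrite !gmd0 !(glin0 Li) (glin0 LD) gmd0 addr0.
  - by rewrite [in RHS]gmdD !Li.1 [gmd (_ + _)](gmdD (d := T0)) LD.1 addrACA ex ey.
  - have h1 : p - 1 + deg i = n - 1 by rewrite -h addrAC.
    have h2 : p + (deg i - 1) = n - 1 by rewrite -h addrA.
    rewrite Li.2 (gmleibniz h h1 h2) Li.1 (glin_ksign Li) !Li.2 ib.
    rewrite [gmd _](gmleibniz (d := T0) h h1 h2) gmd_delta gact0r ksign_0 addr0 -ahd.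
    congr (_ + _); rewrite [LHS]LD.2 De.
    by congr (ksign p (gact _ _ _)); exact: eq_irrelevance.
have D2 : forall n (x : T0 n), gmd (gmd x + D n x) + D _ (gmd x + D n x) = 0.
  apply: free_twist_sq => // i; rewrite De.
  by rewrite key gmdd (glin0 Li).
pose T := twist LD D2.
have ich : forall n (x : G n), iota (n - 1) (gmd x) = gmd (iota n x : T n).
  by move=> n x; rewrite -key.
have LiT : @glin R G (restrict phi T) iota by exact: Li.
exists T, (DgHom LiT.1 LiT.2 ich), I, deg, b; split=> //.
by apply: (is_basis_ext (b := e : forall i, T (deg i))) => [i|]; rewrite /= ?ib.
Qed.

Lemma base_change_map (G G' : dgMod R) (T T' : dgMod R')
    (iota : dgHom G (restrict phi T)) (iota' : dgHom G' (restrict phi T'))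
    (g : dgHom G G') : is_base_change iota ->
  exists t : dgHom T T', forall n x, t n (iota n x) = iota' n (g n x).
Proof.
move=> bc; have [t [tE _]] := bc T' (compHom iota' g).
by exists t.
Qed.

Lemma base_change_uniq (G : dgMod R) (T T' : dgMod R')
    (iota : dgHom G (restrict phi T)) (iota' : dgHom G (restrict phi T')) :
  is_base_change iota -> is_base_change iota' ->
  exists (t : dgHom T T') (t' : dgHom T' T), forall n x, t' n (t n x) = x.
Proof.
move=> bc bc'; have [t tE] := base_change_map iota' (idHom G) bc.
have [t' tE'] := base_change_map iota (idHom G) bc'.
exists t, t' => n x; have [h [_ hu]] := bc T iota.
rewrite -[LHS]/(compHom t' t n x) -[RHS]/(idHom T n x).
by rewrite (hu (compHom t' t)) ?(hu (idHom T)) // => m y; rewrite /= tE tE'.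
Qed.

(** The linear extension of a homotopy is again a homotopy: the defect of the homotopy identity is
    linear, as the terms with d(a) cancel, and it vanishes on the image of a basis. *)
Lemma base_change_homotopic (G G' : dgMod R) (T T' : dgMod R')
    (iota : dgHom G (restrict phi T)) (iota' : dgHom G' (restrict phi T'))
    (g h : dgHom G G') (s t : dgHom T T') :
  free_base_change iota ->
  (forall n x, s n (iota n x) = iota' n (g n x)) ->
  (forall n x, t n (iota n x) = iota' n (h n x)) ->
  homotopic g h -> homotopic s t.
Proof.
move=> [I [deg [b [Hb HT]]]] sE tE [K LK KE].
have Li : @glin R (shift G) (restrict phi (shift T)) (fun n x => iota (n - 1) x).
  split=> [n x y|i j n hn a x]; first by rewrite mhD.
  by rewrite /= (glin_ksign (glin_dgHom iota)) mhZ.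
have HS : @is_basis R' (shift T) I (fun i => deg i + 1)
    (fun i => iota (deg i + 1 - 1) (shift_basis b i)).
  apply: is_basis_ext (is_basis_shift HT) => i.
  exact: (esym (@map_cast (fun d => G d) (fun d => T d) (fun d => @mh _ _ _ iota d) _ _ _ _)).
have Lg : @glin R (shift G) (restrict phi T') (fun n x => iota' n (K n x)).
  split=> [n x y|i j n hn a x]; first by rewrite LK.1 mhD.
  by rewrite LK.2 mhZ.
have [H LH HE] := base_ext Li (is_basis_shift Hb) HS Lg.
exists H => //.
have LD : @glin R' (shift T) (shift T')
    (fun n x => s (n - 1) x - t (n - 1) x - (gmd (H n x) - H (n - 1) (@gmd R' (shift T) n x))).
  split=> [n x y|i j n hn a x].
    by rewrite !mhD (@gmdD R' (shift T)) !LH.1 gmdD; zmod.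
  have h1 : i - 1 + j = n - 1 by rewrite -hn addrAC.
  have h2 : i + (j - 1) = n - 1 by rewrite -hn addrA.
  have e1 : gmd (H n (gact hn a x)) =
      gact h1 (gd a) (H j x) + ksign i (gact h2 a (gmd (H j x))).
    by rewrite LH.2 (gmleibniz hn h1 h2).
  have e2 : H (n - 1) (@gmd R' (shift T) n (gact hn a x)) =
      gact h1 (gd a) (H j x) + ksign i (gact h2 a (H (j - 1) (@gmd R' (shift T) j x))).
    rewrite (@gmleibniz R' (shift T) _ _ _ hn h1 h2) LH.1 LH.2; congr (_ + _).
    set w := @gact R' (shift T) _ _ _ _ _ _.
    by rewrite -[LHS]/(H (n - 1) (ksign i w)) (glin_ksign LH) LH.2.
  rewrite e1 e2 /= (eq_irrelevance (shift_deg hn) h2) !(glin_ksign (glin_dgHom _)) !mhZ.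
  by rewrite !gactDr !gactN !gactDr !gactN !ksignB; zmod.
have L0 : @glin R' (shift T) (shift T') (fun _ _ => 0).
  by split=> *; rewrite ?addr0 ?gact0r.
have E0 := glin_basis_eq HS LD L0 _.
move=> n x; have {E0} := E0 _ n x.
rewrite -[@gmd R' (shift T) n x]/(- gmd x) (glinN LH) opprK => E0.
apply/eqP; rewrite -subr_eq0; apply/eqP; apply: E0 => i.
set y := shift_basis b i; move: (deg i + 1) y => m y.
rewrite sE tE HE -[@gmd R' (shift T) m _]/(- gmd (iota (m - 1) y : T (m - 1))) (glinN LH).
have := mhd iota (y : G (m - 1)) => /= <-.
have -> : H (m - 1) (iota (m - 1 - 1) (gmd (y : G (m - 1)))) = iota' _ (K (m - 1) (gmd (y : G (m - 1)))).
  exact: HE.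
have e1 : iota' _ (g (m - 1) y) - iota' _ (h (m - 1) y) =
    iota' _ (gmd (K m y)) + iota' _ (K _ (gmd (y : G (m - 1)))).
  by rewrite -mhD -KE (glinB (glin_dgHom iota')).
have := mhd iota' (K m y) => /= e2.
by rewrite opprK [X in X - _ = 0]e1 e2; exact: subrr.
Qed.

Lemma free_base_change_cone (G G' : dgMod R) (T T' : dgMod R')
    (iota : dgHom G (restrict phi T)) (iota' : dgHom G' (restrict phi T'))
    (g : dgHom G G') (t : dgHom T T') :
  free_base_change iota -> free_base_change iota' ->
  (forall n x, t n (iota n x) = iota' n (g n x)) ->
  exists j : dgHom (cone g) (restrict phi (cone t)), free_base_change j.
Proof.
move=> [I [deg [b [Hb HT]]]] [I' [deg' [b' [Hb' HT']]]] tE.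
pose j n (u : cone g n) : restrict phi (cone t) n := (iota' n u.1, iota (n - 1) u.2).
have LJ : @glin R (cone g) (restrict phi (cone t)) j.
  split=> [n u v|i l n h a u].
    by rewrite /j /= !mhD.
  by rewrite /j /= (glin_ksign (glin_dgHom iota)) !mhZ.
have Jd : forall n u, j (n - 1) (gmd u) = gmd (j n u).
  move=> n u; rewrite /j /= mhD (glinN (glin_dgHom iota)) !mhd /= -tE.
  by [].
exists (DgHom LJ.1 LJ.2 Jd).
exists (I' + I)%type, (cone_deg (fun i => deg i + 1) deg'), (cone_basis g (shift_basis b) b').
split; first exact: is_basis_cone (is_basis_shift Hb) Hb'.
apply: is_basis_ext (is_basis_cone t (is_basis_shift HT) HT').
case=> [i|i]; congr pair => /=.
- by rewrite (glin0 (glin_dgHom iota)).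
- by rewrite (glin0 (glin_dgHom iota')).
- exact: (esym (@map_cast (fun d => G d) (fun d => T d) (fun d => @mh _ _ _ iota d) _ _ _ _)).
Qed.

End BaseChange.

(** * Linear algebra over a graded field *)

Definition helt (K : dgAlg) (T : dgMod K) : Type := {n : int & T n}.

Definition hel (K : dgAlg) (T : dgMod K) n (x : T n) : helt T :=
  existT (fun n => T n) n x.

Section GradedLinearAlgebra.
Variables (K : dgAlg).

Definition submod (T : dgMod K) (W : forall n, T n -> Prop) : Prop :=
  [/\ forall n, W n 0, forall n x y, W n x -> W n y -> W n (x + y) &
      forall i j n (h : i + j = n) (a : K i) x, W j x -> W n (gact h a x)].

(** The span modulo W, which allows linear algebra in a quotient to be done on representatives. *)
Fixpoint spn (T : dgMod K) (W : forall n, T n -> Prop) (ys : seq (helt T)) n (x : T n) : Prop :=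
  match ys with
  | [::] => W n x
  | y :: ys' => exists a : K (n - projT1 y),
      spn W ys' (x - gact (subrK (projT1 y) n) a (projT2 y))
  end.

Fixpoint allh (T : dgMod K) (W : forall n, T n -> Prop) (ys : seq (helt T)) : Prop :=
  match ys with
  | [::] => True
  | y :: ys' => W _ (projT2 y) /\ allh W ys'
  end.

(** Comparing each element with the later ones only is enough over a graded field, where the first
    nonzero coefficient of a relation is invertible. *)
Fixpoint indep (T : dgMod K) (W : forall n, T n -> Prop) (ys : seq (helt T)) : Prop :=
  match ys with
  | [::] => True
  | y :: ys' => ~ spn W ys' (projT2 y) /\ indep W ys'
  end.

Section OneModule.
Variable T : dgMod K.
Implicit Types W V : forall n, T n -> Prop.

Lemma submodN W n x : submod W -> W n x -> W n (- x).
Proof.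
move=> [_ _ WZ] Wx; have h0 : 0 + n = n by rewrite add0r.
by rewrite -[x](gact1 h0) -gactNl; apply: WZ.
Qed.

Lemma submodB W n x y : submod W -> W n x -> W n y -> W n (x - y).
Proof. by move=> sW Wx /(submodN sW); case: sW => _ WD _; exact: WD. Qed.

Lemma spn_mono W V ys n x : (forall n x, W n x -> V n x) -> @spn T W ys n x -> @spn T V ys n x.
Proof.
move=> WV; elim: ys n x => [|y ys IH] n x /=; first exact: WV.
by move=> [a sx]; exists a; exact: IH.
Qed.

Lemma submod_spn W ys : submod W -> submod (@spn T W ys).
Proof.
move=> sW; elim: ys => [|y ys [S0 SD SZ]] //; split=> [n|n x x' [a sx] [a' sx']|i j n h r x [a sx]].
- by exists 0; rewrite gact0l subr0; exact: S0.
- exists (a + a'); rewrite gactDl; have := SD _ _ _ sx sx'.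
  by congr (spn _ _ _); zmod.
- exists (gmul (act_deg (projT1 y) h) r a).
  rewrite (gactA _ _ (subrK _ _) h) -gactN -gactDr; exact: SZ.
Qed.

Lemma spn_base W ys n x : submod W -> W n x -> @spn T W ys n x.
Proof.
move=> sW; elim: ys n x => [|y ys IH] n x //= Wx.
by exists 0; rewrite gact0l subr0; exact: IH.
Qed.

Lemma spn_cons W y ys n x : submod W -> @spn T W ys n x -> spn W (y :: ys) x.
Proof. by move=> sW sx; exists 0; rewrite gact0l subr0. Qed.

Lemma spn_hd W y ys : submod W -> spn W (y :: ys) (projT2 y).
Proof.
move=> sW; case: y => n y /=.
have e : 0 = n - n :> int by rewrite subrr.
have h0 : 0 + n = n by rewrite add0r.
exists (rcast e (gone K)).
rewrite -(@gact_cast _ _ _ _ _ _ _ e erefl h0) gact1 subrr.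
by case: (submod_spn ys sW).
Qed.

Lemma allh_mono W V ys : (forall n x, W n x -> V n x) -> allh W ys -> allh V ys.
Proof. by move=> WV; elim: ys => //= y ys IH [/WV Vy /IH]. Qed.

Lemma allhI W V ys : allh W ys -> allh V ys -> allh (fun n x => W n x /\ V n x) ys.
Proof. by elim: ys => //= y ys IH [Wy Wys] [Vy Vys]; split; [|exact: IH]. Qed.

Lemma allh_spn W ys : submod W -> allh (@spn T W ys) ys.
Proof.
move=> sW; elim: ys => //= y ys IH; split; first exact: (spn_hd y ys sW).
by apply: allh_mono IH => n x; exact: (spn_cons y).
Qed.

Lemma spn_sub W V ys : submod V -> (forall n x, W n x -> V n x) -> allh V ys ->
  forall n x, @spn T W ys n x -> V n x.
Proof.
move=> sV WV; elim: ys => [_ n x|y ys IH [Vy Vys] n x [a sx]]; first exact: WV.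
have [_ VD VZ] := sV.
rewrite -[x](subrK (gact (subrK (projT1 y) n) a (projT2 y))).
by apply: VD; [exact: IH | exact: VZ].
Qed.

Lemma spn_add1 W y ys n x : @spn T (@spn T W [:: y]) ys n x ->
  exists a, spn W ys (x - gact (subrK (projT1 y) n) a (projT2 y)).
Proof.
elim: ys n x => [|z ys IH] n x //= [b /IH[a sx]].
exists a, b; move: sx; congr (spn _ _ _); zmod.
Qed.

Hypothesis Kinv : forall i j (h : j + i = 0) (x : K i), x <> 0 ->
  exists y : K j, gmul h y x = gone K.

(** Suppose a member z depends on y and the later members. If the coefficient of y is zero, z was
    already dependent; otherwise inverting it puts y in the span of the family. *)
Lemma indep_add1 W y ys : submod W -> ~ spn W ys (projT2 y) -> indep W ys ->
  indep (@spn T W [:: y]) ys.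
Proof.
move=> sW; elim: ys => //= z ys IH nsy [nz ind]; split; last first.
  by apply: IH => // sy; apply: nsy; exact: spn_cons.
move=> /spn_add1[a sz].
have [a0|/eqP an0] := eqVneq a 0; first by apply: nz; move: sz; rewrite a0 gact0l subr0.
have h : projT1 y - projT1 z + (projT1 z - projT1 y) = 0 by rewrite addrA subrK subrr.
have [r ra] := Kinv h an0; apply: nsy; exists r.
have [_ _ SZ] := submod_spn ys sW.
have h' : projT1 y - projT1 z + projT1 z = projT1 y by rewrite subrK.
have := SZ _ _ _ h' r _ sz; rewrite gactDr gactN.
have h0 : 0 + projT1 y = projT1 y by rewrite add0r.
rewrite -(gactA h h0 (subrK _ _) h') ra gact1 => /(submodN (submod_spn ys sW)).
congr (spn _ _ _); rewrite (eq_irrelevance h' (subrK _ _)); zmod.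
Qed.

(** Enlarging W by one element costs at most one member. [V] is arbitrary so as to follow the
    surviving members; the induction adds to it membership in the span of the tail, which keeps z
    independent of them. *)
Lemma indep_drop W V y zs : submod W -> allh V zs -> indep W zs ->
  exists zs', [/\ (size zs <= (size zs').+1)%N, allh V zs' & indep (@spn T W [:: y]) zs'].
Proof.
move=> sW; elim: zs V => [|z zs IH] V; first by exists [::].
move=> /= [Vz Vzs] [nz ind].
have [sy|nsy] := pselect (spn W zs (projT2 y)); last first.
  by exists zs; split=> //; exact: indep_add1.
have sS := submod_spn zs sW.
have Vzs' := allhI Vzs (allh_spn zs sW).
have [zs' [sz Vz' ind']] := IH _ Vzs' ind.
exists (z :: zs'); split=> //=.
  by split=> //; apply: allh_mono Vz' => n x [].
split=> // sz'; apply: nz; apply: (@spn_sub (@spn T W [:: y]) (@spn T W zs) zs' sS _ _ _ _ sz').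
  apply: (@spn_sub W (@spn T W zs) [:: y] sS) => // m u.
  exact: spn_base.
by apply: allh_mono Vz' => n x [].
Qed.

(** Steinitz exchange: the elements of [ys] are absorbed into W one by one, each at the cost of at
    most one member of [zs]. *)
Lemma exchange W zs ys : submod W -> indep W zs -> allh (@spn T W ys) zs ->
  (size zs <= size ys)%N.
Proof.
elim: ys W zs => [|y ys IH] W zs sW ind szs.
  case: zs ind szs => //= z zs [nz _] [Wz _].
  by case: nz; exact: spn_base.
have [zs' [sz szs' ind']] := indep_drop y sW szs ind.
apply: leq_trans sz _; rewrite ltnS.
apply: IH ind' _; first exact: submod_spn.
apply: allh_mono szs' => n x.
have s1 := submod_spn [:: y] sW; have sS := submod_spn ys s1.
apply: (spn_sub sS).
  by move=> m u Wu; apply: spn_base => //; exact: spn_base.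
split; first by apply: spn_base => //; exact: spn_hd.
by apply: allh_mono (allh_spn ys sW) => m u; apply: spn_mono => l v; exact: spn_base.
Qed.

(** Take for w the remainder of x after a combination of [ys]; it lies in V because x and [ys] do,
    and x - w is an honest combination, whatever W0. *)
Lemma spn_split W V W0 ys n (x : T n) : submod W0 -> submod V -> allh V ys -> V n x ->
  spn W ys x -> exists w, [/\ W n w, V n w & spn W0 ys (x - w)].
Proof.
move=> sW0 sV; elim: ys n x => [|y ys IH] n x /=.
  by move=> _ Vx Wx; exists x; split=> //; rewrite subrr; case: sW0.
move=> [Vy Vys] Vx [a sx].
have [|w [Ww Vw sw]] := IH _ _ Vys _ sx.
  by apply: submodB => //; case: sV => _ _; apply.
by exists w; split=> //; exists a; move: sw; congr (spn _ _ _); zmod.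
Qed.

(** Additivity of rank, on families. A member z that depends on [ys] modulo W2 is replaced by its
    remainder w in W2; as z - w lies in the span of the other members modulo W, a relation for w
    would give one for z. *)
Lemma indep_split W W2 V zs : submod W -> submod W2 -> submod V ->
  (forall n x, W n x -> W2 n x) -> allh V zs -> indep W zs ->
  exists xs ys, [/\ (size xs + size ys)%N = size zs, allh (fun n x => V n x /\ W2 n x) xs,
    allh V ys, indep W xs & indep W2 ys].
Proof.
move=> sW sW2 sV WW2 Vzs ind.
suff [xs [ys [? ? ? ? [? ? ?]]]] : exists xs ys,
    [/\ (size xs + size ys)%N = size zs, allh (fun n x => V n x /\ W2 n x) xs,
      allh V ys, indep W xs & [/\ indep W2 ys, allh (@spn T W zs) xs & allh (@spn T W zs) ys]].
  by exists xs, ys.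
elim: zs Vzs ind => [|z zs IH] /=; first by exists [::], [::].
move=> [Vz Vzs] [nz ind]; have [xs [ys [sz Vxs Vys ix [iy sx sy]]]] := IH Vzs ind.
have sS := submod_spn zs sW; have sS' := submod_spn (z :: zs) sW.
have up us : allh (@spn T W zs) us -> allh (@spn T W (z :: zs)) us.
  by apply: allh_mono => n x; exact: spn_cons.
have Sz : spn W (z :: zs) (projT2 z) by exact: spn_hd.
have [syz|nyz] := pselect (spn W2 ys (projT2 z)); last first.
  exists xs, (z :: ys); split=> //=; first by rewrite addnS sz.
  by split=> //; [exact: up | split=> //; exact: up].
have [w [Ww Vw sw]] := spn_split sW sV Vys Vz syz.
have szw : spn W zs (projT2 z - w).
  by apply: (spn_sub sS _ sy sw) => n x; exact: spn_base.
exists (hel w :: xs), ys; split=> //=; first by rewrite addSn sz.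
  split=> // swx; apply: nz; rewrite -[projT2 z](subrK w).
  case: (sS) => _ SD _; apply: SD => //.
  by apply: (spn_sub sS _ sx swx) => n x; exact: spn_base.
split=> //; [split | ]; [| exact: up | exact: up].
rewrite -[w](subKr (projT2 z)); apply: (submodB sS') => //.
exact: (@spn_cons W z zs _ _ sW szw).
Qed.

(** Modulo W2 the elements of [xs] vanish, so a relation for a member of [ys] becomes one inside
    [ys]. The order matters, since [indep] looks only at later elements. *)
Lemma indep_cat W W2 xs ys : submod W -> submod W2 -> (forall n x, W n x -> W2 n x) ->
  allh W2 xs -> indep W xs -> indep W2 ys -> indep W (ys ++ xs).
Proof.
move=> sW sW2 WW2 Wxs ix; elim: ys => //= y ys IH [ny iy]; split; last exact: IH.
move=> sy; apply: ny; have sS := submod_spn ys sW2.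
apply: (spn_sub sS _ _ sy).
  by move=> n x /WW2; exact: spn_base.
elim: ys sS {IH iy sy} => [|z ys IH] sS /=; first exact: Wxs.
split; first exact: spn_hd.
apply: allh_mono (IH (submod_spn ys sW2)) => n x; exact: spn_cons.
Qed.

Lemma indep_suffix W ys m : indep W ys -> indep W (drop m ys).
Proof. by elim: ys m => [|y ys IH] [|m] //= [_ iy]; exact: IH. Qed.

Lemma allh_suffix W ys m : allh W ys -> allh W (drop m ys).
Proof. by elim: ys m => [|y ys IH] [|m] //= [_ iy]; exact: IH. Qed.

End OneModule.

Section TwoModules.
Variables (T T' : dgMod K) (f : dgHom T T').

Definition hmap (y : helt T) : helt T' := hel (f _ (projT2 y)).

Lemma spn_map_inv (W V : forall n, T n -> Prop) (W' : forall n, T' n -> Prop) ys n (x : T n) :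
  submod V -> (forall n x, V n x -> W' n (f n x) -> W n x) -> allh V ys -> V n x ->
  spn W' (map hmap ys) (f n x) -> spn W ys x.
Proof.
move=> sV WW; elim: ys n x => [|y ys IH] n x /=; first by move=> _; exact: WW.
move=> [Vy Vys] Vx [a]; rewrite -mhZ -(glinB (glin_dgHom f)) => sx.
exists a; apply: IH sx => //; apply: submodB => //.
by case: sV => _ _; apply.
Qed.

Lemma indep_map (W V : forall n, T n -> Prop) (W' : forall n, T' n -> Prop) ys :
  submod V -> (forall n x, V n x -> W' n (f n x) -> W n x) -> allh V ys ->
  indep W ys -> indep W' (map hmap ys).
Proof.
move=> sV WW; elim: ys => //= y ys IH [Vy Vys] [ny iy]; split; last exact: IH.
by move=> /(spn_map_inv sV WW Vys Vy).
Qed.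

Lemma allh_map (V : forall n, T n -> Prop) (V' : forall n, T' n -> Prop) ys :
  (forall n x, V n x -> V' n (f n x)) -> allh V ys -> allh V' (map hmap ys).
Proof. by move=> VV; elim: ys => //= y ys IH [/VV ? /IH]. Qed.

(** A relation between lifts maps to a relation between the original elements modulo W'. *)
Lemma indep_lift (W V : forall n, T n -> Prop) (W' V' : forall n, T' n -> Prop) ys :
  submod W' -> (forall n x, W n x -> W' n (f n x)) ->
  (forall n y, V' n y -> exists2 x, V n x & W' n (y - f n x)) ->
  allh V' ys -> indep W' ys ->
  exists xs : seq (helt T), [/\ size xs = size ys, allh V xs & indep W xs].
Proof.
move=> sW' WW lift Vys iy.
suff [xs [? ? ? _]] : exists xs : seq (helt T), [/\ size xs = size ys, allh V xs, indep W xs &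
    forall n (x : T n), spn W xs x -> spn W' ys (f n x)] by exists xs.
elim: ys Vys iy => [|y ys IH] /=.
  by exists [::]; split=> // n x; exact: WW.
move=> [Vy Vys] [ny iy]; have [xs [sz Vxs ix sx]] := IH Vys iy.
have [x Vx Wx] := lift _ _ Vy.
have [_ SD SZ] := submod_spn ys sW'.
exists (hel x :: xs); split=> //=; first by rewrite sz.
  split=> // /sx sfx; apply: ny; rewrite -[projT2 y](subrK (f _ x)).
  by apply: SD => //; exact: spn_base.
move=> n u [a /sx su]; exists a; move: su.
rewrite (glinB (glin_dgHom f)) mhZ => su.
rewrite (_ : _ - _ = f n u - gact (subrK (projT1 y) n) a (f (projT1 y) x) -
   gact (subrK (projT1 y) n) a (projT2 y - f _ x)).
  by apply: (submodB (submod_spn ys sW')) => //; apply: SZ; exact: spn_base.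
rewrite gactDr gactN; zmod.
Qed.

End TwoModules.

End GradedLinearAlgebra.

(** * Rank of homology *)

Section HomologyRank.
Variable K : dgAlg.
Hypothesis K0 : forall n (x : K n), gd x = 0.
Hypothesis Kinv : forall i j (h : j + i = 0) (x : K i), x <> 0 ->
  exists y : K j, gmul h y x = gone K.
Hypothesis K1 : gone K <> 0.

Definition bnd (T : dgMod K) n (x : T n) : Prop := boundary x.
Definition cyc (T : dgMod K) n (x : T n) : Prop := gmd x = 0.

Lemma gmd_gact (T : dgMod K) i j n (h : i + j = n) (h2 : i + (j - 1) = n - 1)
    (a : K i) (x : T j) : gmd (gact h a x) = ksign i (gact h2 a (gmd x)).
Proof.
have h1 : i - 1 + j = n - 1 by rewrite -h addrAC.
by rewrite (gmleibniz h h1 h2) K0 gact0l add0r.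
Qed.

Lemma submod_cyc (T : dgMod K) : submod (@cyc T).
Proof.
split=> [n|n x y dx dy|i j n h a x dx]; rewrite /cyc ?gmd0 ?gmdD ?dx ?dy ?addr0 //.
have h2 : i + (j - 1) = n - 1 by rewrite -h addrA.
by rewrite (gmd_gact h h2) dx gact0r ksign_0.
Qed.

Lemma submod_bnd (T : dgMod K) : submod (@bnd T).
Proof.
split=> [n|n x y|i j n h a x]; [exact: boundary0 | exact: boundaryD |].
move: h x; have [m ?] := degB1 j; subst j; have [l ?] := degB1 n; subst n => h x.
move=> /boundaryE[y ->]; have h' : i + m = l by lia.
apply/boundaryE; exists (ksign i (gact h' a y)).
by rewrite gmd_ksign (gmd_gact h' h) ksignK.
Qed.

Definition Indep (T : dgMod K) (i : nat) : Prop :=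
  exists zs : seq (helt T), [/\ size zs = i, allh (@cyc T) zs & indep (@bnd T) zs].

Section Conversion.
Variables (T : dgMod K) (I : choiceType) (deg : I -> int) (z : forall i, T (deg i)).
Let zh i : helt T := hel (z i).
Variable W : forall n, T n -> Prop.
Arguments W : clear implicits.
Hypothesis sW : submod W.

Lemma lincomb_cons n i s (a : forall i, K (n - deg i)) :
  lincomb z (i :: s) a = gact (subrK (deg i) n) (a i) (z i) + lincomb z s a.
Proof. by rewrite /lincomb big_cons. Qed.

Lemma lincomb_dfwith n i s (a : forall i, K (n - deg i)) (a0 : K (n - deg i)) :
  i \notin s ->
  lincomb z (i :: s) (dfwith a a0) = gact (subrK (deg i) n) a0 (z i) + lincomb z s a.
Proof.
move=> nis; rewrite lincomb_cons dfwith_in; congr (_ + _).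
by apply: eq_big_seq => j js; rewrite dfwith_out //; apply: contraNneq nis => ->.
Qed.

Lemma spn_lincomb s n (x : T n) : uniq s ->
  spn W (map zh s) x <-> exists a : forall i, K (n - deg i), W n (x - lincomb z s a).
Proof.
elim: s n x => [|i s IH] n x /=.
  move=> _; rewrite /lincomb; split=> [Wx|[a]]; last by rewrite big_nil subr0.
  by exists (fun=> 0); rewrite big_nil subr0.
move=> /andP[nis us]; split=> [[a0 /IH[//|a Wa]]|[a Wa]].
  by exists (dfwith a a0); rewrite lincomb_dfwith // opprD addrA.
exists (a i); apply/IH => //; exists a.
by move: Wa; rewrite lincomb_cons opprD addrA.
Qed.

Lemma indep_lincomb s n (a : forall i, K (n - deg i)) : uniq s ->
  indep W (map zh s) -> W n (lincomb z s a) -> forall i, i \in s -> a i = 0.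
Proof.
elim: s => //= i s IH /andP[nis us] [nz ind] Wa.
have ai : a i = 0.
  apply: contrapT => ai; apply: nz.
  have h : deg i - n + (n - deg i) = 0 by rewrite addrA subrK subrr.
  have [r ra] := Kinv h ai.
  have h' : deg i - n + n = deg i by rewrite subrK.
  have h0 : 0 + deg i = deg i by rewrite add0r.
  have [_ _ WZ] := sW; have := WZ _ _ _ h' r _ Wa.
  rewrite lincomb_cons gactDr -(gactA h h0 (subrK _ _) h') ra gact1.
  rewrite gact_lincomb => Wr; apply/spn_lincomb => //.
  exists (fun j => - gmul (act_deg (deg j) h') r (a j)).
  rewrite (_ : lincomb _ _ _ = - lincomb z s (fun j => gmul (act_deg (deg j) h') r (a j))).
    by rewrite opprK.
  by rewrite /lincomb -sumrN; apply: eq_bigr => j _; rewrite gactNl.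
move=> j; rewrite inE => /orP[/eqP -> //|]; apply: IH => //.
by move: Wa; rewrite lincomb_cons ai gact0l add0r.
Qed.

Lemma lincomb_indep s : uniq s ->
  (forall n (a : forall i, K (n - deg i)), W n (lincomb z s a) -> forall i, i \in s -> a i = 0) ->
  indep W (map zh s).
Proof.
elim: s => //= i s IH /andP[nis us] H; split; last first.
  apply: IH => // n a Wa j js.
  have := H n (dfwith a (0 : K (n - deg i))); rewrite lincomb_dfwith // gact0l add0r.
  have ij : i != j by apply: contraNneq nis => ->.
  by move=> /(_ Wa j); rewrite inE js orbT dfwith_out // => /(_ isT).
move=> /spn_lincomb-/(_ us)[a Wa].
have e : 0 = deg i - deg i :> int by rewrite subrr.
have h0 : 0 + deg i = deg i by rewrite add0r.
have := H _ (dfwith (fun j => - a j) (rcast e (gone K))).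
rewrite lincomb_dfwith // -(@gact_cast _ _ _ _ _ _ _ e erefl h0) gact1.
have -> : lincomb z s (fun j => - a j) = - lincomb z s a.
  by rewrite /lincomb -sumrN; apply: eq_bigr => j _; rewrite gactNl.
move=> /(_ Wa i); rewrite inE eqxx dfwith_in => /(_ isT).
by move: e; rewrite subrr => e; rewrite (eq_irrelevance e erefl) => /K1.
Qed.

End Conversion.

Lemma homology_basisP (T : dgMod K) r :
  homology_basis T r <-> exists zs : seq (helt T), [/\ size zs = r, allh (@cyc T) zs,
    indep (@bnd T) zs & forall n (x : T n), gmd x = 0 -> spn (@bnd T) zs x].
Proof.
have sB := submod_bnd T; split.
  move=> [deg [z [dz sz iz]]].
  exists (map (fun i => hel (z i)) (enum 'I_r)); split.
  - by rewrite size_map -cardE card_ord.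
  - by elim: (enum _) => //= i s IH; split => //; exact: dz.
  - apply: lincomb_indep => //; first exact: enum_uniq.
    by move=> n a Wa i _; exact: iz Wa i.
  - by move=> n x dx; apply/spn_lincomb; [exact: enum_uniq | exact: sz].
move=> [zs [<- cz iz sz]].
pose t i := tnth (in_tuple zs) i; pose deg i := projT1 (t i).
pose z i : T (deg i) := projT2 (t i).
have ez : map (fun i => hel (z i)) (enum 'I_(size zs)) = zs.
  rewrite -[RHS](map_tnth_enum (in_tuple zs)); apply: eq_map => i.
  by rewrite /z /deg /t; case: (tnth _ _).
exists deg, z; split.
- move: cz; rewrite -[X in allh _ X]ez => cz i.
  have: i \in enum 'I_(size zs) by rewrite mem_enum.
  elim: (enum _) cz => //= j s IH [dj /IH{}IH].
  by rewrite inE => /orP[/eqP ->|/IH].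
- by move=> n y /sz; rewrite -[X in spn _ X]ez => /spn_lincomb; apply; exact: enum_uniq.
- move=> n a Wa i; move: iz; rewrite -[X in indep _ X]ez => iz.
  apply: (indep_lincomb sB _ iz Wa); [exact: enum_uniq | by rewrite mem_enum].
Qed.

(** For finite rank, suffixes of a basis give all smaller sizes and [exchange] excludes larger ones.
    For infinite rank an independent family never spans, as it would be a basis, so it can always be
    enlarged. *)
Lemma Indep_rank (T : dgMod K) rho i : is_homology_rank T rho -> leq_rank i rho <-> Indep T i.
Proof.
case: rho => [r|] /=.
  move=> /homology_basisP[zs [sz cz iz spz]]; split=> [ir|[ys [<- cy iy]]].
    exists (drop (r - i) zs); split; [|exact: allh_suffix | exact: indep_suffix].
    by rewrite size_drop sz subKn.
  rewrite -sz; apply: (exchange Kinv (submod_bnd T) iy).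
  exact: allh_mono cy.
move=> H; split=> // _; elim: i => [|i [zs [sz cz iz]]]; first by exists [::].
have [sp|/existsNP[n /existsNP[x /not_implyP[dx nx]]]] :=
    pselect (forall n (x : T n), gmd x = 0 -> spn (@bnd T) zs x).
  by case: (H i); apply/homology_basisP; exists zs.
by exists (hel x :: zs); split=> //=; rewrite ?sz.
Qed.

Lemma homology_rank_ex (T : dgMod K) : exists rho, is_homology_rank T rho.
Proof.
have [[r hr]|H] := pselect (exists r, homology_basis T r); first by exists (Some r).
by exists None => r hr; apply: H; exists r.
Qed.

(** A left inverse up to homotopy makes t injective on homology. *)
Lemma Indep_map (T T' : dgMod K) (t : dgHom T T') (t' : dgHom T' T) i :
  homotopic (compHom t' t) (idHom T) -> Indep T i -> Indep T' i.
Proof.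
move=> tt [zs [sz cz iz]]; exists (map (hmap t) zs); split.
- by rewrite size_map.
- by apply: allh_map cz => n x; rewrite /cyc -mhd => ->; exact: (glin0 (glin_dgHom t)).
- apply: indep_map (submod_cyc T) _ cz iz => n x dx btx.
  rewrite -[x](subrK (t' n (t n x))) /bnd; apply: boundaryD; last exact: boundary_map.
  exact: (homotopic_boundary (homotopic_sym tt) dx).
Qed.

Section ConeRank.
Variables (T T' : dgMod K) (t : dgHom T T').
Let killed n (y : T' n) : Prop := bnd (coneIn t n y).

Let submod_killed : submod killed.
Proof.
split=> [n|n x y bx by_|i j n h a x bx]; rewrite /killed.
- by rewrite (glin0 (glin_dgHom (coneIn t))); exact: boundary0.
- by rewrite /bnd mhD; exact: boundaryD.
- by rewrite mhZ; case: (submod_bnd (cone t)) => _ _; apply.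
Qed.

Let bnd_killed n (y : T' n) : bnd y -> killed y.
Proof. exact: boundary_map. Qed.

(** On cycles this is exactness of H(T) -> H(T') -> H(cone t) at H(T'). *)
Lemma killedP n (y : T' n) : killed y <-> exists2 x : T n, gmd x = 0 & bnd (y - t n x).
Proof.
have [m ?] := degB1 n; subst n; split.
  move=> /boundaryE[[y' x] e].
  have e1 : y = gmd y' + t _ x := congr1 fst e.
  have e2 : 0 = - gmd (x : T (m - 1)) := congr1 snd e.
  exists x; first by rewrite -[gmd _]opprK -e2 oppr0.
  by rewrite e1 addrK; exact: Boundary.
move=> [x dx /boundaryE[y' e]]; apply/boundaryE; exists ((y', x) : cone t m).
by congr pair => /=; rewrite -?e ?subrK ?dx ?oppr0.
Qed.

(** The family is split along the kernel of H(T') -> H(cone t): by exactness the part in the kernel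
    lifts to H(T), and the rest stays independent in H(cone t). *)
Lemma Indep_cone l : Indep T' l -> exists i j, [/\ (i + j)%N = l, Indep T i & Indep (cone t) j].
Proof.
move=> [zs [sz cz iz]].
have [xs [ys [sxy Vx Vy ix iy]]] :=
  indep_split (submod_bnd T') submod_killed (submod_cyc T') bnd_killed cz iz.
exists (size xs), (size ys); split; first by rewrite sxy.
  have [|n y [_ /killedP[x dx bx]]|us [su cu iu]] := @indep_lift K T T' t (@bnd T) (@cyc T) (@bnd T')
    (fun n x => cyc x /\ killed x) xs (submod_bnd T') _ _ Vx ix.
  - by move=> n x; exact: boundary_map.
  - by exists x.
  - by exists us.
exists (map (hmap (coneIn t)) ys); split; first by rewrite size_map.
  by apply: allh_map Vy => n x; rewrite /cyc -mhd => ->; exact: (glin0 (glin_dgHom (coneIn t))).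
by apply: indep_map (submod_cyc T') _ Vy iy.
Qed.

(** Injectivity of H(T) -> H(T') makes H(T') -> H(cone t) surjective. A family of the cone therefore
    lifts, independent modulo the kernel, while the images of a family of T are independent inside
    the kernel. *)
Lemma Indep_cone_split (t' : dgHom T' T) i j : homotopic (compHom t' t) (idHom T) ->
  Indep T i -> Indep (cone t) j -> Indep T' (i + j).
Proof.
move=> tt [xs [sx cx ix]] [ys [sy cy iy]].
have inj n (x : T n) : gmd x = 0 -> bnd (t n x) -> bnd x.
  move=> dx btx; rewrite -[x](subrK (t' n (t n x))) /bnd.
  apply: boundaryD; last exact: boundary_map.
  exact: (homotopic_boundary (homotopic_sym tt) dx).
have [|n y cyy|us [su cu iu]] := @indep_lift K T' (cone t) (coneIn t) killed (@cyc T') (@bnd (cone t))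
    (@cyc (cone t)) ys (submod_bnd _) _ _ cy iy.
- by [].
- case: y cyy => y x /cone_cycle[dy dx].
  have btx : bnd (t _ x).
    rewrite (_ : t _ x = - gmd y); first by apply: boundaryN; exact: Boundary.
    by apply/eqP; rewrite -addr_eq0 -dy; apply/eqP; exact: addrC.
  move: y x dy dx btx; have [m ?] := degB1 n; subst n => y x dy dx btx.
  have /boundaryE[x' ex] := inj _ _ dx btx.
  (* As x = d x', the cycle (y, x) differs from (y + t x', 0) by the boundary of (0, - x'). *)
  exists (y + t _ x'); first by rewrite /cyc gmdD -mhd -ex.
  apply/boundaryE; exists ((0, - x') : cone t m); congr pair => /=.
    by rewrite gmd0 (glinN (glin_dgHom t)); zmod.
  by rewrite gmdN opprK ex subr0.
exists (us ++ map (hmap t) xs); split.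
- by rewrite size_cat size_map su sx sy addnC.
- elim: (us) cu => [_|u vs IH] /=; last by case=> cu /IH.
  by apply: allh_map cx => n x; rewrite /cyc -mhd => ->; exact: (glin0 (glin_dgHom t)).
- apply: (indep_cat (submod_bnd T') submod_killed bnd_killed) => //.
    apply: allh_map cx => n x dx; apply/killedP; exists x => //.
    by rewrite subrr; exact: boundary0.
  by apply: indep_map (submod_cyc T) _ cx ix => n x; exact: inj.
Qed.

End ConeRank.

End HomologyRank.

(** * Jump loci *)

Section Kappa.
Variables (k : fieldType) (c : nat) (p : hprime k c).

Section Fractions.
Variables (E : fieldType) (pi : {rmorphism {mpoly k[c]} -> E}).
Hypothesis pi_eq0 : forall q, (pi q == 0) = (q \in (hp_ideal p : pred {mpoly k[c]})).

Lemma kappa_in_unit i j (h : j + i = 0) (x : kappa_in pi_eq0 i) :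
  x <> 0 -> exists y : kappa_in pi_eq0 j, gmul h y x = gone (kappa_in pi_eq0).
Proof.
case: x => x hx /eqP; rewrite -val_eqE /= => x0.
have /kapP[d [a [s [ha hs ps ex]]]] := hx.
have s0 : pi s != 0 by rewrite pi_eq0.
have a0 : pi a != 0 by apply: contraNneq x0 => a0; rewrite ex a0 mul0r.
(* The denominator a of the inverse has degree d + i, so its numerator s must have degree d + i + j,
   which is d. *)
have hy : pi s / pi a \is kap p pi j.
  apply/kapP; exists (d + i), s, a; split=> //; last by rewrite -pi_eq0.
  by rewrite -addrA [i + j]addrC h addr0.
exists (KappaEl hy); apply: val_inj => /=.
by rewrite ex mulrA divfK // divff.
Qed.

Lemma kappa_in_one_neq0 : gone (kappa_in pi_eq0) <> 0.
Proof. by move=> /(congr1 val) /= /eqP; rewrite oner_eq0. Qed.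

End Fractions.

Lemma kappa_unit i j (h : j + i = 0) (x : kappa p i) :
  x <> 0 -> exists y : kappa p j, gmul h y x = gone (kappa p).
Proof. exact: kappa_in_unit. Qed.

Lemma kappa_one_neq0 : gone (kappa p) <> 0.
Proof. exact: kappa_in_one_neq0. Qed.

Lemma kappa_d n (x : kappa p n) : gd x = 0.
Proof. by []. Qed.

End Kappa.

Lemma Diso_id (R : dgAlg) (X : dgMod R) : Diso (Did X).
Proof. by exists (Did X); split; exact: deq_idl. Qed.

Section Main.
Variables (k : fieldType) (A : localDgAlg k) (c : nat) (f : 'I_c -> A 0).
Hypothesis fm : forall i, max_ideal (f i).
Variables (B : koszul f) (p : hprime k c).

(* T computes RHom_B(X, k) (x)^L_S kappa(p). *)
Definition fiber_model (X : dgMod B) (T : dgMod (kappa p)) : Prop :=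
  exists (F : dgMod B) (q : dgHom F X)
         (G : dgMod (cohop k c)) (r : dgHom G (RHom fm F))
         (iota : dgHom G (restrict (to_kappa p) T)),
    [/\ semifree F, quasi_iso q, semifree G, quasi_iso r & is_base_change iota].

Lemma jump_locusE i X : jump_locus fm i X p <->
  exists2 T, fiber_model X T & Indep T i.
Proof.
have R T rho j := @Indep_rank _ (@kappa_d k c p) (@kappa_unit k c p) (@kappa_one_neq0 k c p) T rho j.
split=> [[rho [F [q [G [r [T [iota [H rk]]]]]]] /(R T rho i rk) ind]|[T [F [q [G [r [iota H]]]]] ind]].
  by exists T => //; exists F, q, G, r, iota.
have [rho rk] := homology_rank_ex T.
by exists rho; [exists F, q, G, r, T, iota | apply/(R T rho i rk)].
Qed.

Lemma rmap_homotopy_equiv (F F' : dgMod B) (phi : dgHom F F') (psi : dgHom F' F) :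
  homotopy_equiv phi psi -> homotopy_equiv (rmap fm phi) (rmap fm psi).
Proof.
move=> [h1 h2]; split.
  apply: homotopic_trans _ (homotopic_trans (rmap_homotopic fm h2) _);
    by apply: homotopic_eq => n x; apply: homS_eq.
apply: homotopic_trans _ (homotopic_trans (rmap_homotopic fm h1) _);
  by apply: homotopic_eq => n x; apply: homS_eq.
Qed.

(** Independence of all choices. Resolutions over B are homotopy equivalent, so both resolutions
    over S resolve the same module up to restriction; they too are homotopy equivalent, and base
    change preserves this. *)
Lemma fiber_model_iso (X X' : dgMod B) (u : dmor X X') T T' i :
  Diso u -> fiber_model X T -> fiber_model X' T' -> Indep T i -> Indep T' i.
Proof.
move=> iu [F [q [G [r [iota [sF qq sG qr bc]]]]]] [F' [q' [G' [r' [iota' [sF' qq' sG' qr' bc']]]]]].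
have [phi [psi /rmap_homotopy_equiv/homotopy_equiv_quasi_iso qphi]] :=
  resolution_uniq sF sF' qq qq' iu.
have [al [be [h1 _]]] := resolution_uniq sG sG' qr (quasi_iso_comp qr' qphi)
  (Diso_id _).
(* T is known only through its universal property; an explicit base change is interposed so that the
   homotopy on G can be transported. *)
have [T0 [iota0 fb]] := base_change_ex (to_kappa p) sG.
have bc0 := free_base_changeP fb.
have [s [s' ss]] := base_change_uniq bc bc0.
have [t tE] := base_change_map iota' al bc0.
have [t' tE'] := base_change_map iota0 be bc'.
have K0 := @kappa_d k c p.
have st : homotopic (compHom s' s) (idHom T) by exact: homotopic_eq.
move=> /(Indep_map K0 st); apply: (@Indep_map _ K0 _ _ t t').
apply: (base_change_homotopic fb _ _ h1) => n x //=.
by rewrite tE tE'.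
Qed.

Lemma fiber_model_cone (X Y : dgMod B) (g : dgHom X Y) :
  exists (TC TY : dgMod (kappa p)) (t : dgHom TC TY),
    [/\ fiber_model (cone g) TC, fiber_model Y TY, fiber_model X (cone t) &
      (exists s : dmor (cone g) Y, deq (Dcomp (Dmap (coneIn g)) s) (Did _)) ->
      exists t' : dgHom TY TC, homotopic (compHom t' t) (idHom TC)].
Proof.
have [FX [qX [sX qiX]]] := semifree_resolution X.
have [FY [qY [sY qiY]]] := semifree_resolution Y.
have [h gh] := semifree_lift (compHom g qX) sX qiY.
have [qC [qCin /(_ qiX qiY) qiC]] := cone_map (homotopic_sym gh).
have sC := semifree_cone h sX sY.
pose rho := rmap fm (coneIn h).
have [GC [rC [sGC qrC]]] := semifree_resolution (RHom fm (cone h)).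
have [GY [rY [sGY qrY]]] := semifree_resolution (RHom fm FY).
have [m em] := semifree_lift (compHom rho rC) sGC qrY.
have [d [_ /(_ qrC qrY) qd]] := cone_map (homotopic_sym em).
have [kap /rcone_quasi_iso qkap] := rcone_dgHom fm h.
have [TC [iC fbC]] := base_change_ex (to_kappa p) sGC.
have [TY [iY fbY]] := base_change_ex (to_kappa p) sGY.
have bcC := free_base_changeP fbC; have bcY := free_base_changeP fbY.
have [t tE] := base_change_map iY m bcC.
have [j /free_base_changeP bcj] := free_base_change_cone fbC fbY tE.
exists TC, TY, t; split.
- by exists (cone h), qC, GC, rC, iC.
- by exists FY, qY, GY, rY, iY.
- exists FX, qX, (cone m), (compHom kap d), j; split=> //.
    exact: semifree_cone.
  exact: quasi_iso_comp.
move=> [s es].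
(* The section becomes a chain map sg from cone h to FY. Restriction along it is a left inverse of
   rho up to homotopy; its lift [la] is therefore one of m, by uniqueness of lifts along [rC]. *)
have [|sg esg] := lift_section (e' := coneIn h) sC qiY qiC _ es.
  by apply: homotopic_eq => n y; exact: qCin.
have [la ela] := semifree_lift (compHom (rmap fm sg) rY) sGY qrC.
have [t' tE'] := base_change_map iC la bcY.
exists t'; apply: (base_change_homotopic (g := compHom la m) (h := idHom GC) fbC) => [n x|//|].
  by rewrite /= tE tE'.
apply: (semifree_lift_uniq sGC qrC).
apply: homotopic_trans (homotopic_trans _ (homotopic_sym (homotopic_compr m ela))) _.
  exact: homotopic_eq.
apply: homotopic_trans (homotopic_trans _ (homotopic_compl (rmap fm sg) (homotopic_sym em))) _.
  exact: homotopic_eq.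
apply: homotopic_trans (homotopic_trans _ (homotopic_compr rC (rmap_homotopic fm esg))) _.
  by apply: homotopic_eq => n x; apply: homS_eq.
by apply: homotopic_eq => n x; apply: homS_eq.
Qed.

Lemma fiber_model_ex (X : dgMod B) : exists T, fiber_model X T.
Proof.
have [F [q [sF qq]]] := semifree_resolution X.
have [G [r [sG qr]]] := semifree_resolution (RHom fm F).
have [T [iota /free_base_changeP bc]] := base_change_ex (to_kappa p) sG.
by exists T, F, q, G, r, iota.
Qed.

End Main.

Lemma Diso_sym (R : dgAlg) (X Y : dgMod R) (u : dmor X Y) :
  Diso u -> exists2 v, Diso v & deq (Dcomp v u) (Did X) /\ deq (Dcomp u v) (Did Y).
Proof. by move=> [v [vu uv]]; exists v => //; exists u. Qed.

(** With t = s g one has v t = g, hence g e b' t = v b b' t = g, and g cancels on the left. *)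
Lemma section_transport (R : dgAlg) (Y C M N : dgMod R) (e : dmor Y C) (b : dmor Y M)
    (g : dmor C N) (v : dmor M N) (b' : dmor M Y) (g' : dmor N C) (s : dmor N M) :
  deq (Dcomp b b') (Did M) -> deq (Dcomp g' g) (Did C) ->
  deq (Dcomp v b) (Dcomp g e) -> deq (Dcomp v s) (Did N) ->
  deq (Dcomp e (Dcomp b' (Dcomp s g))) (Did C).
Proof.
move=> bb gg sq vs; set t := Dcomp s g.
have vt : deq (Dcomp v t) g.
  apply: deq_trans (deq_assoc _ _ _) _.
  exact: deq_trans (deq_cong vs (deq_refl _)) (deq_idl _).
have gt : deq (Dcomp g (Dcomp e (Dcomp b' t))) g.
  apply: deq_trans (deq_assoc _ _ _) _.
  apply: deq_trans (deq_cong (deq_sym sq) (deq_refl _)) _.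
  apply: deq_trans (deq_sym (deq_assoc _ _ _)) _.
  apply: deq_trans _ vt; apply: deq_cong (deq_refl _) _.
  apply: deq_trans (deq_assoc _ _ _) _.
  exact: deq_trans (deq_cong bb (deq_refl _)) (deq_idl _).
apply: deq_trans (deq_sym (deq_idl _)) _.
apply: deq_trans (deq_cong (deq_sym gg) (deq_refl _)) _.
apply: deq_trans (deq_sym (deq_assoc _ _ _)) _.
exact: deq_trans (deq_cong (deq_refl _) gt) gg.
Qed.

Local Close Scope ring_scope.

Theorem proposition2p10 (k : fieldType) (A : localDgAlg k) (c : nat)
    (f : 'I_c -> A 0%R) (fm : forall i : 'I_c, max_ideal (f i))
    (B : koszul f) (L M N : dgMod B)
    (pL : perfect_over L) (pM : perfect_over M) (pN : perfect_over N)
    (u : dmor L M) (v : dmor M N) (w : dmor N (shift L))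
    (tri : exact_triangle u v w) (l : nat) :
  (forall p : hprime k c, jump_locus fm l M p ->
     exists i j : nat,
       i + j = l /\ jump_locus fm i L p /\ jump_locus fm j N p) /\
  ((exists s : dmor N M, deq (Dcomp v s) (Did N)) ->
   forall p : hprime k c, jump_locus fm l M p <->
     exists i j : nat,
       i + j = l /\ jump_locus fm i L p /\ jump_locus fm j N p).
Proof.
case: tri => X [Y [h [a [b [g [[ia ib ig] [_ sq _]]]]]]].
have [a' ia' _] := Diso_sym ia; have [b' ib' [b'b bb']] := Diso_sym ib.
have [g' ig' [g'g gg']] := Diso_sym ig.
have sub (p : hprime k c) : jump_locus fm l M p -> exists i j : nat,
    i + j = l /\ jump_locus fm i L p /\ jump_locus fm j N p.
  move=> /jump_locusE[T mT iT].
  have [TC [TY [t [mC mY mX _]]]] := fiber_model_cone fm p h.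
  have iY := fiber_model_iso ib' mT mY iT.
  have [i [j [ij iC iX]]] := Indep_cone (@kappa_d k c p) t iY.
  have [TL mL] := fiber_model_ex fm p L; have [TN mN] := fiber_model_ex fm p N.
  (* The order is reversed by contravariance: the source TC of t belongs to N, and the cone of t to
     L. *)
  exists j, i; rewrite addnC; split=> //; split; apply/jump_locusE.
    by exists TL => //; exact: fiber_model_iso ia mX mL iX.
  by exists TN => //; exact: fiber_model_iso ig mC mN iC.
split=> // -[s vs] p; split=> [|[i [j [ij [/jump_locusE[TL mL iL] /jump_locusE[TN mN iN]]]]]].
  exact: sub.
have [TC [TY [t [mC mY mX split_t]]]] := fiber_model_cone fm p h.
have [|t' tt] := split_t.
  exists (Dcomp b' (Dcomp s g)).
  exact: section_transport bb' g'g sq vs.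
have iC := fiber_model_iso ig' mN mC iN; have iX := fiber_model_iso ia' mL mX iL.
have [TM mM] := fiber_model_ex fm p M.
apply/jump_locusE; exists TM => //; apply: fiber_model_iso ib mY mM _.
by rewrite -ij addnC; exact: (Indep_cone_split (@kappa_d k c p) tt iC iX).
Qed.
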